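(* Let $N\ge5$, fix $o\in\mathbb{H}^N$ and let $r=\varrho(x,o)$ be the geodesic distance from $o$. For all $u\in C_c^\infty(\mathbb{H}^N)$, $$\int_{\mathbb{H}^N}|\Delta_{\mathbb{H}^N}u|^2dv_{\mathbb{H}^N}-\frac{(N-1)^4}{16}\int_{\mathbb{H}^N}u^2dv_{\mathbb{H}^N}\ge\frac{(N-1)^2}{8}\int_{\mathbb{H}^N}\frac{u^2}{r^2}dv_{\mathbb{H}^N}+\frac{9}{16}\int_{\mathbb{H}^N}\frac{u^2}{r^4}dv_{\mathbb{H}^N}+\frac{(N^2-1)(N-3)^2}{8}\int_{\mathbb{H}^N}\frac{u^2}{\sinh^2r}dv_{\mathbb{H}^N}+\frac{(N-1)(N-3)(N^2-4N-3)}{16}\int_{\mathbb{H}^N}\frac{u^2}{\sinh^4r}dv_{\mathbb{H}^N}.$$ The constant $\frac{(N-1)^4}{16}$ is sharp in the sense that the left-hand side can be negative if it is replaced by a larger constant. Furthermore, no inequality of the form $$\int_{\mathbb{H}^N}|\Delta_{\mathbb{H}^N}u|^2dv_{\mathbb{H}^N}-\frac{(N-1)^4}{16}\int_{\mathbb{H}^N}u^2dv_{\mathbb{H}^N}\ge c\int_{\mathbb{H}^N}\frac{u^2}{r^2}dv_{\mathbb{H}^N}$$ holds for all $u\in C_c^\infty(\mathbb{H}^N)$ when $c>\frac{(N-1)^2}{8}$.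
   Context: $\Delta_{\mathbb{H}^N}$ and $dv_{\mathbb{H}^N}$ denote the Laplace–Beltrami operator and Riemannian volume of the $N$-dimensional hyperbolic space $\mathbb{H}^N$. *)

(* Defs.v *)
(* Hyperbolic space H^N is realised as the
   Poincare ball model  B^N = { x in R^N : |x| < 1 }  with metric
   g = (2/(1-|x|^2))^2 (dx_1^2 + ... + dx_N^2).  Points of R^N are row
   vectors 'rV[R]_N. *)
From HB Require Import structures.
From mathcomp Require Import all_boot all_order all_algebra.
From mathcomp Require Import all_classical all_reals all_analysis.
Set Implicit Arguments. Unset Strict Implicit. Unset Printing Implicit Defensive.
Import Order.TTheory GRing.Theory Num.Theory.
Import numFieldNormedType.Exports.
Local Open Scope classical_set_scope.
Local Open Scope ring_scope.

Section Hyperbolic.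
Variables (R : realType) (N : nat).
Local Notation V := 'rV[R]_N.

Definition eucl2 (x : V) : R := \sum_(i < N) (x ord0 i) ^+ 2.

Definition inH (x : V) : Prop := eucl2 x < 1.

(* conformal factor: g_ij = conf x ^2 * delta_ij *)
Definition conf (x : V) : R := 2 / (1 - eucl2 x).

Definition ebase (i : 'I_N) : V := delta_mx ord0 i.

Definition dpart (i : 'I_N) (f : V -> R) : V -> R := 'D_(ebase i) f.

Fixpoint dparts (s : seq 'I_N) (f : V -> R) : V -> R :=
  match s with [::] => f | i :: s' => dpart i (dparts s' f) end.

Definition smooth (f : V -> R) : Prop :=
  forall s : seq 'I_N, continuous (dparts s f) /\
    forall (i : 'I_N) (x : V), derivable (dparts s f) x (ebase i).

(* u in C_c^infinity(H^N): a smooth function whose support is a compact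
   subset of the (open) ball; u is extended by 0 outside the ball. *)
Definition Cc_inf_H (u : V -> R) : Prop :=
  smooth u /\ compact (closure [set x | u x != 0]) /\
  closure [set x | u x != 0] `<=` inH.

(* Laplace-Beltrami operator of g = conf^2 * delta :
   Delta_g u = (det g)^(-1/2) d_i ( (det g)^(1/2) g^{ij} d_j u )
             = conf^(-N) sum_i d_i ( conf^(N-2) d_i u ).            *)
Definition LB (u : V -> R) (x : V) : R :=
  (conf x ^+ N)^-1 *
  \sum_(i < N) dpart i (fun y => conf y ^+ (N - 2) * dpart i u y) x.

Definition sinh (t : R) : R := (expR t - expR (- t)) / 2.
Definition acosh (t : R) : R := ln (t + Num.sqrt (t ^+ 2 - 1)).

Definition hdist (x y : V) : R :=
  acosh (1 + 2 * eucl2 (x - y) / ((1 - eucl2 x) * (1 - eucl2 y))).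

Definition setc (x : V) (i : 'I_N) (t : R) : V :=
  \row_(j < N) (if j == i then t else x ord0 j).

(* iterated Lebesgue integral over the coordinates listed in s
   (innermost = last element of s); by Tonelli this is the Lebesgue
   integral over R^{#s} for nonnegative measurable integrands *)
Fixpoint iint (s : seq 'I_N) (f : V -> \bar R) : V -> \bar R :=
  match s with
  | [::] => f
  | i :: s' => fun x =>
      (\int[@lebesgue_measure R]_(t in [set: R]) iint s' f (setc x i t))%E
  end.

Definition intRN (f : V -> \bar R) : \bar R := iint (enum 'I_N) f 0.

(* integral over H^N w.r.t. the Riemannian volume dv = conf^N dx *)
Definition hint (F : V -> R) : \bar R :=
  intRN (fun x => if `[< inH x >] then (F x * conf x ^+ N)%:E else 0%E).

End Hyperbolic.

(* Main.v *)
(* Put m = (N - 1) / 2 and let r be the distance to the pole.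

   The inequality holds pointwise up to a divergence.  Expanding the square of
   LB u - w / (2 r) + A u, where w = du/dr + m coth(r) u and
   A = m^2 + m (m - 1) / sinh(r)^2, and integrating by parts with
   Hess r = coth(r) (g - dr * dr), one finds that (LB u)^2 minus the weighted
   u^2 is a sum of squares plus a divergence.  The pole is excised by a cutoff
   at scale eps, whose contribution is O(eps^(N - 4)), and Fatou's lemma
   removes the cutoff.

   For the optimality take u = sinh(r)^(-m) r^(1/2) B((ln r - T) / L) with a
   bump B on (0, 1).  Conjugation by sinh^(-m) turns LB + m^2 into d^2/dr^2 up
   to exponentially small terms, and r^(1/2) is the virtual ground state of the
   one-dimensional Hardy inequality, so for L and T large the integral of
   (LB u)^2 exceeds that of m^4 u^2 + (m^2 / 2) u^2 / r^2 by an arbitrarily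
   small fraction of the integral of u^2 / r^2.  As r >= exp T on the support,
   that integral is itself negligible against the one of u^2. *)
Require Import Defs.
From HB Require Import structures.
From mathcomp Require Import all_boot all_order all_algebra.
From mathcomp Require Import all_classical all_reals all_analysis.
From mathcomp Require Import finmap measurable_realfun ring lra.
Set Implicit Arguments. Unset Strict Implicit. Unset Printing Implicit Defensive.
Import Order.TTheory GRing.Theory Num.Theory.
Import numFieldNormedType.Exports.
Local Open Scope classical_set_scope.
Local Open Scope ring_scope.

(** * Lebesgue measure on R^N *)

(** Writing u = sinh(r)^(-m) v turns the radial part of [LB] into v'' - A v, which is the origin of
    A, and w is sinh(r)^(-m) v'. For radial u the first square is then that of v'' - v' / (2 r); it
    vanishes at v = r^(3/2), the extremal of the one-dimensional Rellich inequality with constant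
    9/16. The cross term 2 m^2 v'^2 gives m^2 / 2 by Hardy's inequality. The tangential part of the
    gradient enters with a nonnegative coefficient, so no expansion in spherical harmonics is
    involved. Two obstacles shape the development. The distance is singular at the pole, so the
    geometry is computed first for cosh r, which is smooth on the whole ball and has Hessian cosh(r)
    g; the formulas for r follow by the chain rule off the pole. The integral is an iterated one
    with values in the extended reals: it has to be identified with the integral of a measure, and a
    signed divergence can be cancelled only after its positive and negative parts are shown to have
    equal finite integrals. *)

Section BorelRV.
Variables (R : realType) (N : nat).
Local Notation V := 'rV[R]_N.

Definition borelV := g_sigma_algebraType (@open V).

Lemma open_measurableV (U : set V) : open U -> measurable (U : set borelV).
Proof. by move=> oU; apply: sub_sigma_algebra. Qed.

Lemma continuous_measurableV (f : V -> R) :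
  continuous f -> measurable_fun [set: borelV] (f : borelV -> R).
Proof.
move=> /continuousP cf.
apply: (measurability (@RGenOpens.G R) (@RGenOpens.measurableE R)) => _ [_ [a [b ->]] <-].
by rewrite setTI; apply: open_measurableV; apply: cf; exact: interval_open.
Qed.

(** Balls of row vectors are cubes, so this countable union reduces measurability questions to one
    coordinate at a time. *)
Lemma open_rational_boxes (U : set V) : open U ->
  U = \bigcup_(p in [set p : 'rV[rat]_N * nat |
        ball (map_mx ratr p.1 : V) p.2.+1%:R^-1 `<=` U])
      ball (map_mx ratr p.1 : V) p.2.+1%:R^-1.
Proof.
move=> oU; apply/seteqP; split => [x Ux|x [p pU /pU//]].
have /nbhs_ballP[e /= e0 xeU] : nbhs x U by apply: open_nbhs_nbhs.
have [k ke] : exists k : nat, k.+1%:R^-1 < e / 2.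
  have e2 : 0 < e / 2 by rewrite divr_gt0.
  have [k _ /(_ k (leqnn k))/= kP] := near_infty_natSinv_lt (PosNum e2).
  by exists k.
have k0 : 0 < k.+1%:R^-1 :> R by rewrite invr_gt0.
have [q qx] : exists q : 'rV[rat]_N, forall i, `|ratr (q ord0 i) - x ord0 i| < k.+1%:R^-1.
  have H i : exists q : rat, `|ratr q - x ord0 i| < k.+1%:R^-1.
    have : x ord0 i - k.+1%:R^-1 < x ord0 i + k.+1%:R^-1.
      by rewrite ltrD2l gtrN.
    by move=> /rat_in_itvoo[q]; rewrite in_itv/= => /andP[q1 q2]; exists q; rewrite ltr_distl q1 q2.
  exists (\row_i sval (cid (H i))) => i; rewrite mxE.
  by case: cid.
exists (q, k) => /=.
  move=> y [_ qy]; apply: xeU; split=> // i j; rewrite [i]ord1.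
  rewrite /ball/= (splitr e).
  have := qy ord0 j; rewrite /ball/= !mxE => qyj.
  rewrite -(subrKA (ratr (q ord0 j))) (le_lt_trans (ler_normD _ _))//.
  rewrite ltrD// ?(lt_trans _ ke)//.
  by rewrite distrC; exact: qx.
by split=> // i j; rewrite [i]ord1 /ball/= mxE; exact: qx.
Qed.

(** It suffices to pull back rational cubes. Such a preimage is a rectangle: the coordinates other
    than [i] constrain the vector, and coordinate [i] constrains the new value. *)
Lemma measurable_setc (i : 'I_N) :
  measurable_fun [set: borelV * measurableTypeR R]
    (fun p => setc p.1 i p.2 : borelV).
Proof.
apply: measurability => // _ [U oU <-]; rewrite setTI.
rewrite (open_rational_boxes oU) preimage_bigcup.
rewrite bigcup_mkcond; apply: countable_bigcupT_measurable; first exact: countableP.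
move=> [q k] /=; case: ifP => _; last exact: measurable0.
set S := (X in measurable X).
have -> : S =
  [set p : V * R | forall j, j != i -> `|ratr (q ord0 j) - p.1 ord0 j| < k.+1%:R^-1] `&`
  [set p : V * R | `|ratr (q ord0 i) - p.2| < k.+1%:R^-1].
  apply/seteqP; split => [[x t] /= [_ H]|[x t] /= [H1 H2]].
    split=> [j ji|].
    - by have := H ord0 j; rewrite /ball/= !mxE (negbTE ji).
    - by have := H ord0 i; rewrite /ball/= !mxE eqxx.
  split; first by rewrite invr_gt0.
  move=> a j; rewrite [a]ord1 /ball/= !mxE; case: eqP => [->//|/eqP]; exact: H1.
apply: measurableI.
- rewrite (_ : [set _ | _] = [set x : borelV | forall j, j != i ->
     `|ratr (q ord0 j) - x ord0 j| < k.+1%:R^-1] `*` [set: measurableTypeR R]); last first.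
    by apply/seteqP; split => [[x t] /= H|[x t] /= []].
  apply: measurableX => //; apply: open_measurableV.
  rewrite (_ : [set _ | _] = \big[setI/setT]_(j < N | j != i)
    [set x : V | `|ratr (q ord0 j) - x ord0 j| < k.+1%:R^-1]); last first.
    apply/seteqP; split => x /=; rewrite -bigcap_seq_cond /bigcap/=.
      by move=> H j /= /andP[_ ji]; exact: H.
    by move=> H j ji; apply: H => /=; rewrite ji mem_index_enum.
  elim/big_ind : _ => [|A B oA oB|j _]; [exact: openT|exact: openI|].
  rewrite (_ : [set _ | _] = (fun x : V => x ord0 j) @^-1` ball (ratr (q ord0 j) : R) (k.+1%:R^-1 : R)) //.
  by apply: open_comp => [x _|]; [exact: coord_continuous|exact: ball_open].
- rewrite (_ : [set _ | _] = [set: borelV] `*` ball (ratr (q ord0 i) : R) (k.+1%:R^-1 : R)); last first.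
    by apply/seteqP; split => [[x t] /= H|[x t] /= []].
  by apply: measurableX => //; apply: open_measurable; exact: ball_open.
Qed.

End BorelRV.

(** * Iterated integration as a measure *)

Section IteratedIntegral.
Variables (R : realType) (N : nat).
Local Notation V := 'rV[R]_N.
Local Notation BV := (borelV R N).
Local Notation mR := (measurableTypeR R).
Implicit Types (s : seq 'I_N) (f g : V -> \bar R).
Local Open Scope ereal_scope.

(** The class of integrands for which Tonelli's theorem holds; it is stable under partial
    integration. *)
Definition pos_meas f := (forall x, 0 <= f x) /\ measurable_fun [set: BV] (f : BV -> \bar R).

Lemma iint_cat s t f x : iint (s ++ t) f x = iint s (iint t f) x.
Proof.
by elim: s x => //= i s ih x; apply: eq_integral => y _; exact: ih.
Qed.

Lemma pos_meas_setc i f : pos_meas f ->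
  measurable_fun [set: (BV * mR)%type] (fun p => f (setc p.1 i p.2)) .
Proof. by move=> [_ mf]; apply: (measurableT_comp mf); exact: measurable_setc. Qed.

Lemma pos_meas_setc1 i f x : pos_meas f ->
  measurable_fun [set: mR] (fun t => f (setc x i t)).
Proof.
move=> /(pos_meas_setc i) mf.
exact: (measurableT_comp mf (@pair1_measurable _ _ BV mR x)).
Qed.

Lemma iint_ge0 s f x : (forall x, 0 <= f x) -> 0 <= iint s f x.
Proof. by move=> f0; elim: s x => //= i s ih x; apply: integral_ge0. Qed.

(** Tonelli on [borelV] times the line: the parameter stays the full vector, whose integrated
    coordinate is overwritten by [setc]. *)
Lemma pos_meas_iint s f : pos_meas f -> pos_meas (iint s f).
Proof.
move=> pf; elim: s => //= i s ih; split=> [x|].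
  by apply: (@iint_ge0 (i :: s)); exact: pf.1.
have := @measurable_fun_fubini_tonelli_F _ _ BV mR R (@lebesgue_measure R)
  (fun p => iint s f (setc p.1 i p.2)).
by apply; [exact: pos_meas_setc|move=> p; apply: ih.1].
Qed.

Lemma iint_nneseries s (f : (V -> \bar R)^nat) x : (forall n, pos_meas (f n)) ->
  iint s (fun x => \sum_(n <oo) f n x) x = \sum_(n <oo) iint s (f n) x.
Proof.
move=> pf; elim: s x => //= i s ih x.
under eq_integral do rewrite ih.
rewrite integral_nneseries//= => n.
  by apply: pos_meas_setc1; exact: pos_meas_iint.
by move=> t _; apply: iint_ge0; exact: (pf n).1.
Qed.

Lemma iintD s f g x : pos_meas f -> pos_meas g ->
  iint s (fun x => f x + g x) x = iint s f x + iint s g x.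
Proof.
move=> pf pg; elim: s x => //= i s ih x.
under eq_integral do rewrite ih.
rewrite ge0_integralD//=.
- by move=> t _; apply: iint_ge0; exact: pf.1.
- by apply: pos_meas_setc1; exact: pos_meas_iint.
- by move=> t _; apply: iint_ge0; exact: pg.1.
- by apply: pos_meas_setc1; exact: pos_meas_iint.
Qed.

Lemma iint0 s (x : V) : iint s (fun=> 0 : \bar R) x = 0.
Proof.
elim: s x => //= i s ih x; under eq_integral do rewrite ih.
exact: integral0.
Qed.

Lemma iintZ s (k : R) f x : (0 <= k)%R -> pos_meas f ->
  iint s (fun x => k%:E * f x) x = k%:E * iint s f x.
Proof.
move=> k0 pf; elim: s x => //= i s ih x.
under eq_integral do rewrite ih.
rewrite ge0_integralZl//=.
- by apply: pos_meas_setc1; exact: pos_meas_iint.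
- by move=> t _; apply: iint_ge0; exact: pf.1.
Qed.

Lemma le_iint s f g x : pos_meas f -> pos_meas g -> (forall x, f x <= g x) ->
  iint s f x <= iint s g x.
Proof.
move=> pf pg fg; elim: s x => //= i s ih x.
apply: ge0_le_integral => //=.
- by move=> t _; apply: iint_ge0; exact: pf.1.
- by apply: pos_meas_setc1; exact: pos_meas_iint.
- by apply: pos_meas_setc1; exact: pos_meas_iint.
Qed.

Lemma iint_limn s (f : (V -> \bar R)^nat) x : (forall n, pos_meas (f n)) ->
  (forall x, {homo f ^~ x : n m / (n <= m)%N >-> n <= m}) ->
  iint s (fun x => limn (f ^~ x)) x = limn (fun n => iint s (f n) x).
Proof.
move=> pf nf; elim: s x => //= i s ih x.
under eq_integral do rewrite ih.
rewrite (@monotone_convergence _ mR R (@lebesgue_measure R) setT measurableT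
  (fun n t => iint s (f n) (setc x i t)))//=.
- by move=> n; apply: pos_meas_setc1; exact: pos_meas_iint.
- by move=> n t _; apply: iint_ge0; exact: (pf n).1.
- by move=> t _ n m nm; apply: le_iint => // y; exact: nf.
Qed.

(** Overwriting two distinct coordinates commutes, so this is Tonelli on the plane with the other
    coordinates frozen. *)
Lemma iint_swap i j s f x : i != j -> pos_meas f ->
  iint [:: i, j & s] f x = iint [:: j, i & s] f x.
Proof.
move=> ij pf /=.
have pg := pos_meas_iint s pf; set g := iint s f in pg *.
have setcC a b : setc (setc x i a) j b = setc (setc x j b) i a.
  apply/rowP => k; rewrite !mxE; case: (eqVneq k i) => [->|//].
  by rewrite (negbTE ij).
under [RHS]eq_integral do under eq_integral do rewrite -setcC.
apply: (@fubini_tonelli _ _ mR mR R (@lebesgue_measure R) (@lebesgue_measure R)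
  (fun p => g (setc (setc x i p.1) j p.2))); last by move=> p; exact: pg.1.
have H := pos_meas_setc j pg.
apply: (measurableT_comp H (_ : measurable_fun setT (fun p : mR * mR => (setc x i p.1 : BV, p.2)))).
apply/measurable_fun_pair => //.
apply: (measurableT_comp (measurable_setc i) (_ : measurable_fun setT (fun p : mR * mR => (x : BV, p.1)))).
by apply/measurable_fun_pair.
Qed.

Lemma iint_rcons i s f x : i \notin s -> pos_meas f ->
  iint (i :: s) f x = iint (rcons s i) f x.
Proof.
move=> is_ pf; elim: s is_ x => // j s ih; rewrite inE negb_or => /andP[ij /ih {}ih] x.
by rewrite iint_swap//=; apply: eq_integral => t _; exact: ih.
Qed.

(* Measuring sets by the iterated integral turns [intRN] into the integral against
   a measure, so that convergence theorems (Fatou) apply to it. *)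
Definition muV (A : set BV) : \bar R := intRN (fun x => (\1_A x)%:E).

Lemma pos_meas_indic (A : set BV) : measurable A -> pos_meas (fun x => (\1_A x)%:E).
Proof.
move=> mA; split=> [x|]; first by rewrite lee_fin.
by apply/measurable_EFinP; exact: measurable_indic.
Qed.

Let mu0 : muV set0 = 0.
Proof.
by rewrite /muV /intRN -[RHS](iint0 (enum 'I_N) 0%R); congr iint; apply/funext => x; rewrite indic0.
Qed.
Let mu_ge0 A : 0 <= muV A.
Proof. by apply: iint_ge0 => x; rewrite lee_fin. Qed.
Let mu_sigma : semi_sigma_additive muV.
Proof.
move=> F mF tF mUF.
have -> : muV (\bigcup_n F n) = \sum_(n <oo) muV (F n).
  rewrite /muV /intRN -iint_nneseries; last by move=> n; exact: pos_meas_indic.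
  congr iint; apply/funext => x.
  by rewrite indic_bigcup.
apply: is_cvg_nneseries => n _ _; exact: mu_ge0.
Qed.

HB.instance Definition _ := isMeasure.Build _ BV R muV mu0 mu_ge0 mu_sigma.

Import HBNNSimple.

(** The two sides agree on indicators by construction. Simple functions follow by linearity of
    [iint], and the general case by monotone convergence on both sides. *)
Lemma integral_muVE f : pos_meas f -> \int[muV]_x f x = intRN f.
Proof.
move=> [f0 mf]; pose g := nnsfun_approx measurableT mf.
have g_lim x : EFin \o (fun n => g n x) @ \oo --> f x.
  by apply: cvg_nnsfun_approx.
have g_nd x : {homo (fun n => g n x) : n m / (n <= m)%N >-> (n <= m)%R}.
  by move=> n m nm; exact/lefP/nd_nnsfun_approx.
have pg n : pos_meas (EFin \o g n).
  by split=> [x|]; [rewrite lee_fin; exact: fun_ge0|exact/measurable_EFinP].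
rewrite (nd_ge0_integral_lim muV f0 g_nd g_lim).
have -> : f = fun x => limn (fun n => (EFin \o g n) x).
  by apply/funext => x; apply/esym/cvg_lim => //; exact: g_lim.
rewrite /intRN iint_limn//.
apply: congr_lim; apply/funext => n /=; rewrite sintegralE.
under [in RHS]eq_fun do rewrite fimfunE -fsumEFin//.
rewrite fsbig_finite//=.
have -> : (fun x => \sum_(r \in range (g n)) (r * \1_(g n @^-1` [set r]) x)%:E) =
  (fun x => \sum_(r <- (enum_fset (fset_set (range (g n))))) r%:E * (\1_(g n @^-1` [set r]) x)%:E).
  by apply/funext => x; rewrite fsbig_finite//=; apply: eq_bigr => r _; rewrite EFinM.
have : forall r, r \in enum_fset (fset_set (range (g n))) -> (0 <= r)%R.
  by move=> r; rewrite -[_ \in _]/(r \in fset_set _) in_fset_set// => /set_mem[x _ <-]; exact: fun_ge0.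
elim: (enum_fset _) => [|r rs ih] r0.
  by rewrite big_nil -[LHS](iint0 (enum 'I_N) 0%R); congr iint; apply/funext => x; rewrite big_nil.
have r0' : (0 <= r)%R by apply: r0; rewrite mem_head.
have mr q : pos_meas (fun x => (\1_(g n @^-1` [set q]) x)%:E).
  by apply: pos_meas_indic; exact: measurable_sfunP.
rewrite big_cons ih; last by move=> q qr; apply: r0; rewrite inE qr orbT.
rewrite /muV /intRN -iintZ// -iintD.
- by congr iint; apply/funext => x; rewrite big_cons.
- split=> [x|]; first by apply: mule_ge0; [|exact: (mr r).1].
  by apply: measurable_funeM; exact: (mr r).2.
- split=> [x|].
    rewrite big_seq; apply: sume_ge0 => q qr; apply: mule_ge0; last exact: (mr q).1.
    by rewrite lee_fin; apply: r0; rewrite inE qr orbT.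
  by apply: emeasurable_sum => q; apply: measurable_funeM; exact: (mr q).2.
Qed.

(** Any coordinate can be made the innermost one, where the fundamental theorem of calculus applies
    to a derivative in that direction. *)
Lemma intRN_last i : exists s, forall f, pos_meas f ->
  intRN f = iint s (fun x => \int[@lebesgue_measure R]_t f (setc x i t)) 0%R.
Proof.
have : i \in enum 'I_N by rewrite mem_enum.
have := enum_uniq 'I_N; rewrite /intRN.
move=> /[swap] /splitPr[s1 s2]; rewrite cat_uniq /= => /and4P[_ _ is2 _].
exists (s1 ++ s2) => f pf.
rewrite iint_cat (_ : iint (i :: s2) f = iint (rcons s2 i) f).
  by rewrite -iint_cat -cats1 catA iint_cat.
by apply/funext => x; exact: iint_rcons.
Qed.

Definition boxV (c : V) (r : R) : set BV :=
  [set x : V | forall i, (`|x ord0 i - c ord0 i| <= r)%R].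

Lemma measurable_boxV c r : measurable (boxV c r).
Proof.
rewrite (_ : boxV c r = \big[setI/setT]_(j < N)
    [set x : V | (`|x ord0 j - c ord0 j| <= r)%R]); last first.
  apply/seteqP; split => x /=; rewrite -bigcap_seq /bigcap/=.
    by move=> H j /= _; exact: H.
  by move=> H j; apply: H => /=; rewrite mem_index_enum.
elim/big_ind : _ => [|A B oA oB|j _]; [exact: measurableT|exact: measurableI|].
rewrite -[X in measurable X]setCK; apply: measurableC.
apply: open_measurableV; rewrite openC.
rewrite (_ : [set _ | _] = (fun x : V => x ord0 j) @^-1` closed_ball_ Num.norm (c ord0 j) r) //.
  apply: preimage_closed => [x _|]; [exact: coord_continuous|exact: closed_closed_ball_].
by apply/seteqP; split=> x /=; rewrite distrC.
Qed.

(** Stated for a partial list of coordinates so that the induction closes: each integrated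
    coordinate contributes a side length, the others remain as a condition on [x]. *)
Lemma iint_box s c r x : uniq s -> (0 <= r)%R ->
  iint s (fun x => (\1_(boxV c r) x)%:E) x =
  ((r *+ 2) ^+ size s * (`[< forall i, i \notin s -> (`|x ord0 i - c ord0 i| <= r)%R >])%:R)%:E.
Proof.
move=> + r0; elim: s x => [|i s ih] x /=.
  move=> _; rewrite expr0 mul1r indicE; congr ((nat_of_bool _)%:R)%:E.
  apply/idP/idP => [/set_mem H|/asboolP H].
    by apply/asboolP => i _; exact: H.
  by apply/mem_set => i; exact: H.
move=> /andP[is_ us]; under eq_integral do rewrite ih//.
set P := `[< forall j, _ >].
have E t : `[< forall j, j \notin s -> (`|setc x i t ord0 j - c ord0 j| <= r)%R >]
  = (P && `[< (`|t - c ord0 i| <= r)%R >]).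
  apply/asboolP/andP => [H|[/asboolP H1 /asboolP H2] j js].
    split; apply/asboolP; last by have := H i is_; rewrite mxE eqxx.
    move=> j; rewrite inE negb_or => /andP[ji js].
    by have := H j js; rewrite mxE (negbTE ji).
  by rewrite mxE; case: eqP => [->//|/eqP ji]; apply: H1; rewrite inE (negbTE ji).
under eq_integral do rewrite E -mulnb natrM mulrA EFinM.
rewrite ge0_integralZl//=; last first.
- by rewrite lee_fin mulr_ge0// exprn_ge0// mulrn_wge0.
- apply/measurable_EFinP.
  rewrite (_ : (fun _ => _) = \1_(closed_ball_ Num.norm (c ord0 i) r)); last first.
    apply/funext => t; rewrite indicE; congr ((nat_of_bool _)%:R).
    by apply/asboolP/idP => [H|/set_mem]; [apply/mem_set|]; rewrite /closed_ball_/= distrC.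
  apply: measurable_indic.
  by rewrite -[X in measurable X]setCK; apply: measurableC; apply: open_measurable; rewrite openC; exact: closed_closed_ball_.
rewrite (eq_integral (fun t : mR => (\1_`[(c ord0 i - r)%R, (c ord0 i + r)%R] t)%:E)); last first.
  move=> t _; rewrite indicE; congr ((nat_of_bool _)%:R)%:E.
  by apply/asboolP/idP => [H|/set_mem]; [apply/mem_set; move: H|]; rewrite /= in_itv/= ler_distl.
rewrite integral_indic//= setIT lebesgue_measure_itv/= lte_fin.
(* The measure of an interval is given by a test on strictly ordered endpoints; the degenerate case
   is [r = 0], where both sides vanish. *)
case: ltP => [_|]; last first.
  rewrite lerD2l => rr; have -> : r = 0%R by apply/eqP; rewrite eq_le r0 andbT; move: rr; rewrite lerNr; nra.
  by rewrite mul0rn !mule0 exprS !mul0r.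
by rewrite -EFinB -EFinM exprS; congr EFin; ring.
Qed.

Lemma muV_box c r : (0 <= r)%R -> muV (boxV c r) = ((r *+ 2) ^+ N)%:E.
Proof.
move=> r0; rewrite /muV /intRN iint_box ?enum_uniq//.
rewrite size_enum_ord (_ : asbool _ = true) ?mulr1//.
by apply/asboolP => i; rewrite mem_enum.
Qed.

End IteratedIntegral.

(** * Functions of class C^n *)

Section DeriveRules.
Variables (R : realType) (V : normedModType R).
Implicit Types (f g : V -> R) (x v : V) (a b : R).

Lemma is_derive_cstE x v (c : R) : is_derive x v (fun=> c) 0.
Proof. exact: is_derive_cst. Qed.

Lemma is_derive_add f g x v a b : is_derive x v f a -> is_derive x v g b ->
  is_derive x v (fun y => f y + g y) (a + b).
Proof. by move=> *; exact: is_deriveD. Qed.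

Lemma is_derive_opp f x v a : is_derive x v f a ->
  is_derive x v (fun y => - f y) (- a).
Proof. by move=> *; exact: is_deriveN. Qed.

Lemma is_derive_mul f g x v a b : is_derive x v f a -> is_derive x v g b ->
  is_derive x v (fun y => f y * g y) (a * g x + f x * b).
Proof.
move=> df dg; apply: (is_derive_eq (@is_deriveM _ _ f g x v a b df dg)).
by rewrite /GRing.scale/= addrC mulrC.
Qed.

Lemma is_derive_natpow f x v a n : is_derive x v f a ->
  is_derive x v (fun y => f y ^+ n) (n%:R * f x ^+ n.-1 * a).
Proof.
move=> df; elim: n => [|n ih].
  rewrite mul0r mul0r; apply: is_derive_eq; last reflexivity.
  under [X in is_derive _ _ X]eq_fun do rewrite expr0; exact: is_derive_cst.
under eq_fun do rewrite exprS.
apply: (is_derive_eq (is_derive_mul df ih)).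
case: n {ih} => [|n] /=; first by rewrite expr0; ring.
by rewrite exprS -(natr1 n.+1); ring.
Qed.

Lemma is_derive_bigsum (I : Type) (r : seq I) (P : pred I) (F : I -> V -> R) (dF : I -> R) x v :
  (forall i, is_derive x v (F i) (dF i)) ->
  is_derive x v (fun y => \sum_(i <- r | P i) F i y) (\sum_(i <- r | P i) dF i).
Proof.
move=> dfF; elim: r => [|i r ih].
  under eq_fun do rewrite big_nil; rewrite big_nil; exact: is_derive_cst.
under eq_fun do rewrite big_cons; rewrite big_cons.
by case: ifP => // _; exact: is_derive_add.
Qed.

(** Restriction to a line, from which the chain rule is inherited from the one-variable case. *)
Lemma is_derive_line f x v a :
  is_derive x v f a <-> is_derive (0 : R) (1 : R) (fun t : R => f (t *: v + x)) a.
Proof.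
have E : (fun h : R => h^-1 *: (((fun t : R => f (t *: v + x)) \o shift 0) (h *: 1) - f (0 *: v + x)))
  = (fun h : R => h^-1 *: ((f \o shift x) (h *: v) - f x)).
  apply/funext => h /=; rewrite addr0 scale0r add0r.
  by rewrite -[h *: 1]/(h * 1) mulr1.
by split=> -[df <-]; split; rewrite /derivable /derive ?E // -E.
Qed.

Lemma is_derive_comp (phi : R -> R) f x v a b :
  is_derive (f x) (1 : R) phi b -> is_derive x v f a ->
  is_derive x v (fun y => phi (f y)) (b * a).
Proof.
move=> dphi /is_derive_line df; apply/is_derive_line.
apply: (@is_derive1_comp _ phi (fun t : R => f (t *: v + x))) => //.
by rewrite scale0r add0r.
Qed.

Lemma is_derive_inv f x v a : f x != 0 -> is_derive x v f a ->
  is_derive x v (fun y => (f y)^-1) (- a / f x ^+ 2).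
Proof.
move=> fx0 df; apply: is_derive_eq.
  apply: (@is_derive_comp (fun y => y^-1)) df.
  exact: (@is_deriveV _ id).
by rewrite /GRing.scale/= mulr1 expr2 invfM; ring.
Qed.

Lemma is_derive_open (D : set V) f g x v a : open D -> D x ->
  (forall y, D y -> f y = g y) -> is_derive x v f a -> is_derive x v g a.
Proof.
move=> oD Dx fg; apply: near_eq_is_derive.
by apply: filterS (open_nbhs_nbhs (conj oD Dx)) => y /fg.
Qed.

End DeriveRules.

(** Differentiates along the syntax of the function and leaves the derivative to unification;
    [eassumption] supplies the atoms from the context, and nonvanishing denominators remain as
    goals. *)
Ltac der := repeat first
  [ notypeclasses refine (is_derive_cstE _ _ _)
  | notypeclasses refine (is_derive_id _ _)
  | eassumption
  | notypeclasses refine (is_derive_opp _)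
  | notypeclasses refine (is_derive_add _ _)
  | notypeclasses refine (is_derive_mul _ _)
  | notypeclasses refine (is_derive_natpow _ _)
  | notypeclasses refine (is_derive_inv _ _) ].
Ltac der_eq := notypeclasses refine (is_derive_eq _ _); [der|]; cbv beta.

Section Cn.
Variables (R : realType) (N : nat).
Local Notation V := 'rV[R]_N.
Implicit Types (D : set V) (f g : V -> R) (x : V) (i : 'I_N).

(** Finite order and a domain are tracked because radial functions are regular only off the pole.
    Continuity and derivatives at a point of [D] are taken in the whole space, not within [D]. *)
Fixpoint Cn n D f : Prop := (forall x, D x -> {for x, continuous f}) /\
  match n with 0 => True | n'.+1 =>
    forall i, (forall x, D x -> derivable f x (ebase R i)) /\ Cn n' D (dpart i f) end.

Lemma CnE n D f : Cn n D f -> forall x, D x -> {for x, continuous f}.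
Proof. by case: n => [|n] []. Qed.

Lemma Cn_dpart n D f i : Cn n.+1 D f -> Cn n D (dpart i f).
Proof. by case=> _ /(_ i)[]. Qed.

Lemma Cn_is_derive n D f i x : Cn n.+1 D f -> D x ->
  is_derive x (ebase R i) f (dpart i f x).
Proof. by case=> _ /(_ i)[+ _] => /[apply] df; exact: derivableP. Qed.

Lemma CnS n D f : Cn n.+1 D f -> Cn n D f.
Proof.
elim: n f => [|n ih] f; first by case.
move=> [cf df]; split=> // i; split; first exact: (df i).1.
by apply: ih; exact: (df i).2.
Qed.

Lemma Cn_le m n D f : (m <= n)%N -> Cn n D f -> Cn m D f.
Proof.
move=> /subnK <-; elim: (n - m)%N => // k ih; rewrite addSn => /CnS; exact: ih.
Qed.

(** All conditions are pointwise with ambient neighbourhoods. This glues the fields that are defined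
    by different formulas near the pole, off the support and in between. *)
Lemma Cn_local n D f : (forall x, D x -> exists D', D' x /\ Cn n D' f) -> Cn n D f.
Proof.
elim: n f => [|n ih] f H.
  by split=> // x Dx; have [D' [D'x /CnE]] := H x Dx; apply.
split=> [x Dx|i]; first by have [D' [D'x /CnE]] := H x Dx; apply.
split=> [x Dx|].
  by have [D' [D'x [_ /(_ i)[+ _]]]] := H x Dx; apply.
apply: ih => x Dx; have [D' [D'x /Cn_dpart fD']] := H x Dx.
by exists D'.
Qed.

Lemma Cn_sub n D D' f : D' `<=` D -> Cn n D f -> Cn n D' f.
Proof. by move=> DD fD; apply: Cn_local => x /DD Dx; exists D. Qed.

Lemma dpart_open D f g i x : open D -> D x -> (forall y, D y -> f y = g y) ->
  dpart i f x = dpart i g x.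
Proof.
move=> oD Dx fg; apply: near_eq_derive; near=> y.
by apply: fg; near: y; exact: open_nbhs_nbhs.
Unshelve. all: by end_near.
Qed.

Lemma continuous_open D f g x : open D -> D x -> (forall y, D y -> f y = g y) ->
  {for x, continuous f} -> {for x, continuous g}.
Proof.
move=> oD Dx fg; rewrite /prop_for /continuous_at -fg//.
move=> cf.
have H : {near nbhs x, f =1 g}.
  by apply: filterS (open_nbhs_nbhs (conj oD Dx)) => y /fg.
exact: cvg_trans (near_eq_cvg H) cf.
Qed.

Lemma Cn_ext n D f g : open D -> (forall y, D y -> f y = g y) ->
  Cn n D f -> Cn n D g.
Proof.
move=> oD; elim: n f g => [|n ih] f g fg fD.
  by split=> // x Dx; apply: (continuous_open oD Dx fg); exact: (CnE fD).
split=> [x Dx|i].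
  by apply: (continuous_open oD Dx fg); exact: (CnE fD).
split=> [x Dx|].
  apply: (@ex_derive _ _ _ _ _ _ (dpart i f x)).
  by apply: (is_derive_open oD Dx fg); exact: Cn_is_derive fD _.
apply: (ih (dpart i f)); last exact: Cn_dpart.
by move=> y Dy; exact: (dpart_open _ oD Dy).
Qed.

Lemma Cn_intro n D f (df : 'I_N -> V -> R) : open D ->
  (forall x, D x -> {for x, continuous f}) ->
  (forall i x, D x -> is_derive x (ebase R i) f (df i x)) ->
  (forall i, Cn n D (df i)) -> Cn n.+1 D f.
Proof.
move=> oD cf H dfD; split=> // i; split.
  by move=> x Dx; have [] := H i x Dx.
by apply: Cn_ext (dfD i) => // y Dy; rewrite /dpart; apply/esym/derive_val; exact: H.
Qed.

Lemma Cn_cst n D (c : R) : open D -> Cn n D (fun=> c).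
Proof.
move=> oD; elim: n c => [|n ih] c.
  by split=> // x _; exact: cst_continuous.
apply: (@Cn_intro _ _ _ (fun _ _ => 0)) => // x _; exact: cst_continuous.
Qed.

Lemma is_derive_coord i j x :
  is_derive x (ebase R i) (fun y : V => y ord0 j) (i == j)%:R.
Proof.
apply/is_derive_line.
rewrite (_ : (fun t => _) = (fun t : R => (j == i)%:R * t + x ord0 j)); last first.
  apply/funext => t; rewrite !mxE eqxx/= mulrC; congr (_ * _ + _).
der_eq.
by rewrite eq_sym; ring.
Qed.

Lemma Cn_coord n D j : open D -> Cn n D (fun y => y ord0 j).
Proof.
move=> oD; case: n => [|n].
  by split=> // x _; exact: coord_continuous.
apply: (@Cn_intro _ _ _ (fun i _ => (i == j)%:R)) => // [x _|i x _|i].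
- exact: coord_continuous.
- exact: is_derive_coord.
- exact: Cn_cst.
Qed.

Lemma Cn_add n D f g : open D -> Cn n D f -> Cn n D g -> Cn n D (fun y => f y + g y).
Proof.
move=> oD; elim: n f g => [|n ih] f g fD gD.
  by split=> // x Dx; apply: continuousD; [exact: (CnE fD)|exact: (CnE gD)].
apply: (@Cn_intro _ _ _ (fun i y => dpart i f y + dpart i g y)) => // [x Dx|i x Dx|i].
- by apply: continuousD; [exact: (CnE fD)|exact: (CnE gD)].
- by apply: is_derive_add; [exact: Cn_is_derive fD _|exact: Cn_is_derive gD _].
- by apply: ih; exact: Cn_dpart.
Qed.

Lemma Cn_mul n D f g : open D -> Cn n D f -> Cn n D g -> Cn n D (fun y => f y * g y).
Proof.
move=> oD; elim: n f g => [|n ih] f g fD gD.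
  by split=> // x Dx; apply: continuousM; [exact: (CnE fD)|exact: (CnE gD)].
apply: (@Cn_intro _ _ _ (fun i y => dpart i f y * g y + f y * dpart i g y)) => // [x Dx|i x Dx|i].
- by apply: continuousM; [exact: (CnE fD)|exact: (CnE gD)].
- by apply: is_derive_mul; [exact: Cn_is_derive fD _|exact: Cn_is_derive gD _].
- by apply: Cn_add => //; apply: ih => //; do ?[exact: Cn_dpart|exact: CnS].
Qed.

Lemma Cn_opp n D f : open D -> Cn n D f -> Cn n D (fun y => - f y).
Proof.
move=> oD fD; have := Cn_mul oD (Cn_cst n (-1) oD) fD.
by apply: Cn_ext => // y _; rewrite mulN1r.
Qed.

Lemma Cn_exp n D f k : open D -> Cn n D f -> Cn n D (fun y => f y ^+ k).
Proof.
move=> oD fD; elim: k => [|k ih].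
  by under eq_fun do rewrite expr0; exact: Cn_cst.
by under eq_fun do rewrite exprS; exact: Cn_mul.
Qed.

Lemma Cn_bigsum n D (I : Type) (r : seq I) (F : I -> V -> R) : open D ->
  (forall k, Cn n D (F k)) -> Cn n D (fun y => \sum_(k <- r) F k y).
Proof.
move=> oD FD; elim: r => [|k r ih].
  by under eq_fun do rewrite big_nil; exact: Cn_cst.
by under eq_fun do rewrite big_cons; exact: Cn_add.
Qed.

(* [P] is any family containing [h] and closed under derivation on [E]; it plays
   the role of smoothness of [h]. *)
Lemma Cn_comp n D (E : set R) (P : (R -> R) -> Prop) (h : R -> R) f : open D ->
  (forall h, P h -> exists h', P h' /\ forall t, E t -> is_derive t (1 : R) h (h' t)) ->
  P h -> (forall x, D x -> E (f x)) -> Cn n D f -> Cn n D (fun y => h (f y)).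
Proof.
move=> oD PP Ph DE; elim: n h Ph => [|n ih] h Ph fD.
  split=> // x Dx; have [h' [_ dh]] := PP _ Ph.
  have [/derivable1_diffP/differentiable_continuous ch _] := dh (f x) (DE x Dx).
  by apply: continuous_comp; [exact: (CnE fD)|exact: ch].
have [h' [Ph' dh]] := PP _ Ph.
apply: (@Cn_intro _ _ _ (fun i y => h' (f y) * dpart i f y)) => // [x Dx|i x Dx|i].
- have [/derivable1_diffP/differentiable_continuous ch _] := dh (f x) (DE x Dx).
  by apply: continuous_comp; [exact: (CnE fD)|exact: ch].
- by apply: is_derive_comp; [apply: dh; exact: DE|exact: Cn_is_derive fD _].
- by apply: Cn_mul => //; [apply: ih => //; exact: CnS|exact: Cn_dpart].
Qed.

Lemma Cn_inv n D f : open D -> (forall x, D x -> f x != 0) ->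
  Cn n D f -> Cn n D (fun y => (f y)^-1).
Proof.
move=> oD f0 fD.
apply: (@Cn_comp _ _ [set t | t != 0] (fun h => exists c k, h = fun t : R => c * t^-1 ^+ k)
   (fun t => t^-1)) => //; last by exists 1, 1%N; apply/funext => t; rewrite mul1r.
move=> _ [c [k ->]]; exists (fun t : R => (- c * k%:R) * t^-1 ^+ k.+1); split.
  by exists (- c * k%:R), k.+1.
move=> t /= t0; der_eq => //.
case: k => [|k] /=; first by rewrite !mul0r !mulr0 !mul0r addr0.
by rewrite !exprS; move: (t^-1 ^+ k) => a; field.
Qed.

Lemma Cn_expR n D f : open D -> Cn n D f -> Cn n D (fun y => expR (f y)).
Proof.
move=> oD fD; apply: (@Cn_comp _ _ setT (fun h => h = expR)) => // h ->.
by exists expR; split => // t _; exact: is_derive_expR.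
Qed.

Lemma Cn_ln n D f : open D -> (forall x, D x -> 0 < f x) ->
  Cn n D f -> Cn n D (fun y => ln (f y)).
Proof.
move=> oD f0; case: n => [|n] fD.
  split=> // x Dx; apply: continuous_comp; first exact: (CnE fD).
  by apply: continuous_ln; exact: f0.
apply: (@Cn_intro _ _ _ (fun i y => (f y)^-1 * dpart i f y)) => // [x Dx|i x Dx|i].
- apply: continuous_comp; first exact: (CnE fD).
  by apply: continuous_ln; exact: f0.
- by apply: is_derive_comp; [apply: is_derive1_ln; exact: f0|exact: Cn_is_derive fD _].
- apply: Cn_mul => //; [apply: Cn_inv => //|exact: Cn_dpart].
    by move=> x Dx; rewrite gt_eqF ?f0.
  exact: CnS.
Qed.

Lemma dparts_rcons s i f : dparts (rcons s i) f = dparts s (dpart i f).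
Proof. by elim: s => //= j s ->. Qed.

(** [dparts] adds derivatives on the outside while [Cn] takes them from the inside; [dparts_rcons]
    and induction from the end of the list reconcile the two. *)
Lemma smoothP f : smooth f <-> forall n, Cn n setT f.
Proof.
split.
  move=> sf n; elim: n f sf => [|n ih] f sf.
    by split=> // x _; exact: (sf [::]).1.
  split=> [x _|i]; first exact: (sf [::]).1.
  split=> [x _|]; first exact: (sf [::]).2.
  apply: ih => s; have := sf (rcons s i); by rewrite dparts_rcons.
move=> H s; elim/last_ind: s f H => [|s i ih] f H /=.
  split=> [x|i x]; first exact: (CnE (H 0%N)).
  by exact: ((H 1%N).2 i).1.
by rewrite dparts_rcons; apply: ih => n; apply: Cn_dpart; exact: H.
Qed.

End Cn.

(** * Mean values along lines and symmetry of mixed partial derivatives *)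

Section LineMVT.
Variables (R : realType) (V : normedModType R).

Lemma is_derive_line_at (f : V -> R) (x v : V) (t a : R) :
  is_derive (t *: v + x) v f a -> is_derive t (1 : R) (fun s : R => f (s *: v + x)) a.
Proof.
have E : (fun h : R => h^-1 *: (((fun s : R => f (s *: v + x)) \o shift t) (h *: 1) - f (t *: v + x)))
  = (fun h : R => h^-1 *: ((f \o shift (t *: v + x)) (h *: v) - f (t *: v + x))).
  apply/funext => h /=.
  by rewrite -[h *: 1]/(h * 1) mulr1 scalerDl addrA.
by move=> -[df <-]; split; rewrite /derivable /derive ?E // -E.
Qed.

Lemma MVT_line (f df : V -> R) (x v : V) (h : R) : 0 < h ->
  (forall t, 0 <= t <= h -> is_derive (t *: v + x) v f (df (t *: v + x))) ->
  exists2 c, 0 < c < h & f (h *: v + x) - f x = h * df (c *: v + x).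
Proof.
move=> h0 H.
have dline t : 0 <= t <= h -> is_derive t (1 : R) (fun s : R => f (s *: v + x)) (df (t *: v + x)).
  by move=> th; apply: is_derive_line_at; exact: H.
have [||c] := @MVT R (fun t => f (t *: v + x)) (fun t => df (t *: v + x)) 0 h h0.
- move=> t; rewrite in_itv/= => /andP[t0 th]; apply: dline.
  by rewrite (ltW t0) (ltW th).
- apply: continuous_in_subspaceT => t /set_mem; rewrite /= in_itv/= => /dline[+ _].
  by move=> /derivable1_diffP/differentiable_continuous.
rewrite in_itv/= => ch E; exists c => //.
by move: E; rewrite scale0r add0r subr0 mulrC.
Qed.

End LineMVT.

Lemma le_two_halves (R : realType) (a b c eps : R) :
  `|a - c| < eps / 2 -> `|b - c| < eps / 2 -> `|a - b| <= eps.
Proof. by move=> ac bc; have := ler_distD c a b; have := distrC c b; lra. Qed.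

Section Schwarz.
Variables (R : realType) (N : nat).
Local Notation V := 'rV[R]_N.
Local Notation e := (ebase R).

Lemma is_derive_trans (f : V -> R) (x y v : V) a :
  is_derive (y + x) v f a -> is_derive x v (fun z => f (y + z)) a.
Proof.
have E : (fun h : R => h^-1 *: (((fun z => f (y + z)) \o shift x) (h *: v) - f (y + x)))
  = (fun h : R => h^-1 *: ((f \o shift (y + x)) (h *: v) - f (y + x))).
  by apply/funext => h /=; rewrite addrCA.
by move=> -[df <-]; split; rewrite /derivable /derive ?E // -E.
Qed.

Let ball_corner (x : V) (i j : 'I_N) (a b r : R) : 0 <= a -> 0 <= b -> a + b < r ->
  ball x r (a *: e i + (b *: e j + x)).
Proof.
move=> a0 b0 abr; split; first by apply: le_lt_trans abr; rewrite addr_ge0.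
move=> k l; rewrite [k]ord1 /ball/= !mxE !eqxx/=.
rewrite (_ : _ - _ = - (a * (l == i)%:R + b * (l == j)%:R)); last by ring.
rewrite normrN.
rewrite ger0_norm ?addr_ge0 ?mulr_ge0//; apply: le_lt_trans abr.
by case: (l == i); case: (l == j); rewrite ?mulr1 ?mulr0 ?addr0 ?add0r// ?lerDl ?lerDr ?addr_ge0.
Qed.

(** Two mean value steps, first along [e i] for the increment of [u] in direction [j], then along
    [e j]. The left side is symmetric in [i] and [j], which makes the mixed partials agree in the
    limit. *)
Let second_difference (D : set V) (u : V -> R) (x : V) i j (r h : R) :
  Cn 2 D u -> ball x r `<=` D -> 0 < h -> h + h < r ->
  exists2 p, ball x (h + h) p &
  u (h *: e i + (h *: e j + x)) - u (h *: e i + x) - (u (h *: e j + x) - u x)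
  = h * (h * dpart j (dpart i u) p).
Proof.
move=> u2 xD h0 hr.
have inD a b : 0 <= a <= h -> 0 <= b <= h -> D (b *: e j + (a *: e i + x)).
  move=> /andP[a0 ah] /andP[b0 bh]; apply: xD; apply: ball_corner => //.
  by apply: le_lt_trans hr; rewrite lerD.
have h0h : 0 <= h <= h by apply/andP; split => //; exact: ltW.
have z0h : (0 : R) <= 0 <= h by apply/andP; split => //; exact: ltW.
pose w y := u (h *: e j + y) - u y.
have [|c /andP[c0 ch] wE] := @MVT_line R V w (fun y => dpart i u (h *: e j + y) - dpart i u y) x (e i) h h0.
  move=> t th; apply: is_derive_add.
    by apply: is_derive_trans; apply: (Cn_is_derive _ u2); exact: inD.
  apply: is_derive_opp; apply: (Cn_is_derive _ u2).
  by have := inD t 0 th z0h; rewrite scale0r add0r.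
have [|d /andP[d0 dh] dE] := @MVT_line R V (dpart i u) (dpart j (dpart i u)) (c *: e i + x) (e j) h h0.
  move=> t th; apply: (Cn_is_derive _ (Cn_dpart i u2)); apply: inD => //.
  by rewrite (ltW c0) (ltW ch).
exists (d *: e j + (c *: e i + x)).
  by apply: ball_corner; rewrite ?ltW// ltrD.
rewrite -dE -wE /w; rewrite addrCA; ring.
Qed.

Lemma dpartC (D : set V) (u : V -> R) (x : V) i j : open D -> D x -> Cn 2 D u ->
  dpart i (dpart j u) x = dpart j (dpart i u) x.
Proof.
move=> oD Dx u2.
have [r r0 xD] : exists2 r, 0 < r & ball x r `<=` D.
  have /nbhs_ballP[r /= r0 xD] : nbhs x D by exact: open_nbhs_nbhs.
  by exists r.
have cij a b : {for x, continuous (dpart a (dpart b u))}.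
  by apply: (CnE (n := 0) _ Dx); do 2 apply: Cn_dpart.
apply/eqP; rewrite -subr_eq0 -normr_le0; apply/ler_addgt0Pr => eps eps0.
rewrite add0r.
have e2 : 0 < eps / 2 by rewrite divr_gt0.
have /cvgrPdist_lt /(_ _ e2) /nbhs_ballP[r1 /= r10 c1] := cij i j.
have /cvgrPdist_lt /(_ _ e2) /nbhs_ballP[r2 /= r20 c2] := cij j i.
(* Both intermediate points lie within [h + h] of [x], hence within all three radii. *)
pose h := Num.min r (Num.min r1 r2) / 4.
have m0 : 0 < Num.min r (Num.min r1 r2) by rewrite !lt_min r0 r10 r20.
have h0 : 0 < h by rewrite divr_gt0.
have hm : h + h < Num.min r (Num.min r1 r2) by rewrite /h; lra.
have [hr h1 h2] : [/\ h + h < r, h + h < r1 & h + h < r2].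
  by move: hm; rewrite !lt_min => /and3P[].
have [p xp pE] := second_difference i j u2 xD h0 hr.
have [q xq qE] := second_difference j i u2 xD h0 hr.
have pq : dpart j (dpart i u) p = dpart i (dpart j u) q.
  have hn0 : h != 0 by rewrite gt_eqF.
  apply: (mulfI hn0); apply: (mulfI hn0).
  transitivity (u (h *: e i + (h *: e j + x)) - u (h *: e i + x) - (u (h *: e j + x) - u x)).
    by rewrite -pE.
  by rewrite -qE addrCA; ring.
have H1 : `|dpart j (dpart i u) x - dpart j (dpart i u) p| < eps / 2.
  by apply: c2; apply: le_ball xp; exact: ltW.
have H2 : `|dpart i (dpart j u) x - dpart i (dpart j u) q| < eps / 2.
  by apply: c1; apply: le_ball xq; exact: ltW.
rewrite -pq in H2.
have H3 := le_two_halves H2 H1.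
exact: H3.
Qed.

End Schwarz.

(** * The divergence theorem *)

Section Divergence.
Variables (R : realType) (N : nat).
Local Notation V := 'rV[R]_N.
Local Notation BV := (borelV R N).
Local Notation mR := (measurableTypeR R).
Local Notation mu := (@muV R N).

Lemma integral_box_bounded (h : V -> R) c M K : 0 <= M ->
  measurable_fun [set: BV] (h : BV -> R) ->
  (forall x, `|h x| <= K * \1_(boxV c M) x) ->
  mu.-integrable setT (fun x => (h x)%:E) .
Proof.
move=> M0 mh hK.
have K0 : mu.-integrable setT (fun x => (K * \1_(boxV c M) x)%:E).
  apply: (@integrableZl _ BV R mu setT measurableT K (fun x => (\1_(boxV c M) x)%:E)).
  apply/integrableP; split.
    by apply/measurable_EFinP; apply: measurable_indic; exact: measurable_boxV.
  under eq_integral do rewrite gee0_abs ?lee_fin//.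
  rewrite integral_indic//; last exact: measurable_boxV.
  by rewrite setIT [X in (X < _)%E](muV_box c M0) ltry.
apply: le_integrable K0 => //; first exact/measurable_EFinP.
by move=> x _ /=; rewrite lee_fin (le_trans (hK x))// ler_norm.
Qed.

Lemma compact_boxV (c : V) M : compact (boxV c M : set V).
Proof.
apply: bounded_closed_compact.
  exists (`|c| + `|M|); split; first by rewrite num_real.
  move=> t tM x xM; apply: (le_trans _ (ltW tM)).
  rewrite -(subrK c x) addrC (le_trans (ler_normD _ _))// lerD2l.
  rewrite [leLHS]/Num.norm/= mx_normrE; apply/bigmax_leP; split=> [//|[k l] _ /=].
  by rewrite [k]ord1 !mxE (le_trans (xM l))// ler_norm.
rewrite (_ : boxV c M = \bigcap_(j : 'I_N)
    [set x : V | (`|x ord0 j - c ord0 j| <= M)%R]); last first.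
  by apply/seteqP; split => x /= H j; [move=> _; exact: H|exact: (H j Logic.I)].
apply: closed_bigI => j _.
rewrite (_ : [set _ | _] = (fun x : V => x ord0 j) @^-1` closed_ball_ Num.norm (c ord0 j) M) //.
  apply: preimage_closed => [x _|]; [exact: coord_continuous|exact: closed_closed_ball_].
by apply/seteqP; split=> x /=; rewrite distrC.
Qed.

Lemma continuous_bounded_box (h : V -> R) c M : continuous h ->
  (forall x, ~ boxV c M x -> h x = 0) ->
  exists2 K, 0 <= K & forall x, `|h x| <= K * \1_(boxV c M) x.
Proof.
move=> ch h0.
have : compact (h @` (boxV c M : set V)).
  by apply: (continuous_compact _ (@compact_boxV c M)); apply: continuous_subspaceT.
move=> /compact_bounded[K [_ HK]].
exists (`|K| + 1) => [|x]; first by rewrite addr_ge0.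
rewrite indicE; case: (boolP (x \in boxV c M)) => [/set_mem xB|/negP xB].
  by rewrite mulr1; apply: (HK (`|K| + 1)); [rewrite ltr_pwDr// ler_norm|exists x].
by rewrite h0 ?normr0 ?mulr0// => xB'; apply: xB; exact/mem_set.
Qed.

Lemma integrable_continuous_box (h : V -> R) c M : 0 <= M -> continuous h ->
  (forall x, ~ boxV c M x -> h x = 0) -> mu.-integrable setT (fun x => (h x)%:E).
Proof.
move=> M0 ch h0; have [K _ HK] := continuous_bounded_box ch h0.
by apply: integral_box_bounded HK => //; exact: continuous_measurableV.
Qed.

Local Open Scope ereal_scope.

(** The integral of a compactly supported derivative is zero, in a form without subtraction, so that
    it can be put under further iterated integrals. *)
Lemma integral_funepos_funeneg (phi dphi : R -> R) (M : R) : (0 < M)%R ->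
  continuous dphi -> (forall t, is_derive t (1%R : R) phi (dphi t)) ->
  (forall t, (M <= `|t|)%R -> phi t = 0%R) -> (forall t, (M < `|t|)%R -> dphi t = 0%R) ->
  \int[@lebesgue_measure R]_t (EFin \o dphi)^\+ t = \int[@lebesgue_measure R]_t (EFin \o dphi)^\- t.
Proof.
move=> M0 cd dphiE phi0 dphi0.
have cphi : continuous phi.
  by move=> t; have [/derivable1_diffP/differentiable_continuous + _] := dphiE t.
pose D : set R := `[(- M)%R, M]%classic.
have MM : (- M < M)%R by rewrite (lt_trans _ M0)// oppr_lt0.
have FTC : \int[@lebesgue_measure R]_(t in D) (dphi t)%:E = 0.
  rewrite (@continuous_FTC2 R dphi phi) //.
  - by rewrite !phi0 ?subee// ?normrN ger0_norm// ltW.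
  - by apply: continuous_subspaceT.
  - split.
    + by move=> t _; have [] := dphiE t.
    + by apply: cvg_at_right_filter; exact: cphi.
    + by apply: cvg_at_left_filter; exact: cphi.
  - by move=> t _; rewrite derive1E; exact: derive_val.
have out (f : mR -> \bar R) : (forall t, (M < `|t|)%R -> f t = 0) ->
    \int[@lebesgue_measure R]_t f t = \int[@lebesgue_measure R]_(t in D) f t.
  move=> f0; rewrite [RHS]integral_mkcond; apply: eq_integral => t _.
  rewrite /patch; case: ifPn => // /negP tD; apply: f0; rewrite ltNge.
  by apply/negP => tM; apply: tD; apply/mem_set; rewrite /D/= in_itv/= -ler_norml.
rewrite out; last by move=> t /dphi0 E; rewrite funeposE /= E maxxx.
rewrite out; last by move=> t /dphi0 E; rewrite funenegE /= E oppr0 maxxx.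
move: FTC; rewrite integralE.
have : 0 <= \int[@lebesgue_measure R]_(t in D) (EFin \o dphi)^\+ t by apply: integral_ge0.
have : 0 <= \int[@lebesgue_measure R]_(t in D) (EFin \o dphi)^\- t by apply: integral_ge0.
move: (integral _ _ _) (integral _ _ _) => [a||] [b||]//= _ _.
by move=> [/eqP]; rewrite subr_eq0 => /eqP ->.
Qed.

Lemma setcE (x : V) i (t : R) : setc x i t = (t *: ebase R i + setc x i 0%R)%R.
Proof.
by apply/rowP => j; rewrite !mxE eqxx/=; case: (j == i); rewrite ?mulr1 ?mulr0 ?addr0 ?add0r.
Qed.

Lemma continuous_setc (x : V) i : continuous (setc x i).
Proof.
rewrite (_ : setc x i = fun t : R => (t *: ebase R i + setc x i 0%R)%R); last first.
  by apply/funext => t; exact: setcE.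
move=> t; apply: cvgD; last exact: cvg_cst.
exact: scalel_continuous.
Qed.

(** With coordinate [i] innermost, the positive and negative parts of the derivative have equal
    integrals on every line, hence equal integrals; integrability then allows the difference. *)
Lemma integral_dpart_eq0 i (G : V -> R) (M : R) : (0 < M)%R -> Cn 1 setT G ->
  (forall x, ~ boxV (0%R : V) M x -> G x = 0%R) ->
  mu.-integrable setT (fun x => (dpart i G x)%:E) /\
  \int[mu]_x (dpart i G x)%:E = 0.
Proof.
move=> M0 G1 G0; set g := dpart i G.
have cg : continuous g by move=> x; apply: (CnE (Cn_dpart i G1)).
have g0 x : ~ boxV (0%R : V) M x -> g x = 0%R.
  move=> xM.
  rewrite /g (_ : dpart i G x = dpart i (fun=> 0%R) x); first exact: derive_cst.
  apply: (@dpart_open _ _ (~` boxV (0%R : V) M)) => //.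
  by rewrite openC; apply: compact_closed; [exact: norm_hausdorff|exact: compact_boxV].
have ig : mu.-integrable setT (fun x => (g x)%:E).
  by apply: (integrable_continuous_box (ltW M0) cg g0).
split => //; rewrite integralE.
have mg : measurable_fun [set: BV] (EFin \o (g : BV -> R)).
  by apply/measurable_EFinP; exact: continuous_measurableV.
have pp : pos_meas ((EFin \o g)^\+ : V -> \bar R).
  by split=> //; exact: measurable_funepos.
have pn : pos_meas ((EFin \o g)^\- : V -> \bar R).
  by split=> //; exact: measurable_funeneg.
have -> : \int[mu]_x (EFin \o g)^\+ x = \int[mu]_x (EFin \o g)^\- x.
  rewrite !integral_muVE//; have [s sE] := intRN_last R i; rewrite !sE//.
  congr iint; apply/funext => x.
  have dx t : is_derive t (1%R : R) (fun t => G (setc x i t)) (g (setc x i t)).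
    under [X in is_derive _ _ X]eq_fun do rewrite setcE.
    by apply: is_derive_line_at; rewrite -setcE; exact: Cn_is_derive G1 _.
  have noB t : (M < `|t|)%R -> ~ boxV (0%R : V) M (setc x i t).
    by move=> Mt /(_ i); rewrite !mxE eqxx subr0 leNgt Mt.
  under eq_integral => t _.
    rewrite (_ : _^\+ _ = (EFin \o (fun t => g (setc x i t)))^\+ t); last by rewrite !funeposE.
    over.
  under [RHS]eq_integral => t _.
    rewrite (_ : _^\- _ = (EFin \o (fun t => g (setc x i t)))^\- t); last by rewrite !funenegE.
    over.
  (* [M + 1] because [G] is only known to vanish strictly outside the closed box, while the
     one-variable lemma asks for zeros at the endpoints too. *)
  apply: (@integral_funepos_funeneg _ (fun t => g (setc x i t)) (M + 1)%R _ _ dx).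
  - by rewrite addr_gt0.
  - by move=> t; apply: continuous_comp; [exact: continuous_setc|exact: cg].
  - by move=> t Mt; apply: G0; apply: noB; rewrite (lt_le_trans _ Mt)// ltrDl.
  - by move=> t Mt; apply: g0; apply: noB; rewrite (lt_trans _ Mt)// ltrDl.
rewrite subee//; have := integrable_neg_fin_num measurableT ig; by [].
Qed.

End Divergence.

(** * Geometry of the ball model *)

Section Conformal.
Variables (R : realType) (N : nat).
Local Notation V := 'rV[R]_N.
Local Notation e := (ebase R).
Local Notation conf := (@conf R N).
Implicit Types (x : V) (u a b : V -> R).

(* The Riemannian inner product of the gradients of a and b. *)
Definition gam a b x : R := (conf x)^-1 ^+ 2 * \sum_(i < N) dpart i a x * dpart i b x.

Definition Hball : set V := [set x | inH x].

Lemma is_derive_eucl2 i x : is_derive x (e i) (@eucl2 R N) (2 * x ord0 i).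
Proof.
apply: is_derive_eq.
  apply: (@is_derive_bigsum R V 'I_N (index_enum _) xpredT (fun j y => y ord0 j ^+ 2)
    (fun j => 2%:R * (x ord0 j) ^+ 1 * (i == j)%:R)).
  by move=> j; apply: is_derive_natpow; exact: is_derive_coord.
rewrite (bigD1 i)//= eqxx expr1 mulr1 big1 ?addr0// => j ji.
by rewrite eq_sym (negbTE ji) mulr0.
Qed.

Lemma Cn_eucl2 n (D : set V) : open D -> Cn n D (@eucl2 R N).
Proof.
move=> oD; apply: Cn_bigsum => // j.
by apply: Cn_exp => //; exact: Cn_coord.
Qed.

Lemma open_Hball : open Hball.
Proof.
have c2 : continuous (@eucl2 R N) by move=> x; apply: (CnE (Cn_eucl2 0 openT)).
rewrite (_ : Hball = @eucl2 R N @^-1` [set t | t < 1]) //.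
by apply: open_comp => [x _|]; [exact: c2|exact: open_lt].
Qed.

Lemma eucl2_ge0 x : 0 <= eucl2 x.
Proof. by apply: sumr_ge0 => i _; exact: sqr_ge0. Qed.

Lemma conf_gt0 x : inH x -> 0 < conf x.
Proof. by move=> xH; rewrite divr_gt0// subr_gt0. Qed.

Lemma conf_neq0 x : inH x -> conf x != 0.
Proof. by move=> /conf_gt0 /lt0r_neq0. Qed.

Lemma eucl2_conf x : inH x -> eucl2 x = 1 - 2 / conf x.
Proof.
move=> xH; rewrite /Defs.conf; have : 1 - eucl2 x != 0 by rewrite subr_eq0 gt_eqF.
by move=> ?; field.
Qed.

Lemma is_derive_conf i x : inH x -> is_derive x (e i) conf (conf x ^+ 2 * x ord0 i).
Proof.
move=> xH; have n0 : 1 - eucl2 x != 0 by rewrite subr_eq0 gt_eqF.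
have dx := is_derive_eucl2 i x.
rewrite /Defs.conf; der_eq => //.
by field.
Qed.

Lemma Cn_conf n : Cn n Hball conf.
Proof.
have oH := open_Hball.
rewrite /Defs.conf; apply: Cn_mul => //; first exact: Cn_cst.
apply: Cn_inv => // [x xH|]; first by rewrite subr_eq0 gt_eqF.
by apply: Cn_add => //; [exact: Cn_cst|apply: Cn_opp => //; exact: Cn_eucl2].
Qed.

Section Domain.
Variable D : set V.
Hypotheses (oD : open D) (DH : D `<=` Hball).

Lemma Cn_confD n : Cn n D conf. Proof. exact: Cn_sub (Cn_conf n). Qed.

Lemma Cn_gam n a b : Cn n.+1 D a -> Cn n.+1 D b -> Cn n D (gam a b).
Proof.
move=> aD bD; apply: Cn_mul => //.
  apply: Cn_exp => //; apply: Cn_inv => //; last exact: Cn_confD.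
  by move=> x /DH /conf_neq0.
by apply: Cn_bigsum => // j; apply: Cn_mul => //; exact: Cn_dpart.
Qed.

Lemma gamC a b x : gam a b x = gam b a x.
Proof. by rewrite /gam; under eq_bigr do rewrite mulrC. Qed.

Lemma dpart_is_derive i (f : V -> R) x d : is_derive x (e i) f d -> dpart i f x = d.
Proof. by case. Qed.

(** [gam] sees its first argument only through its partial derivatives at [x], and linearly; product
    and chain rules are instances. *)
Lemma gam_lin a b f g c1 c2 x :
  (forall i, dpart i f x = c1 * dpart i a x + c2 * dpart i b x) ->
  gam f g x = c1 * gam a g x + c2 * gam b g x.
Proof.
move=> H; rewrite /gam mulrCA [c2 * _]mulrCA -mulrDr; congr (_ * _).
rewrite !mulr_sumr -big_split/=; apply: eq_bigr => i _; rewrite H; ring.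
Qed.

Lemma gam_mul a b g x : D x -> Cn 1 D a -> Cn 1 D b ->
  gam (fun y => a y * b y) g x = b x * gam a g x + a x * gam b g x.
Proof.
move=> Dx aD bD; apply: gam_lin => i; apply: dpart_is_derive.
have da := Cn_is_derive i aD Dx; have db := Cn_is_derive i bD Dx.
by der_eq; ring.
Qed.

Lemma gam_comp (phi : R -> R) d a g x : D x -> Cn 1 D a ->
  is_derive (a x) (1 : R) phi d -> gam (fun y => phi (a y)) g x = d * gam a g x.
Proof.
move=> Dx aD dphi; rewrite -[RHS]addr0 -(mul0r (gam a g x)).
apply: gam_lin => i; rewrite mul0r addr0; apply: dpart_is_derive.
by apply: is_derive_comp => //; exact: (Cn_is_derive i aD Dx).
Qed.

Lemma gam_ext f a g x : D x -> (forall y, D y -> f y = a y) -> gam f g x = gam a g x.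
Proof.
move=> Dx fa; rewrite /gam; congr (_ * _); apply: eq_bigr => i _; congr (_ * _).
exact: (@dpart_open _ _ D).
Qed.

(** The product rule for the Riemannian divergence of phi grad a, in Euclidean densities: the volume
    contributes [conf ^+ N] and the inverse metric removes two powers. *)
Lemma div_grad phi a x : (2 <= N)%N -> D x -> Cn 1 D phi -> Cn 2 D a ->
  \sum_(i < N) dpart i (fun y => conf y ^+ (N - 2) * (phi y * dpart i a y)) x =
  conf x ^+ N * (phi x * LB a x + gam phi a x).
Proof.
move=> N2 Dx phiD aD.
have k0 : conf x != 0 by apply/conf_neq0/DH.
have G1 i : Cn 1 D (fun y => conf y ^+ (N - 2) * dpart i a y).
  exact: (Cn_mul oD (Cn_exp _ oD (Cn_confD 1)) (Cn_dpart i aD)).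
under eq_bigr => i _.
  rewrite (_ : dpart i _ x = dpart i phi x * (conf x ^+ (N - 2) * dpart i a x) +
     phi x * dpart i (fun y => conf y ^+ (N - 2) * dpart i a y) x); last first.
    apply: dpart_is_derive.
    under [X in is_derive _ _ X]eq_fun do rewrite mulrCA.
    apply: is_derive_mul; first exact: (Cn_is_derive i phiD Dx).
    exact: (Cn_is_derive i (G1 i) Dx).
  over.
rewrite big_split/= -mulr_sumr /LB /gam.
rewrite [in RHS]mulrDr addrC; congr (_ + _).
  by rewrite [RHS]mulrCA mulVKf// expf_neq0.
have -> : conf x ^+ N = conf x ^+ (N - 2) * conf x ^+ 2 by rewrite -exprD subnK.
rewrite mulrA; have -> : conf x ^+ (N - 2) * conf x ^+ 2 * (conf x)^-1 ^+ 2 = conf x ^+ (N - 2).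
  by rewrite -mulrA -exprMn divff// expr1n mulr1.
by rewrite mulr_sumr; apply: eq_bigr => i _; rewrite mulrCA.
Qed.

End Domain.
End Conformal.

(** * Gradient, Laplacian and Hessian of cosh r *)

Section CoshDistance.
Variables (R : realType) (N : nat) (o : 'rV[R]_N).
Hypotheses (oH : inH o) (N2 : (2 <= N)%N).
Local Notation V := 'rV[R]_N.
Local Notation e := (ebase R).
Local Notation conf := (@conf R N).
Local Notation Hball := (@Hball R N).
Local Notation gam := (@gam R N).
Implicit Types (x : V) (u a b : V -> R).

(* [chd x] is cosh of the hyperbolic distance from o to x; on the ball it is
   the affine function [(conf x * ell x - (1 + |o|^2)) / (1 - |o|^2)] of the
   hyperboloid coordinates. *)
Definition chd x : R := 1 + 2 * eucl2 (x - o) / ((1 - eucl2 x) * (1 - eucl2 o)).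

Let w0 := 1 - eucl2 o.
Let O2 := eucl2 o.
Let P x := \sum_(i < N) x ord0 i * o ord0 i.
Let ell x := 1 + O2 - 2 * P x.

Let w0_gt0 : 0 < w0. Proof. by rewrite subr_gt0. Qed.
Let w0_neq0 : w0 != 0. Proof. exact: lt0r_neq0. Qed.

Lemma eucl2B x : eucl2 (x - o) = eucl2 x - 2 * P x + O2.
Proof.
rewrite /eucl2 /P /O2 /eucl2 mulr_sumr -sumrN -!big_split/=.
by apply: eq_bigr => i _; rewrite !mxE; ring.
Qed.

Lemma chdE x : inH x -> chd x = (conf x * ell x - (1 + O2)) / w0.
Proof.
move=> xH; have n0 : 1 - eucl2 x != 0 by rewrite subr_eq0 gt_eqF.
rewrite /chd eucl2B /ell /Defs.conf -/w0; have w0' := w0_neq0.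
have -> : O2 = 1 - w0 by rewrite /w0 /O2 opprB addrC subrK.
by field; rewrite ?n0 ?w0'.
Qed.

(* [fA] and [fB] are the coefficients in [d_i chd = fA * x_i + fB * o_i]. *)
Let fA x := conf x ^+ 2 * ell x / w0.
Let fB x := - (2 * conf x) / w0.

Let is_derive_ell i x : is_derive x (e i) ell (- (2 * o ord0 i)).
Proof.
have dP : is_derive x (e i) P (o ord0 i).
  apply: is_derive_eq.
    apply: (@is_derive_bigsum R V 'I_N (index_enum _) xpredT (fun j y => y ord0 j * o ord0 j)
      (fun j => (i == j)%:R * o ord0 j + x ord0 j * 0)).
    by move=> j; have dc := is_derive_coord i j x; der.
  rewrite (bigD1 i)//= eqxx mul1r mulr0 addr0 big1 ?addr0// => j ji.
  by rewrite eq_sym (negbTE ji) mulr0 mul0r addr0.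
by rewrite /ell; der_eq; ring.
Qed.

Lemma is_derive_chd i x : inH x ->
  is_derive x (e i) chd (fA x * x ord0 i + fB x * o ord0 i).
Proof.
move=> xH.
apply: (is_derive_open (@open_Hball R N) xH (f := fun y => (conf y * ell y - (1 + O2)) / w0)).
  by move=> y yH; rewrite chdE.
have dk := is_derive_conf i xH; have dl := is_derive_ell i x.
der_eq; rewrite /fA /fB; ring.
Qed.

Lemma dpart_chd i x : inH x -> dpart i chd x = fA x * x ord0 i + fB x * o ord0 i.
Proof. by move=> /(is_derive_chd i) []. Qed.

Lemma is_derive_dpart_chd i j x : inH x ->
  is_derive x (e j) (dpart i chd)
    ((2 * conf x * ell x * x ord0 j - 2 * o ord0 j) * conf x ^+ 2 * x ord0 i / w0
     + fA x * (i == j)%:R - 2 * conf x ^+ 2 * x ord0 j * o ord0 i / w0).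
Proof.
move=> xH.
apply: (is_derive_open (@open_Hball R N) xH (f := fun y => fA y * y ord0 i + fB y * o ord0 i)).
  by move=> y yH; rewrite dpart_chd.
have dk := is_derive_conf j xH; have dl := is_derive_ell j x.
have dc := is_derive_coord j i x.
rewrite /fA /fB; der_eq; rewrite eq_sym /=; ring.
Qed.

Lemma dpart2_chd i j x : inH x -> dpart j (dpart i chd) x =
  (2 * conf x * ell x * x ord0 j - 2 * o ord0 j) * conf x ^+ 2 * x ord0 i / w0
     + fA x * (i == j)%:R - 2 * conf x ^+ 2 * x ord0 j * o ord0 i / w0.
Proof. by move=> /(is_derive_dpart_chd i j) []. Qed.

Lemma Cn_chd n : Cn n Hball chd.
Proof.
have oB := @open_Hball R N.
apply: (Cn_ext (f := fun y => (conf y * ell y - (1 + O2)) / w0)) => //.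
  by move=> y yH; rewrite chdE.
have cl : Cn n Hball ell.
  apply: Cn_add => //; first exact: Cn_cst.
  apply: Cn_opp => //; apply: Cn_mul => //; first exact: Cn_cst.
  apply: Cn_bigsum => // k; apply: Cn_mul => //; [exact: Cn_coord|exact: Cn_cst].
apply: Cn_mul => //; last exact: Cn_cst.
apply: Cn_add => //; last exact: Cn_cst.
by apply: Cn_mul => //; exact: Cn_conf.
Qed.

Let dot_lin (a b : R) (p q r : 'I_N -> R) :
  \sum_(i < N) (a * p i + b * q i) * r i =
  a * \sum_(i < N) p i * r i + b * \sum_(i < N) q i * r i.
Proof. by rewrite !mulr_sumr -big_split/=; apply: eq_bigr => i _; ring. Qed.

Let dot_chd (q : 'I_N -> R) x : inH x -> \sum_(i < N) dpart i chd x * q i =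
  fA x * (\sum_(i < N) x ord0 i * q i) + fB x * (\sum_(i < N) o ord0 i * q i).
Proof. by move=> xH; rewrite -dot_lin; apply: eq_bigr => i _; rewrite dpart_chd. Qed.

Let sumoo : \sum_(i < N) o ord0 i * o ord0 i = O2.
Proof. by apply: eq_bigr => i _; rewrite expr2. Qed.
Let sumxx x : \sum_(i < N) x ord0 i * x ord0 i = eucl2 x.
Proof. by apply: eq_bigr => i _; rewrite expr2. Qed.
Let sumox x : \sum_(i < N) o ord0 i * x ord0 i = P x.
Proof. by apply: eq_bigr => i _; rewrite mulrC. Qed.

Let PE x : P x = (1 + O2 - ell x) / 2.
Proof. by rewrite /ell; field. Qed.
Let O2E : O2 = 1 - w0. Proof. by rewrite /w0 opprB addrC subrK. Qed.

Lemma gam_chd x : inH x -> gam chd chd x = chd x ^+ 2 - 1.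
Proof.
move=> xH; rewrite /gam dot_chd//.
under eq_bigr do rewrite mulrC; rewrite dot_chd// sumxx.
under [X in _ + fB x * X]eq_bigr do rewrite mulrC.
rewrite dot_chd// sumoo sumox -/(P x) chdE// eucl2_conf// PE O2E /fA /fB.
have k0 := conf_neq0 xH; have w0' := w0_neq0.
by field; rewrite ?k0 ?w0'.
Qed.

Let nat2 : (N - 2)%:R = N%:R - 2 :> R. Proof. by rewrite natrB. Qed.

Lemma LB_chd x : inH x -> LB chd x = N%:R * chd x.
Proof.
move=> xH; have k0 := conf_neq0 xH; have w0' := w0_neq0.
rewrite /LB; apply: (mulfI (expf_neq0 N k0)); rewrite mulVKf ?expf_neq0//.
have kN : conf x ^+ N = conf x ^+ (N - 2) * conf x ^+ 2 by rewrite -exprD subnK.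
(* For [N = 2] the predecessor is truncated, but the coefficient in front is then zero. *)
have kN1 : (N - 2)%:R * conf x ^+ (N - 2).-1 * conf x = (N - 2)%:R * conf x ^+ (N - 2).
  by case: (N - 2)%N => [|n] /=; rewrite ?mul0r// exprSr mulrA.
under eq_bigr => i _.
  rewrite (_ : dpart i _ x = conf x ^+ (N - 2) *
     ((2 * conf x ^+ 3 * ell x / w0 + (N - 2)%:R * conf x * fA x) * (x ord0 i * x ord0 i) +
      ((N - 2)%:R * conf x * fB x - 4 * conf x ^+ 2 / w0) * (x ord0 i * o ord0 i) + fA x));
    last first.
    have dk := is_derive_conf i xH; have dc := is_derive_dpart_chd i i xH.
    apply: dpart_is_derive; der_eq.
    rewrite eqxx dpart_chd//.
    rewrite (_ : _ * (conf x ^+ 2 * x ord0 i) = ((N - 2)%:R * conf x ^+ (N - 2).-1 * conf x) * (conf x * x ord0 i)); last by ring.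
    rewrite kN1 /=; move: (conf x ^+ (N - 2)) ((N - 2)%:R : R) => p q; ring.
  over.
rewrite -mulr_sumr !big_split/= -!mulr_sumr sumxx -/(P x) sumr_const card_ord -mulr_natr.
rewrite kN -!mulrA; congr (_ * _).
rewrite nat2 chdE// eucl2_conf// PE O2E /fA /fB.
by field; rewrite ?k0 ?w0' opprB addrC subrK pnatr_eq0.
Qed.

(** The left side is Hess f (grad u, grad u) for f = [chd o], written with first-order brackets only
    so that no Christoffel symbols appear. The identity says Hess f = f g. *)
Lemma hess_chd (D : set V) u x : open D -> D `<=` Hball -> D x -> Cn 2 D u ->
  gam (gam u chd) u x - gam (gam u u) chd x / 2 = chd x * gam u u x.
Proof.
move=> oD DH Dx u2; have xH : inH x := DH x Dx.
have k0 := conf_neq0 xH; have w0' := w0_neq0.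
have dk i := is_derive_conf i xH.
have du i j : is_derive x (e j) (dpart i u) (dpart j (dpart i u) x).
  exact: Cn_is_derive (Cn_dpart i u2) Dx.
have dc i j : is_derive x (e j) (dpart i chd) (dpart j (dpart i chd) x).
  by apply: derivableP; have [] := is_derive_dpart_chd i j xH.
have dgam j (a b : V -> R) :
    (forall i, is_derive x (e j) (dpart i a) (dpart j (dpart i a) x)) ->
    (forall i, is_derive x (e j) (dpart i b) (dpart j (dpart i b) x)) ->
    dpart j (gam a b) x =
    - (2 * x ord0 j) / conf x * (\sum_(i < N) dpart i a x * dpart i b x) +
    (conf x)^-1 ^+ 2 * (\sum_(i < N) dpart j (dpart i a) x * dpart i b x +
      \sum_(i < N) dpart i a x * dpart j (dpart i b) x).
  move=> hp hq; apply: dpart_is_derive.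
  have ds : is_derive x (e j) (fun y => \sum_(i < N) dpart i a y * dpart i b y)
      (\sum_(i < N) (dpart j (dpart i a) x * dpart i b x + dpart i a x * dpart j (dpart i b) x)).
    apply: (@is_derive_bigsum R V 'I_N _ _ (fun i y => dpart i a y * dpart i b y)
      (fun i => dpart j (dpart i a) x * dpart i b x + dpart i a x * dpart j (dpart i b) x)) => i.
    exact (@is_derive_mul R V (dpart i a) (dpart i b) x (e j) _ _ (hp i) (hq i)).
  have dkj := dk j.
  have gE : gam a b = fun y => (conf y)^-1 ^+ 2 * \sum_(i < N) dpart i a y * dpart i b y by [].
  rewrite gE; der_eq => //=; rewrite -big_split/=; by field.
set U := \sum_(i < N) x ord0 i * dpart i u x.
set W := \sum_(i < N) o ord0 i * dpart i u x.
set S := \sum_(i < N) dpart i u x * dpart i u x.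
set T := \sum_(j < N) (\sum_(i < N) dpart j (dpart i u) x * dpart i chd x) * dpart j u x.
have dE : \sum_(i < N) dpart i u x * dpart i chd x = fA x * U + fB x * W.
  by under eq_bigr do rewrite mulrC; rewrite dot_chd.
have xE : \sum_(i < N) x ord0 i * dpart i chd x = fA x * eucl2 x + fB x * P x.
  by under eq_bigr do rewrite mulrC; rewrite dot_chd// sumxx sumox.
have HE : \sum_(j < N) (\sum_(i < N) dpart i u x * dpart j (dpart i chd) x) * dpart j u x =
   2 * conf x ^+ 3 * ell x / w0 * (U * U) - 4 * conf x ^+ 2 / w0 * (U * W) + fA x * S.
  under eq_bigr => j _.
    rewrite (_ : _ * _ = (2 * conf x ^+ 3 * ell x / w0 * U) * (x ord0 j * dpart j u x)
      + (- (2 * conf x ^+ 2 / w0 * U)) * (o ord0 j * dpart j u x)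
      + (- (2 * conf x ^+ 2 / w0 * W)) * (x ord0 j * dpart j u x)
      + fA x * (dpart j u x * dpart j u x)); last first.
      under eq_bigr => i _.
        rewrite dpart2_chd// (_ : _ * _ =
          ((2 * conf x * ell x * x ord0 j - 2 * o ord0 j) * conf x ^+ 2 / w0) * (x ord0 i * dpart i u x)
          + (- (2 * conf x ^+ 2 * x ord0 j / w0)) * (o ord0 i * dpart i u x)
          + fA x * ((i == j)%:R * dpart i u x)); last by ring.
        over.
      rewrite !big_split/= -!mulr_sumr -/U -/W.
      rewrite (_ : \sum_(i < N) (i == j)%:R * dpart i u x = dpart j u x); first by ring.
      by rewrite (bigD1 j)//= eqxx mul1r big1 ?addr0// => i /negbTE ->; rewrite mul0r.
    over.
  by rewrite !big_split/= -!mulr_sumr -/U -/W -/S; ring.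
(* Symmetry of second derivatives: those of [u] enter both brackets through the same sum [T] and
   cancel. *)
have TE : \sum_(j < N) (\sum_(i < N) dpart j (dpart i u) x * dpart i u x) * dpart j chd x = T.
  rewrite /T; under eq_bigr do rewrite mulr_suml.
  under [RHS]eq_bigr do rewrite mulr_suml.
  rewrite exchange_big/=; apply: eq_bigr => j _; apply: eq_bigr => i _.
  by rewrite (dpartC i j oD Dx u2); ring.
have gE a b : gam a b x = (conf x)^-1 ^+ 2 * \sum_(i < N) dpart i a x * dpart i b x by [].
rewrite [gam (gam u chd) u x]gE [gam (gam u u) chd x]gE [gam u u x]gE -/S.
under eq_bigr => j _.
  rewrite (dgam j u chd (fun i => du i j) (fun i => dc i j)).
  rewrite dE (_ : _ * _ = (- 2 / conf x * (fA x * U + fB x * W)) * (x ord0 j * dpart j u x)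
    + (conf x)^-1 ^+ 2 * ((\sum_(i < N) dpart j (dpart i u) x * dpart i chd x) * dpart j u x)
    + (conf x)^-1 ^+ 2 * ((\sum_(i < N) dpart i u x * dpart j (dpart i chd) x) * dpart j u x)); last by ring.
  over.
rewrite !big_split/= -!mulr_sumr -/U -/T HE.
under eq_bigr => j _.
  rewrite (dgam j u u (fun i => du i j) (fun i => du i j)).
  rewrite -/S (_ : _ * _ = (- 2 / conf x * S) * (x ord0 j * dpart j chd x)
    + 2 * (conf x)^-1 ^+ 2 * ((\sum_(i < N) dpart j (dpart i u) x * dpart i u x) * dpart j chd x)); last first.
    rewrite (_ : \sum_(i < N) dpart i u x * dpart j (dpart i u) x = \sum_(i < N) dpart j (dpart i u) x * dpart i u x); first by ring.
    by apply: eq_bigr => i _; rewrite mulrC.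
  over.
rewrite !big_split/= -!mulr_sumr xE TE.
rewrite chdE// eucl2_conf// PE O2E /fA /fB.
by field; rewrite ?k0 ?w0'.
Qed.

End CoshDistance.

(** * Hyperbolic functions and the inverse of cosh *)

Section HyperbolicFunctions.
Variable R : realType.
Implicit Types t : R.
Local Notation sinh := (@sinh R).
Local Notation acosh := (@acosh R).

Definition cosh t : R := (expR t + expR (- t)) / 2.
Definition coth t : R := cosh t / sinh t.

Lemma is_derive_expR_comp t : is_derive t (1 : R) (fun s : R => expR (- s)) (- expR (- t)).
Proof.
have dn : is_derive t (1 : R) (fun s : R => - s) (-1) by der.
by have := is_derive_comp (is_derive_expR (- t)) dn; rewrite mulrN1.
Qed.

Lemma is_derive_cosh t : is_derive t (1 : R) cosh (sinh t).
Proof.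
have d1 := is_derive_expR t; have d2 := is_derive_expR_comp t.
rewrite /cosh; der_eq; rewrite /Defs.sinh; ring.
Qed.

Lemma is_derive_sinh t : is_derive t (1 : R) sinh (cosh t).
Proof.
have d1 := is_derive_expR t; have d2 := is_derive_expR_comp t.
rewrite /Defs.sinh; der_eq; rewrite /cosh; ring.
Qed.

Lemma sqr_cosh t : cosh t ^+ 2 = 1 + sinh t ^+ 2.
Proof.
have E : expR t * expR (- t) = 1 by rewrite -expRD subrr expR0.
rewrite /cosh /Defs.sinh.
transitivity (expR t * expR (- t) + ((expR t - expR (- t)) / 2) ^+ 2); first by field.
by rewrite E.
Qed.

Lemma cosh_ge1 t : 1 <= cosh t.
Proof.
have c0 : 0 <= cosh t by rewrite divr_ge0// addr_ge0// expR_ge0.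
by rewrite -(@ler_pXn2r _ 2)// ?nnegrE// sqr_cosh expr1n lerDl sqr_ge0.
Qed.

Lemma sinh0 : sinh 0 = 0. Proof. by rewrite /Defs.sinh oppr0 subrr mul0r. Qed.

Lemma is_derive_coth t : sinh t != 0 -> is_derive t (1 : R) coth (1 - coth t ^+ 2).
Proof.
move=> s0; have d1 := is_derive_cosh t; have d2 := is_derive_sinh t.
by rewrite /coth; der_eq => //; field.
Qed.

Lemma is_derive_continuous (f : R -> R) d t : is_derive t (1 : R) f d -> {for t, continuous f}.
Proof. by case=> /derivable1_diffP/differentiable_continuous. Qed.

Lemma sinh_gt t : 0 < t -> t < sinh t.
Proof.
move=> t0.
have [||c] := @MVT R (fun t => sinh t) cosh 0 t t0.
- by move=> x _; exact: is_derive_sinh.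
- by apply: continuous_subspaceT => x; apply: is_derive_continuous (is_derive_sinh x).
rewrite in_itv/= sinh0 !subr0 => /andP[c0 ct] ->.
rewrite ltr_pMl//.
rewrite -(@ltr_pXn2r _ 2)// ?nnegrE ?(le_trans ler01 (cosh_ge1 _))//.
rewrite expr1n sqr_cosh ltrDl exprn_gt0// /Defs.sinh divr_gt0// subr_gt0 ltr_expR.
by rewrite (lt_trans _ c0)// oppr_lt0.
Qed.

Lemma sinh_gt0 t : 0 < t -> 0 < sinh t.
Proof. by move=> t0; exact: lt_trans t0 (sinh_gt t0). Qed.

Section Acosh.
Variable y : R.
Hypothesis y1 : 1 < y.
Let y0 : 0 < y. Proof. exact: lt_trans y1. Qed.
Let z := Num.sqrt (y ^+ 2 - 1).
Let z2 : z ^+ 2 = y ^+ 2 - 1.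
Proof. by rewrite sqr_sqrtr// subr_ge0 -(expr1n _ 2) ler_pXn2r ?nnegrE// ltW. Qed.
Let z_gt0 : 0 < z.
Proof. by rewrite sqrtr_gt0 subr_gt0 -(expr1n _ 2) ltr_pXn2r ?nnegrE// ltW. Qed.

Let expR_acosh : expR (acosh y) = y + z.
Proof. by rewrite /Defs.acosh lnK// posrE addr_gt0. Qed.
Let expRN_acosh : expR (- acosh y) = y - z.
Proof.
rewrite expRN expR_acosh.
have n0 : y + z != 0 by rewrite gt_eqF// addr_gt0.
apply: (mulfI n0); rewrite divff//.
by transitivity (y ^+ 2 - z ^+ 2); [rewrite z2; ring|ring].
Qed.

Lemma cosh_acosh : cosh (acosh y) = y.
Proof. by rewrite /cosh expR_acosh expRN_acosh; field. Qed.

Lemma sinh_acosh : sinh (acosh y) = Num.sqrt (y ^+ 2 - 1).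
Proof. by rewrite /Defs.sinh expR_acosh expRN_acosh -/z; field. Qed.

Lemma acosh_gt0 : 0 < acosh y.
Proof.
rewrite /Defs.acosh ln_gt0//; apply: lt_trans y1 _; by rewrite ltrDl.
Qed.

Lemma is_derive_acosh : is_derive y (1 : R) acosh (sinh (acosh y))^-1.
Proof.
rewrite sinh_acosh -/z.
have n0 : y + z != 0 by rewrite gt_eqF// addr_gt0.
have zn0 : z != 0 by rewrite gt_eqF.
have dz : is_derive y (1 : R) (fun t : R => Num.sqrt (t ^+ 2 - 1)) (y / z).
  have dq : is_derive y (1 : R) (fun t : R => t ^+ 2 - 1) (2 * y) by der_eq; rewrite /=; ring.
  have q0 : 0 < y ^+ 2 - 1 by rewrite -z2 exprn_gt0.
  have := @is_derive_comp R R (@Num.sqrt R) (fun t : R => t ^+ 2 - 1) y 1 _ _ (is_derive1_sqrt q0) dq.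
  by rewrite -/z => d; apply: (is_derive_eq d); field.
have dln : is_derive (y + z) (1 : R) (@ln R) (y + z)^-1.
  by apply: is_derive1_ln; rewrite addr_gt0.
have ds : is_derive y (1 : R) (fun t : R => t + Num.sqrt (t ^+ 2 - 1)) (1 + y / z) by der.
by apply: (is_derive_eq (@is_derive_comp R R (@ln R) (fun t : R => t + Num.sqrt (t ^+ 2 - 1)) y 1 _ _ dln ds)); field; rewrite ?n0 ?zn0.
Qed.
End Acosh.

End HyperbolicFunctions.

(** * The distance function off the pole *)

Section Radial.
Variables (R : realType) (N : nat) (o : 'rV[R]_N).
Hypotheses (oH : inH o) (N2 : (2 <= N)%N).
Local Notation V := 'rV[R]_N.
Local Notation e := (ebase R).
Local Notation gam := (@gam R N).
Local Notation Hball := (@Hball R N).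
Local Notation chd := (chd o).
Implicit Types (x : V) (u a b : V -> R).

Definition rdist x : R := hdist x o.
Definition Hpunct : set V := Hball `&` ~` [set o].

Lemma open_Hpunct : open Hpunct.
Proof.
apply: openI; first exact: open_Hball.
by rewrite openC; apply: compact_closed; [exact: norm_hausdorff|exact: compact_set1].
Qed.

Lemma HpunctH : Hpunct `<=` Hball. Proof. by move=> x []. Qed.

Lemma eucl2_gt0 x : x != 0 -> 0 < eucl2 x.
Proof.
move=> x0; rewrite lt_neqAle eucl2_ge0 andbT eq_sym; apply: contra x0 => /eqP E.
apply/eqP/rowP => i; rewrite mxE; apply/eqP; rewrite -sqrf_eq0; apply/eqP.
by apply: (psumr_eq0P _ E) => // k _; exact: sqr_ge0.
Qed.

(** The denominator in [chd] is at most 1. This compares hyperbolic with Euclidean distance. *)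
Lemma chd_ge x : inH x -> 1 + 2 * eucl2 (x - o) <= chd x.
Proof.
move=> xH; rewrite -[chd x]/(1 + 2 * eucl2 (x - o) / ((1 - eucl2 x) * (1 - eucl2 o))) lerD2l -mulrA ler_pM2l// ler_peMr ?eucl2_ge0//.
rewrite invf_ge1 ?mulr_gt0 ?subr_gt0//.
by have := eucl2_ge0 x; have := eucl2_ge0 o; have := xH; have := oH; rewrite /inH; nra.
Qed.

Lemma chd_gt1 x : Hpunct x -> 1 < chd x.
Proof.
move=> [xH /eqP xo]; apply: lt_le_trans (chd_ge xH).
by rewrite ltrDl mulr_gt0// eucl2_gt0// subr_eq0.
Qed.

Lemma cosh_rdist x : Hpunct x -> cosh (rdist x) = chd x.
Proof. by move=> /chd_gt1 /cosh_acosh. Qed.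

Lemma rdist_gt0 x : Hpunct x -> 0 < rdist x.
Proof. by move=> /chd_gt1 /acosh_gt0. Qed.

Lemma sinh_rdist_gt0 x : Hpunct x -> 0 < sinh (rdist x).
Proof. by move=> /rdist_gt0 /sinh_gt0. Qed.

Lemma rdisto : rdist o = 0.
Proof.
rewrite /rdist /hdist subrr (_ : eucl2 0 = 0); last first.
  by apply: big1 => i _; rewrite mxE expr0n.
by rewrite mulr0 mul0r addr0 /acosh expr1n subrr sqrtr0 addr0 ln1.
Qed.

Lemma Cn_rdist n : Cn n Hpunct rdist.
Proof.
have oP := open_Hpunct.
have cf : Cn n Hpunct chd by apply: Cn_sub (Cn_chd oH n); exact: HpunctH.
have f2 x : Hpunct x -> 0 < chd x ^+ 2 - 1.
  by move=> /chd_gt1 h; rewrite subr_gt0 expr_gt1// ltW// (lt_trans _ h).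
have c2 : Cn n Hpunct (fun y => chd y ^+ 2 - 1).
  by apply: Cn_add => //; [exact: Cn_exp|exact: Cn_cst].
(* The square root is rewritten with [expR] and [ln], for which the [Cn] rules exist; its argument
   is positive off the pole. *)
apply: (Cn_ext (f := fun y => ln (chd y + expR (2^-1 * ln (chd y ^+ 2 - 1))))) => //.
  move=> y /f2 y2; rewrite /rdist /hdist /acosh -/(chd y); congr (ln (_ + _)).
  apply: (@pexpIrn _ 2) => //; rewrite ?nnegrE ?expR_ge0 ?sqrtr_ge0//.
  rewrite sqr_sqrtr ?ltW// -expRM_natl mulrA divff ?pnatr_eq0// mul1r lnK//.
apply: Cn_ln => //.
  by move=> x /chd_gt1 x1; rewrite addr_gt0// ?expR_gt0// (lt_trans _ x1).
apply: Cn_add => //; apply: Cn_expR => //; apply: Cn_mul => //; first exact: Cn_cst.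
exact: Cn_ln.
Qed.

Lemma dpart_rdist i x : Hpunct x ->
  dpart i rdist x = (sinh (rdist x))^-1 * dpart i chd x.
Proof.
move=> xP; apply: dpart_is_derive.
apply: (@is_derive_comp _ _ (@acosh R) chd); first exact: is_derive_acosh (chd_gt1 xP).
exact: Cn_is_derive (Cn_chd oH 1) (HpunctH xP).
Qed.

Lemma gam_rdistl a x : Hpunct x -> gam rdist a x = (sinh (rdist x))^-1 * gam chd a x.
Proof.
move=> xP; rewrite -[RHS]addr0 -(mul0r (gam chd a x)).
by apply: gam_lin => i; rewrite mul0r addr0 dpart_rdist.
Qed.

Lemma gam_rdist x : Hpunct x -> gam rdist rdist x = 1.
Proof.
move=> xP; have s0 := sinh_rdist_gt0 xP.
rewrite gam_rdistl// gamC gam_rdistl// (gam_chd oH (HpunctH xP)) -cosh_rdist// sqr_cosh.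
by field; rewrite gt_eqF.
Qed.

Let isinh y := (sinh (rdist y))^-1.
Let Cn_isinh n : Cn n Hpunct isinh.
Proof.
have oP := open_Hpunct; apply: Cn_inv => //.
  by move=> x /sinh_rdist_gt0 ?; rewrite gt_eqF.
rewrite /sinh; apply: Cn_mul => //; last exact: Cn_cst.
apply: Cn_add => //; first by apply: Cn_expR => //; exact: Cn_rdist.
by apply: Cn_opp => //; apply: Cn_expR => //; apply: Cn_opp => //; exact: Cn_rdist.
Qed.

Let gam_isinh a x : Hpunct x ->
  gam isinh a x = - (chd x / sinh (rdist x) ^+ 2) * gam rdist a x.
Proof.
move=> xP; have s0 := sinh_rdist_gt0 xP.
apply: (gam_comp (D := Hpunct) (phi := fun t => (sinh t)^-1) (a := rdist)) => //.
  exact: Cn_rdist.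
have d := is_derive_sinh (rdist x).
der_eq; rewrite ?gt_eqF// cosh_rdist//; ring.
Qed.

(** As grad r = grad(cosh r) / sinh r, the divergence is N coth r from [LB_chd] minus coth r from
    the gradient of 1 / sinh r. *)
Lemma LB_rdist x : Hpunct x -> LB rdist x = (N%:R - 1) * coth (rdist x).
Proof.
move=> xP; have s0 := sinh_rdist_gt0 xP; have oP := open_Hpunct.
have xH := HpunctH xP.
have := @div_grad R N Hpunct oP HpunctH isinh chd x N2 xP (Cn_isinh 1)
  (Cn_sub HpunctH (Cn_chd oH 2)).
rewrite gam_isinh// gam_rdistl// gam_chd// LB_chd// => E.
rewrite /LB (_ : \sum_(i < N) _ = \sum_(i < N) dpart i (fun y => conf y ^+ (N - 2) * (isinh y * dpart i chd y)) x); last first.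
  apply: eq_bigr => i _; apply: (@dpart_open _ _ Hpunct) => // y yP.
  by rewrite dpart_rdist.
rewrite E mulKf ?expf_neq0 ?conf_neq0// /isinh /coth -cosh_rdist// sqr_cosh.
by field; rewrite gt_eqF.
Qed.

(** Again the left side is the Hessian on (grad u, grad u). It comes from [hess_chd] divided by sinh
    r; the derivative of 1 / sinh r removes the radial direction. *)
Lemma hess_rdist (D : set V) u x : open D -> D `<=` Hpunct -> D x -> Cn 2 D u ->
  gam (gam u rdist) u x - gam (gam u u) rdist x / 2 =
  coth (rdist x) * (gam u u x - gam u rdist x ^+ 2).
Proof.
move=> oD DP Dx u2; have xP := DP x Dx; have s0 := sinh_rdist_gt0 xP.
have DH : D `<=` Hball by move=> y /DP /HpunctH.
have oP := open_Hpunct; have xH := HpunctH xP.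
have cc : Cn 2 D chd by apply: Cn_sub (Cn_chd oH 2); exact: DH.
rewrite (@gam_ext R N D oD _ (fun y => isinh y * gam u chd y) u x Dx); last first.
  by move=> y /DP yP; rewrite gamC gam_rdistl// gamC.
rewrite (gam_mul u Dx (Cn_sub DP (Cn_isinh 1)) (Cn_gam oD DH u2 cc)).
rewrite gam_isinh// gam_rdistl// [gam (gam u u) rdist x]gamC gam_rdistl//.
rewrite [gam u rdist x]gamC gam_rdistl// [gam chd (gam u u) x]gamC [gam u chd x]gamC.
have := hess_chd oH oD DH Dx u2; rewrite /isinh /coth cosh_rdist//.
move: (gam (gam u u) chd x) (gam (gam u chd) u x) => p q pq.
have -> : q = chd x * gam u u x + p / 2 by rewrite -pq subrK.
by field; rewrite gt_eqF.
Qed.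

End Radial.

(** * Flat functions and cutoffs *)

Section Flat.
Variable R : realType.
Implicit Types (p : {poly R}) (t : R).

(* The span of these functions is closed under derivation, also at 0. *)
Definition flat p t : R := if 0 < t then p.[t^-1] * expR (- t^-1) else 0.

Lemma horner_le p (z : R) : 1 <= z ->
  `|p.[z]| <= (\sum_(i < size p) `|p`_i|) * z ^+ size p.
Proof.
move=> z1; rewrite horner_coef (le_trans (ler_norm_sum _ _ _))//.
rewrite mulr_suml ler_sum// => i _; rewrite normrM ler_wpM2l//.
rewrite ger0_norm ?exprn_ge0 ?(le_trans ler01 z1)//.
by rewrite ler_weXn2l// ltnW.
Qed.

(** Take 1 + y <= exp y at y = z / (n + 1) and raise to the power n + 1. *)
Lemma exprn_le_expR n (z : R) : 0 <= z -> z ^+ n.+1 <= n.+1%:R ^+ n.+1 * expR z.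
Proof.
move=> z0.
have n0 : n.+1%:R != 0 :> R by rewrite pnatr_eq0.
have -> : expR z = expR (z / n.+1%:R) ^+ n.+1.
  by rewrite -expRM_natl mulrC divfK.
rewrite -exprMn ler_pXn2r ?nnegrE ?mulr_ge0 ?expR_ge0//.
rewrite mulrC -ler_pdivrMr// (le_trans _ (expR_ge1Dx _))//.
by rewrite lerDr.
Qed.

(** The exponential absorbs the polynomial in 1 / t and one further power, which leaves the factor
    [|t|]. *)
Lemma flat_small p : exists2 C, 0 <= C & forall t, `|t| <= 1 -> `|flat p t| <= C * `|t|.
Proof.
set n := size p; pose C0 : R := \sum_(i < size p) `|p`_i|.
have C00 : 0 <= C0 by apply: sumr_ge0.
exists (C0 * n.+1%:R ^+ n.+1) => [|t t1]; first by rewrite mulr_ge0// exprn_ge0.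
rewrite /flat; case: ifPn => [t0|_]; last by rewrite normr0 !mulr_ge0// exprn_ge0.
rewrite (gtr0_norm t0) in t1 *.
have z1 : 1 <= t^-1 by rewrite invf_ge1.
rewrite normrM [X in _ * X]ger0_norm ?expR_ge0//.
apply: (le_trans (ler_wpM2r (expR_ge0 _) (horner_le _ z1))).
rewrite -/n -/C0 -mulrA -mulrA ler_wpM2l// expRN ler_pdivrMr ?expR_gt0//.
rewrite mulrAC -ler_pdivrMr//.
by have := @exprn_le_expR n (t^-1) (le_trans ler01 z1); rewrite exprS mulrC.
Qed.

Lemma flat_le0 p t : t <= 0 -> flat p t = 0.
Proof. by move=> t0; rewrite /flat ltNge t0. Qed.

Lemma flat_gt0 p t : 0 < t -> flat p t = p.[t^-1] * expR (- t^-1).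
Proof. by move=> t0; rewrite /flat t0. Qed.

Lemma is_derive_flat p t : is_derive t (1 : R) (flat p) (flat ((p - p^`()) * 'X^2) t).
Proof.
have [t0|t0|->] := ltgtP t 0.
- rewrite flat_le0 ?(ltW t0)//.
  apply: (is_derive_open (D := [set x : R | x < 0]) (f := fun=> 0 : R)) => //.
  by move=> y /= y0; rewrite flat_le0// ltW.
- rewrite flat_gt0//.
  apply: (is_derive_open (D := [set x : R | 0 < x]) (f := fun x : R => p.[x^-1] * expR (- x^-1))) => //.
    by move=> y /= y0; rewrite flat_gt0.
  have tn0 : t != 0 by rewrite gt_eqF.
  have d0 : is_derive t (1 : R) (fun x => x^-1) (- (t^-1) ^+ 2).
    by der_eq => //; rewrite exprVn mulN1r.
  have d1 := @is_derive_comp R R (horner p) (fun x => x^-1) t 1 _ _ (is_derive_poly p t^-1) d0.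
  have dN : is_derive t (1 : R) (fun x => - x^-1) ((t^-1) ^+ 2).
    by rewrite -[X in is_derive _ _ _ X]opprK; exact: is_derive_opp.
  have d2 := @is_derive_comp R R expR (fun x => - x^-1) t 1 _ _ (is_derive_expR (- t^-1)) dN.
  by der_eq; rewrite hornerM hornerD hornerN hornerXn; ring.
rewrite flat_le0//.
(* At 0 the difference quotient of [flat p] is [flat (p * 'X)], which tends to 0 by [flat_small]. *)
have cvg0 : (fun h : R => h^-1 *: ((flat p \o shift 0) (h *: (1 : R)) - flat p 0)) @ 0^' --> (0 : R).
  have [C C0 HC] := flat_small (p * 'X).
  apply/cvgrPdist_le => eps eps0; near=> h.
  have h0 : h != 0 by near: h; exact: nbhs_dnbhs_neq.
  have h1 : `|h| <= 1.
    near: h; apply: dnbhs0_le; exact: ltr01.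
  have hC : `|h| <= eps / (C + 1).
    near: h; apply: dnbhs0_le; by rewrite divr_gt0// ltr_wpDl.
  rewrite /= addr0 (flat_le0 _ (lexx 0)) subr0 sub0r normrN -[h *: 1]/(h * 1) mulr1.
  rewrite (_ : h^-1 *: flat p h = flat (p * 'X) h); last first.
    rewrite /flat -[_ *: _]/(h^-1 * _); case: ifP => _; last by rewrite mulr0.
    by rewrite hornerM hornerX; ring.
  apply: (le_trans (HC h h1)); rewrite (le_trans (ler_wpM2l C0 hC))//.
  rewrite mulrCA; apply: ler_piMr; first exact: ltW.
  by rewrite ler_pdivrMr ?ltr_wpDl// mul1r lerDl.
split; first by apply/cvg_ex; exists 0.
exact: (cvg_lim _ cvg0).
Unshelve. all: by end_near.
Qed.

Lemma flat_ge0 t : 0 <= flat 1 t.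
Proof. by rewrite /flat hornerC mul1r; case: ifP => _ //; exact: expR_ge0. Qed.

Lemma flat1_gt0 t : 0 < t -> 0 < flat 1 t.
Proof. by move=> t0; rewrite flat_gt0// hornerC mul1r expR_gt0. Qed.

Lemma Cn_flat N n (D : set 'rV[R]_N) p (f : 'rV[R]_N -> R) : open D -> Cn n D f ->
  Cn n D (fun y => flat p (f y)).
Proof.
move=> oD fD; apply: (@Cn_comp _ _ _ _ setT (fun h => exists p, h = flat p)) => //; last by exists p.
move=> _ [q ->]; exists (flat ((q - q^`()) * 'X^2)); split; first by eexists.
by move=> t _; exact: is_derive_flat.
Qed.

(** A smooth transition from 0 on t <= 1 to 1 on t >= 2; rescaled by eps it excises the pole. *)
Definition step t : R := flat 1 (t - 1) / (flat 1 (t - 1) + flat 1 (2 - t)).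

Let den t : R := flat 1 (t - 1) + flat 1 (2 - t).
Let den_gt0 t : 0 < den t.
Proof.
rewrite /den; have [t1|t1] := ltP 1 t.
  by rewrite ltr_pwDl ?flat_ge0// flat1_gt0// subr_gt0.
by rewrite ltr_wpDl ?flat_ge0// flat1_gt0// subr_gt0 (le_lt_trans t1)// ltr1n.
Qed.

Lemma step_ge0 t : 0 <= step t.
Proof. by rewrite divr_ge0 ?flat_ge0// ltW// den_gt0. Qed.

Lemma step_le1 t : step t <= 1.
Proof. by rewrite ler_pdivrMr ?den_gt0// mul1r lerDl flat_ge0. Qed.

Lemma step0 t : t <= 1 -> step t = 0.
Proof. by move=> t1; rewrite /step flat_le0 ?subr_le0// mul0r. Qed.

Lemma step1 t : 2 <= t -> step t = 1.
Proof.
move=> t1; rewrite /step [flat 1 (2 - t)]flat_le0 ?subr_le0// addr0 divff//.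
by rewrite gt_eqF// flat1_gt0// subr_gt0 (lt_le_trans _ t1)// ltr1n.
Qed.

Definition step' t : R :=
  (flat 'X^2 (t - 1) * flat 1 (2 - t) + flat 1 (t - 1) * flat 'X^2 (2 - t)) /
  (flat 1 (t - 1) + flat 1 (2 - t)) ^+ 2.

Let is_derive_flat_lo p t :
  is_derive t (1 : R) (fun x => flat p (x - 1)) (flat ((p - p^`()) * 'X^2) (t - 1)).
Proof.
have d0 : is_derive t (1 : R) (fun x => x - 1) 1 by der_eq; ring.
by have := @is_derive_comp R R (flat p) (fun x => x - 1) t 1 _ _ (is_derive_flat p (t - 1)) d0; rewrite mulr1.
Qed.

Let is_derive_flat_hi p t :
  is_derive t (1 : R) (fun x => flat p (2 - x)) (- flat ((p - p^`()) * 'X^2) (2 - t)).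
Proof.
have d1 : is_derive t (1 : R) (fun x => 2 - x) (-1) by der_eq; ring.
by have := @is_derive_comp R R (flat p) (fun x => 2 - x) t 1 _ _ (is_derive_flat p (2 - t)) d1; rewrite mulrN1.
Qed.

Lemma is_derive_step t : is_derive t (1 : R) step (step' t).
Proof.
have E : ((1 - 1^`()) * 'X^2 : {poly R}) = 'X^2 by rewrite derivC subr0 mul1r.
have e1 := is_derive_flat_lo 1 t; have e2 := is_derive_flat_hi 1 t.
rewrite E in e1 e2.
have dn0 : flat 1 (t - 1) + flat 1 (2 - t) != 0 by rewrite gt_eqF// den_gt0.
by rewrite /step; der_eq => //; rewrite /step'; field.
Qed.

Lemma continuous_step' : continuous step'.
Proof.
move=> t.
have e1 := is_derive_flat_lo 1 t; have e2 := is_derive_flat_hi 1 t.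
have e3 := is_derive_flat_lo 'X^2 t; have e4 := is_derive_flat_hi 'X^2 t.
have dn0 : (flat 1 (t - 1) + flat 1 (2 - t)) ^+ 2 != 0 by rewrite expf_neq0// gt_eqF// den_gt0.
suff [d] : exists d, is_derive t (1 : R) step' d by apply: is_derive_continuous.
by eexists; rewrite /step'; der.
Qed.

Lemma step'_out t : ~ (1 < t < 2) -> step' t = 0.
Proof.
move=> /negP; rewrite negb_and -!leNgt => /orP[t1|t2]; rewrite /step'.
  by rewrite !(flat_le0 _ (_ : t - 1 <= 0)) ?subr_le0// mul0r mul0r addr0 mul0r.
by rewrite !(flat_le0 _ (_ : 2 - t <= 0)) ?subr_le0// mulr0 mulr0 addr0 mul0r.
Qed.

Lemma step'_bounded : exists2 K, 0 <= K & forall t, `|step' t| <= K.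
Proof.
have c : {within `[(1 : R), 2], continuous (fun t => `|step' t|)}.
  apply: continuous_subspaceT => t; apply: continuous_comp; first exact: continuous_step'.
  exact: norm_continuous.
have [|k _ Hk] := EVT_max _ c; first by rewrite ler1n.
exists `|step' k| => // t.
have [/andP[t1 t2]|/negP t12] := boolP (1 < t < 2).
  by apply: Hk; rewrite in_itv/= !ltW.
by rewrite step'_out// normr0.
Qed.

End Flat.

(** * The pointwise Rellich identity *)

Section HyperbolicBounds.
Variable R : realType.
Implicit Types t : R.
Local Notation sinh := (@sinh R).

Lemma le_sinh s t : s <= t -> sinh s <= sinh t.
Proof. by move=> st; rewrite ler_pM2r ?invr_gt0// lerB// ler_expR// lerN2. Qed.

Lemma le_cosh s t : 0 <= s -> s <= t -> cosh s <= cosh t.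
Proof.
move=> s0 st; have c0 x := le_trans ler01 (@cosh_ge1 R x).
rewrite -(@ler_pXn2r _ 2)// ?nnegrE// !sqr_cosh lerD2l ler_pXn2r// ?nnegrE.
- exact: le_sinh.
- by rewrite -sinh0 le_sinh.
- by rewrite -sinh0 le_sinh// (le_trans s0).
Qed.

Lemma sinh_le t : 0 < t -> sinh t <= t * cosh t.
Proof.
move=> t0.
have [||c] := @MVT R (fun t => sinh t) (@cosh R) 0 t t0.
- by move=> x _; exact: is_derive_sinh.
- by apply: continuous_subspaceT => x; apply: is_derive_continuous (is_derive_sinh x).
rewrite in_itv/= sinh0 !subr0 => /andP[c0 ct] ->.
by rewrite mulrC ler_pM2l// le_cosh// ltW.
Qed.

Lemma invr_le_coth t : 0 < t -> t^-1 <= coth t.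
Proof.
move=> t0; have s0 := sinh_gt0 t0.
by rewrite /coth ler_pdivlMr// mulrC ler_pdivrMr// mulrC sinh_le.
Qed.

Lemma coth_gt0 t : 0 < t -> 0 < coth t.
Proof. by move=> t0; apply: lt_le_trans (invr_le_coth t0); rewrite invr_gt0. Qed.

Lemma sqr_coth t : 0 < t -> coth t ^+ 2 = 1 + (sinh t ^+ 2)^-1.
Proof.
move=> t0; have s0 := sinh_gt0 t0.
by rewrite /coth expr_div_n sqr_cosh; field; rewrite gt_eqF.
Qed.

Lemma invr_sqr_sinh_lt t : 0 < t -> (sinh t ^+ 2)^-1 < (t^-1) ^+ 2.
Proof.
move=> t0; have s0 := sinh_gt0 t0.
by rewrite exprVn ltf_pV2 ?posrE ?exprn_gt0// ltr_pXn2r ?nnegrE ?ltW// sinh_gt.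
Qed.

End HyperbolicBounds.

(** * Neighbourhoods of the pole *)

Section NearCenter.
Variables (R : realType) (N : nat) (o : 'rV[R]_N).
Hypothesis oH : inH o.
Local Notation V := 'rV[R]_N.
Local Notation Hball := (@Hball R N).
Local Notation Hpunct := (Hpunct o).
Local Notation r := (rdist o).
Implicit Types x : V.
Let oP : open Hpunct := @open_Hpunct R N o.

Lemma Cn_sinh_rdist n : Cn n Hpunct (fun x => sinh (r x)).
Proof.
have rC := Cn_rdist oH n.
have e1 := Cn_expR oP rC; have e2 := Cn_expR oP (Cn_opp oP rC).
exact: (Cn_mul oP (Cn_add oP e1 (Cn_opp oP e2)) (Cn_cst n _ oP)).
Qed.

Lemma Cn_coth_rdist n : Cn n Hpunct (fun x => coth (r x)).
Proof.
have rC := Cn_rdist oH n; have sC := Cn_sinh_rdist n.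
have e1 := Cn_expR oP rC; have e2 := Cn_expR oP (Cn_opp oP rC).
apply: (Cn_mul oP (Cn_mul oP (Cn_add oP e1 e2) (Cn_cst n _ oP))).
by apply: (Cn_inv oP _ sC) => x /(sinh_rdist_gt0 oH) h; rewrite gt_eqF.
Qed.

(** Small balls about the pole are described by cosh r, which is continuous there, since r is
    treated only off the pole. *)
Lemma open_chd_lt (y : R) : open (Hball `&` [set x | chd o x < y]).
Proof.
have oB := @open_Hball R N.
rewrite openE => x [xH xc]; apply: filterI; first exact: open_nbhs_nbhs.
have cf := CnE (Cn_chd oH 0) xH.
by apply: (cf [set t : R | t < y]); apply: open_nbhs_nbhs; split => //; exact: open_lt.
Qed.

Lemma cosh_gt1 (t : R) : 0 < t -> 1 < cosh t.
Proof.
move=> t0; have s0 := sinh_gt0 t0.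
rewrite -(@ltr_pXn2r _ 2)// ?nnegrE ?(le_trans ler01 (cosh_ge1 _))//.
by rewrite expr1n sqr_cosh ltrDl exprn_gt0.
Qed.

Lemma acosh_cosh (t : R) : 0 < t -> acosh (cosh t) = t.
Proof.
move=> t0; rewrite /acosh sqr_cosh addrAC subrr add0r sqrtr_sqr ger0_norm ?(ltW (sinh_gt0 t0))//.
rewrite (_ : cosh t + Defs.sinh t = expR t) ?expRK//.
by rewrite /cosh /Defs.sinh; field.
Qed.

Lemma chd_center : chd o o = 1.
Proof.
rewrite /chd subrr (_ : eucl2 0 = 0); last by apply: big1 => i _; rewrite mxE expr0n.
by rewrite mulr0 mul0r addr0.
Qed.

Lemma rdist_le_chd (a : R) x : 0 < a -> Hpunct x -> chd o x < cosh a -> r x <= a.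
Proof.
move=> a0 xP xc; rewrite leNgt; apply/negP => er; move: xc.
by rewrite -(cosh_rdist oH xP) ltNge le_cosh// ltW.
Qed.

Lemma near_center (a : R) : 0 < a -> (Hball `&` [set x | chd o x < cosh a]) o.
Proof. by move=> a0; split; [exact: oH|rewrite /= chd_center cosh_gt1]. Qed.

End NearCenter.

Section Certificate.
Variables (R : realType) (N : nat) (o : 'rV[R]_N).
Hypotheses (oH : inH o) (N5 : (5 <= N)%N).
Local Notation V := 'rV[R]_N.
Local Notation e := (ebase R).
Local Notation gam := (@gam R N).
Local Notation Hpunct := (Hpunct o).
Local Notation r := (rdist o).
Variables (u : V -> R) (X Xd : R -> R).
Hypotheses (uC : forall n, Cn n Hpunct u).
Hypothesis (Xder : forall t : R, 0 < t -> is_derive t (1 : R) X (Xd t)).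
Hypothesis (XC : Cn 1 Hpunct (fun x => X (r x))).
Implicit Types x y : V.

Let N2 : (2 <= N)%N. Proof. exact: leq_trans N5. Qed.

Definition hm : R := (N%:R - 1) / 2.
Definition hb : R := hm * (hm - 1).

Let ti y := (r y)^-1.
Let co y := coth (r y).
Let ur := gam u r.
Let G2 := gam u u.

(* Here [t = 1 / r] and [c = coth r], so that [c ^ 2 - 1 = 1 / sinh r ^ 2]. *)
Definition pcoef (t : R) : R := - (t / 2).
Definition qcoef (t c : R) : R := 2 * (hm ^+ 2 + hb * (c ^+ 2 - 1)) - hm * t * c.
Definition hcoef (t c : R) : R :=
  - (2 * hb * hm * c * (c ^+ 2 - 1)) + (hm + 3 * hb) / 2 * t * (c ^+ 2 - 1)
  + 3 / 2 * hm ^+ 2 * t + 3 / 8 * t ^+ 3 - 2 * hm ^+ 3 * c.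

(** The field is phir grad r - phiu grad u. [phiu] collects the factors of [LB u] in the expanded
    square, the [pcoef] terms are those of the Rellich-Pohozaev multiplier du/dr, and [hcoef] is
    forced by matching the terms in [u * ur]. *)
Let phir y := X (r y) * (hcoef (ti y) (co y) * u y ^+ 2 + pcoef (ti y) * G2 y).
Let phiu y := X (r y) * (qcoef (ti y) (co y) * u y + 2 * pcoef (ti y) * ur y).

(* The components are densities with respect to the Euclidean volume: the factor
   [conf ^ (N - 2)] makes the Euclidean divergence a multiple of the Riemannian one. *)
Definition rellich_field (i : 'I_N) y : R :=
  conf y ^+ (N - 2) * (phir y * dpart i r y)
  - conf y ^+ (N - 2) * (phiu y * dpart i u y).

(** [hdcoef] and [qdcoef] are the radial derivatives of [hcoef] and [qcoef], by t' = - t^2 and c' =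
    1 - c^2. *)
Let hdcoef (t c : R) : R :=
  - (2 * hb * hm * (3 * c ^+ 2 - 1) * (1 - c ^+ 2))
  + (hm + 3 * hb) / 2 * (- t ^+ 2 * (c ^+ 2 - 1) + 2 * c * t * (1 - c ^+ 2))
  - 3 / 2 * hm ^+ 2 * t ^+ 2 - 9 / 8 * t ^+ 4 - 2 * hm ^+ 3 * (1 - c ^+ 2).
Let qdcoef (t c : R) : R :=
  4 * hb * c * (1 - c ^+ 2) + hm * t ^+ 2 * c - hm * t * (1 - c ^+ 2).

(** The radial component of the field without its factor [X]: this is what multiplies the derivative
    of the cutoff. *)
Definition errterm y : R :=
  hcoef (ti y) (co y) * u y ^+ 2 - qcoef (ti y) (co y) * u y * ur y
  - 2 * pcoef (ti y) * ur y ^+ 2 + pcoef (ti y) * G2 y.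

(** The five weights of the theorem in terms of m: 2 m^2 - 2 = (N - 3)(N + 1) / 2 and hb - 3/2 =
    (N^2 - 4 N - 3) / 4. *)
Definition weight (t c : R) : R :=
  hm ^+ 4 + hm ^+ 2 / 2 * t ^+ 2 + 9 / 16 * t ^+ 4
  + hb * (2 * hm ^+ 2 - 2) * (c ^+ 2 - 1) + hb * (hb - 3 / 2) * (c ^+ 2 - 1) ^+ 2.

Let oP : open Hpunct := @open_Hpunct R N o.
Let PH : Hpunct `<=` @Hball R N := @HpunctH R N o.

Let rC n : Cn n Hpunct r. Proof. exact: Cn_rdist. Qed.
Let tiC n : Cn n Hpunct ti.
Proof. by apply: (Cn_inv oP _ (rC n)) => x /(rdist_gt0 oH) h; rewrite gt_eqF. Qed.

Let coC n : Cn n Hpunct co. Proof. exact: Cn_coth_rdist. Qed.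

Let urC n : Cn n Hpunct ur. Proof. exact: Cn_gam. Qed.
Let G2C n : Cn n Hpunct G2. Proof. exact: Cn_gam. Qed.

Ltac cn := repeat match goal with
  | |- open _ => exact oP
  | |- Cn _ _ (fun _ => ?c) => exact (Cn_cst _ _ oP)
  | |- Cn _ _ (fun y => X (r y)) => exact XC
  | |- Cn _ _ (fun y => ti y) => exact (tiC _)
  | |- Cn _ _ (fun y => co y) => exact (coC _)
  | |- Cn _ _ (fun y => ur y) => exact (urC _)
  | |- Cn _ _ (fun y => G2 y) => exact (G2C _)
  | |- Cn _ _ (fun y => u y) => exact (uC _)
  | |- Cn ?n ?D (fun y => @?f y + @?g y) => refine (@Cn_add _ _ n D f g oP _ _); cbv beta
  | |- Cn ?n ?D (fun y => @?f y * @?g y) => refine (@Cn_mul _ _ n D f g oP _ _); cbv beta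
  | |- Cn ?n ?D (fun y => - @?f y) => refine (@Cn_opp _ _ n D f oP _); cbv beta
  | |- Cn ?n ?D (fun y => @?f y ^+ ?k) => refine (@Cn_exp _ _ n D f k oP _); cbv beta
  end.

Lemma phirC : Cn 1 Hpunct phir.
Proof. rewrite /phir /hcoef /pcoef; cn. Qed.

Lemma phiuC : Cn 1 Hpunct phiu.
Proof. rewrite /phiu /qcoef /pcoef; cn. Qed.

Let kC : Cn 1 Hpunct (fun y => conf y ^+ (N - 2)).
Proof. exact: (Cn_exp _ oP (Cn_sub PH (Cn_conf _ _ 1))). Qed.

Let kphirC i : Cn 1 Hpunct (fun y => conf y ^+ (N - 2) * (phir y * dpart i r y)).
Proof. exact: (Cn_mul oP kC (Cn_mul oP phirC (Cn_dpart i (rC 2)))). Qed.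

Let kphiuC i : Cn 1 Hpunct (fun y => conf y ^+ (N - 2) * (phiu y * dpart i u y)).
Proof. exact: (Cn_mul oP kC (Cn_mul oP phiuC (Cn_dpart i (uC 2)))). Qed.

Lemma Cn_rellich_field i : Cn 1 Hpunct (rellich_field i).
Proof. exact: (Cn_add oP (kphirC i) (Cn_opp oP (kphiuC i))). Qed.

Section Point.
Variable x : V.
Hypothesis xP : Hpunct x.
Let r0 : 0 < r x. Proof. exact: rdist_gt0. Qed.

Let dr i := Cn_is_derive i (rC 1) xP.
Let dX i : is_derive x (e i) (fun y => X (r y)) (Xd (r x) * dpart i r x).
Proof. by apply: is_derive_comp; [exact: Xder|exact: dr]. Qed.
Let dti i : is_derive x (e i) ti (- ti x ^+ 2 * dpart i r x).
Proof.
have d := dr i; rewrite /ti; der_eq; first by rewrite gt_eqF.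
by rewrite exprVn; ring.
Qed.
Let dco i : is_derive x (e i) co ((1 - co x ^+ 2) * dpart i r x).
Proof.
apply: is_derive_comp; last exact: dr.
by apply: is_derive_coth; rewrite gt_eqF// sinh_gt0.
Qed.

Let gam_phir : gam phir r x =
  (Xd (r x) * (hcoef (ti x) (co x) * u x ^+ 2 + pcoef (ti x) * G2 x)
   + X (r x) * (hdcoef (ti x) (co x) * u x ^+ 2 + ti x ^+ 2 / 2 * G2 x))
  + 2 * X (r x) * hcoef (ti x) (co x) * u x * ur x
  + X (r x) * pcoef (ti x) * gam G2 r x.
Proof.
set c1 := Xd (r x) * _ + _.
(* [k] freezes the radial coefficients at [x]. Their own variation is parallel to grad r and is
   collected in [c1], paired with |grad r|^2 = 1. *)
pose k := fun y => 2 * X (r x) * hcoef (ti x) (co x) * u x * u y + X (r x) * pcoef (ti x) * G2 y.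
have kE : gam k r x = 2 * X (r x) * hcoef (ti x) (co x) * u x * gam u r x
   + X (r x) * pcoef (ti x) * gam G2 r x.
  apply: gam_lin => i; apply: dpart_is_derive.
  have d1 := Cn_is_derive i (uC 1) xP; have d2 := Cn_is_derive i (G2C 1) xP.
  by rewrite /k; der_eq; ring.
rewrite -addrA -kE (_ : gam phir r x = c1 * gam r r x + 1 * gam k r x).
  by rewrite (gam_rdist oH xP) mulr1 mul1r.
apply: gam_lin => i.
have d1 := Cn_is_derive i (uC 1) xP; have d2 := Cn_is_derive i (G2C 1) xP.
have d3 := dX i; have d4 := dti i; have d5 := dco i.
have -> : dpart i k x = 2 * X (r x) * hcoef (ti x) (co x) * u x * dpart i u x
   + X (r x) * pcoef (ti x) * dpart i G2 x.
  by apply: dpart_is_derive; rewrite /k; der_eq; ring.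
by apply: dpart_is_derive; rewrite /phir /c1 /hdcoef /hcoef /pcoef; der_eq; rewrite /=; field.
Qed.

Let gam_phiu : gam phiu u x =
  (Xd (r x) * (qcoef (ti x) (co x) * u x + 2 * pcoef (ti x) * ur x)
   + X (r x) * (qdcoef (ti x) (co x) * u x + ti x ^+ 2 * ur x)) * ur x
  + X (r x) * qcoef (ti x) (co x) * G2 x
  + 2 * X (r x) * pcoef (ti x) * gam ur u x.
Proof.
set c1 := Xd (r x) * _ + _.
pose k := fun y => X (r x) * qcoef (ti x) (co x) * u y + 2 * X (r x) * pcoef (ti x) * ur y.
have kE : gam k u x = X (r x) * qcoef (ti x) (co x) * gam u u x
   + 2 * X (r x) * pcoef (ti x) * gam ur u x.
  apply: gam_lin => i; apply: dpart_is_derive.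
  have d1 := Cn_is_derive i (uC 1) xP; have d2 := Cn_is_derive i (urC 1) xP.
  by rewrite /k; der_eq; ring.
rewrite -addrA -kE (_ : gam phiu u x = c1 * gam r u x + 1 * gam k u x).
  by rewrite mul1r gamC.
apply: gam_lin => i.
have d1 := Cn_is_derive i (uC 1) xP; have d2 := Cn_is_derive i (urC 1) xP.
have d3 := dX i; have d4 := dti i; have d5 := dco i.
have -> : dpart i k x = X (r x) * qcoef (ti x) (co x) * dpart i u x
   + 2 * X (r x) * pcoef (ti x) * dpart i ur x.
  by apply: dpart_is_derive; rewrite /k; der_eq; ring.
by apply: dpart_is_derive; rewrite /phiu /c1 /qdcoef /qcoef /pcoef; der_eq; rewrite /=; field.
Qed.

(** As grad r has unit length, the difference is the squared length of grad u - ur grad r. *)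
Lemma gam_Cauchy_Schwarz : ur x ^+ 2 <= G2 x.
Proof.
rewrite -subr_ge0.
have -> : G2 x - ur x ^+ 2 = (conf x)^-1 ^+ 2 *
    \sum_(i < N) (dpart i u x - ur x * dpart i r x) ^+ 2.
  have -> : \sum_(i < N) (dpart i u x - ur x * dpart i r x) ^+ 2 =
    \sum_(i < N) dpart i u x * dpart i u x - 2 * ur x * \sum_(i < N) dpart i u x * dpart i r x
    + ur x ^+ 2 * \sum_(i < N) dpart i r x * dpart i r x.
    rewrite !mulr_sumr -sumrN -!big_split/=; apply: eq_bigr => i _; ring.
  rewrite 2!mulrDr -[(conf x)^-1 ^+ 2 * \sum_(i < N) dpart i u x * dpart i u x]/(gam u u x).
  rewrite mulrN [_ * (2 * ur x * _)]mulrCA.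
  rewrite -[(conf x)^-1 ^+ 2 * \sum_(i < N) dpart i u x * dpart i r x]/(ur x).
  rewrite [_ * (ur x ^+ 2 * _)]mulrCA.
  rewrite -[(conf x)^-1 ^+ 2 * \sum_(i < N) dpart i r x * dpart i r x]/(gam r r x).
  by rewrite (gam_rdist oH xP) -/G2 -/(G2 x); ring.
by rewrite mulr_ge0 ?sqr_ge0// sumr_ge0// => i _; exact: sqr_ge0.
Qed.

Lemma div_rellich_field : \sum_(i < N) dpart i (rellich_field i) x = conf x ^+ N *
  (phir x * (N%:R - 1) * co x + gam phir r x - phiu x * LB u x - gam phiu u x).
Proof.
rewrite (eq_bigr (fun i => dpart i (fun y => conf y ^+ (N - 2) * (phir y * dpart i r y)) x
    - dpart i (fun y => conf y ^+ (N - 2) * (phiu y * dpart i u y)) x)); last first.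
  move=> i _; apply: dpart_is_derive.
  have d1 := Cn_is_derive i (kphirC i) xP; have d2 := Cn_is_derive i (kphiuC i) xP.
  exact: is_derive_add d1 (is_derive_opp d2).
rewrite big_split/= sumrN.
have E1 := div_grad oP PH N2 xP phirC (rC 2).
have E2 := div_grad oP PH N2 xP phiuC (uC 2).
transitivity (conf x ^+ N * (phir x * LB r x + gam phir r x)
  - conf x ^+ N * (phiu x * LB u x + gam phiu u x)).
  by congr (_ - _); [exact: E1|exact: E2].
by rewrite (LB_rdist oH N2 xP) -/(co x); ring.
Qed.

(* [LB u ^ 2] minus the weight is a sum of squares (the inner terms are the
   Hardy ground states r^(3/2), r^(1/2) and sinh r * r^(1/2)) plus a divergence. *)
Lemma certificate : 0 <= X (r x) ->
  X (r x) * (weight (ti x) (co x) * u x ^+ 2) +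
    (conf x ^+ N)^-1 * \sum_(i < N) dpart i (rellich_field i) x
  <= X (r x) * LB u x ^+ 2 + Xd (r x) * errterm x.
Proof.
move=> X0; rewrite div_rellich_field mulKf ?(expf_neq0 _ (conf_neq0 (PH xP)))//.
rewrite gam_phir gam_phiu.
have hs := hess_rdist oH oP (fun y h => h) xP (uC 2).
have -> : gam G2 r x = 2 * (gam ur u x - co x * (G2 x - ur x ^+ 2)).
  by rewrite /co /ur /G2 -hs; field.
have cs := gam_Cauchy_Schwarz.
have c1 : 0 <= co x ^+ 2 - 1.
  by rewrite /co sqr_coth// addrAC subrr add0r invr_ge0 sqr_ge0.
have ct : co x ^+ 2 - 1 <= ti x ^+ 2.
  by rewrite /co sqr_coth// addrAC subrr add0r ltW// invr_sqr_sinh_lt.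
have tc : ti x <= co x := invr_le_coth r0.
have t0 : 0 < ti x by rewrite invr_gt0.
have m2 : 2 <= hm.
  rewrite /hm ler_pdivlMr// lerBrDr -natrM -[1]/(1%:R) -natrD ler_nat//.
have b2 : 2 <= hb by rewrite /hb; nra.
have NE : N%:R - 1 = 2 * hm by rewrite /hm; field.
rewrite NE /phir /phiu /errterm.
set A := hm ^+ 2 + hb * (co x ^+ 2 - 1).
set w := ur x + hm * co x * u x.
(* By [tc] the subtracted terms are at most 3/2 coth^2 = 3/2 + 3/2 (coth^2 - 1), whereas 2 A >= 8 +
   4 (coth^2 - 1) because [hm] and [hb] are at least 2. *)
have kG0 : 0 <= 2 * A - ti x * co x - ti x ^+ 2 / 2 by rewrite /A; nra.
pose sq := (LB u x - ti x / 2 * w + A * u x) ^+ 2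
  + (2 * A - ti x * co x - ti x ^+ 2 / 2) * (G2 x - ur x ^+ 2)
  + ti x ^+ 2 / 4 * (w - 3 / 2 * ti x * u x) ^+ 2
  + 2 * hm ^+ 2 * (w - ti x / 2 * u x) ^+ 2
  + 2 * hb * (co x ^+ 2 - 1) * (w - (co x + ti x / 2) * u x) ^+ 2
  + hb / 2 * (co x ^+ 2 - 1) * (ti x ^+ 2 - (co x ^+ 2 - 1)) * u x ^+ 2.
have sq0 : 0 <= sq.
  rewrite /sq; repeat apply: addr_ge0.
  - exact: sqr_ge0.
  - by rewrite mulr_ge0// subr_ge0.
  - by rewrite mulr_ge0 ?sqr_ge0// divr_ge0// sqr_ge0.
  - by rewrite mulr_ge0 ?sqr_ge0// mulr_ge0// sqr_ge0.
  - by rewrite mulr_ge0 ?sqr_ge0// mulr_ge0// mulr_ge0// (le_trans _ b2).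
  - rewrite mulr_ge0 ?sqr_ge0// mulr_ge0 ?subr_ge0// mulr_ge0// divr_ge0//.
    by rewrite (le_trans _ b2).
rewrite -subr_ge0 (_ : _ - _ = X (r x) * sq) ?mulr_ge0//.
rewrite /sq /w /A /weight /hdcoef /qdcoef /hcoef /qcoef /pcoef /hb; by field.
Qed.

End Point.
End Certificate.

(** * The Poincare-Rellich inequality *)

Section IntegrationTools.
Variables (R : realType) (N : nat).
Local Notation V := 'rV[R]_N.
Local Notation BV := (borelV R N).
Local Notation mu := (@muV R N).
Implicit Types (D : set V) (f g : V -> R).

Lemma le_add_posneg (a b : \bar R) (d : R) : (a + d%:E <= b ->
  a + Order.max d%:E 0 <= b + Order.max (- d%:E) 0)%E.
Proof.
rewrite -EFinN -!EFin_max; case: a b => [a||] [b||] //=.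
- rewrite -!EFinD !lee_fin => H.
  by case: (leP d 0) => h1; case: (leP (- d) 0) => h2; lra.
- by move=> _; rewrite addye// leey.
- by move=> _; rewrite addNye leNye.
Qed.

Definition zpatch D f : V -> R := fun x => if `[< D x >] then f x else 0.

Lemma measurable_patch_open D f : open D -> (forall x, D x -> {for x, continuous f}) ->
  measurable_fun [set: BV] (zpatch D f : BV -> R).
Proof.
move=> oD cf.
apply: (measurability (@RGenOpens.G R) (@RGenOpens.measurableE R)) => _ [_ [a [b ->]] <-].
rewrite setTI /zpatch; set I := `]a, b[%classic.
have oDI : open (D `&` f @^-1` I).
  rewrite openE => x [Dx fx]; apply: filterI; first exact: open_nbhs_nbhs.
  by apply: cf => //; apply: open_nbhs_nbhs; split => //; exact: interval_open.
rewrite (_ : _ @^-1` _ = (D `&` f @^-1` I) `|` (~` D `&` [set _ | I (0 : R)])); last first.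
  apply/seteqP; split => x /=.
    by case: asboolP => Dx Ix; [left|right].
  by move=> [[Dx fx]|[Dx I0]]; case: asboolP.
apply: measurableU; first exact: open_measurableV.
apply: measurableI; first by apply: measurableC; exact: open_measurableV.
have [I0|I0] := pselect (I (0 : R)).
  by rewrite (_ : [set _ | _] = setT); [exact: measurableT|apply/seteqP; split].
by rewrite (_ : [set _ | _] = set0); [exact: measurable0|apply/seteqP; split].
Qed.

Local Open Scope ereal_scope.

Lemma pos_meas_patch D f : open D -> (forall x, D x -> {for x, continuous f}) ->
  (forall x, D x -> (0 <= f x)%R) ->
  pos_meas (fun x : V => if `[< D x >] then (f x)%:E else 0).
Proof.
move=> oD cf f0; split=> [x|].
  by case: asboolP => // /f0; rewrite lee_fin.
rewrite (_ : (fun _ => _) = EFin \o zpatch D f).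
  by apply/measurable_EFinP; exact: measurable_patch_open.
by apply/funext => x; rewrite /zpatch/=; case: ifP.
Qed.

Lemma pos_measD (f g : V -> \bar R) : pos_meas f -> pos_meas g -> pos_meas (fun x => f x + g x).
Proof.
move=> [f0 mf] [g0 mg]; split=> [x|]; first exact: adde_ge0.
exact: emeasurable_funD.
Qed.

Lemma pos_measZ (k : R) (f : V -> \bar R) : (0 <= k)%R -> pos_meas f -> pos_meas (fun x => k%:E * f x).
Proof.
by move=> k0 [f0 mf]; split=> [x|]; [exact: mule_ge0|exact: measurable_funeM].
Qed.

Lemma integral_posD (f g : V -> \bar R) : pos_meas f -> pos_meas g ->
  \int[mu]_x (f x + g x) = \int[mu]_x f x + \int[mu]_x g x.
Proof.
move=> pf pg.
by rewrite (ge0_integralD mu measurableT (fun x _ => pf.1 x) pf.2 (fun x _ => pg.1 x) pg.2).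
Qed.

Lemma integral_posZ (k : R) (f : V -> \bar R) : (0 <= k)%R -> pos_meas f ->
  \int[mu]_x (k%:E * f x) = k%:E * \int[mu]_x f x.
Proof.
by move=> k0 pf; rewrite (ge0_integralZl mu measurableT pf.2 (fun x _ => pf.1 x)) ?lee_fin.
Qed.

Lemma integral_divergence_eq0 (E : 'I_N -> V -> R) (M : R) : (0 < M)%R ->
  (forall i, Cn 1 setT (E i)) -> (forall i x, ~ boxV (0%R : V) M x -> E i x = 0%R) ->
  mu.-integrable setT (fun x => (\sum_(i < N) dpart i (E i) x)%:E) /\
  \int[mu]_x (\sum_(i < N) dpart i (E i) x)%:E = 0.
Proof.
move=> M0 E1 E0.
have H i := integral_dpart_eq0 i M0 (E1 i) (E0 i).
have eqE : (fun x => (\sum_(i < N) dpart i (E i) x)%:E) = (fun x => \sum_(i < N) (dpart i (E i) x)%:E).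
  by apply/funext => x; rewrite sumEFin.
rewrite eqE; split.
  by apply: (@integrable_sum _ BV R mu setT measurableT) => i _; exact: (H i).1.
rewrite (@integral_sum _ BV R mu setT measurableT 'I_N (fun i x => (dpart i (E i) x)%:E)).
  by apply: big1 => i _; exact: (H i).2.
by move=> i; exact: (H i).1.
Qed.

(** The signed divergence d is split so that a + d^+ <= b + d^- compares nonnegative functions; the
    integrals of d^+ and d^- are equal and finite, hence cancel even if those of [a] or [b] are
    infinite. *)
Lemma le_integral_divergence (E : 'I_N -> V -> R) (M : R) (a b : V -> \bar R) : (0 < M)%R ->
  (forall i, Cn 1 setT (E i)) -> (forall i x, ~ boxV (0%R : V) M x -> E i x = 0%R) ->
  pos_meas a -> pos_meas b ->
  (forall x, a x + (\sum_(i < N) dpart i (E i) x)%:E <= b x) ->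
  \int[mu]_x a x <= \int[mu]_x b x.
Proof.
move=> M0 E1 E0 pa pb ab.
have [id] := integral_divergence_eq0 M0 E1 E0; set d := fun x => (\sum_(i < N) _)%:E in id *.
rewrite integralE => intd0.
have md : measurable_fun [set: BV] d by case/integrableP: id.
have pp : pos_meas (d^\+) by split=> //; exact: measurable_funepos.
have pn : pos_meas (d^\-) by split=> //; exact: measurable_funeneg.
have fn : \int[mu]_x d^\- x \is a fin_num := integrable_neg_fin_num measurableT id.
have fp : \int[mu]_x d^\+ x \is a fin_num := integrable_pos_fin_num measurableT id.
have pnE : \int[mu]_x d^\+ x = \int[mu]_x d^\- x.
  move: intd0 fp fn; case: (integral _ _ _) => [p||]//; case: (integral _ _ _) => [q||]//=.
  by move=> [/eqP]; rewrite subr_eq0 => /eqP ->.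
have H : \int[mu]_x (a x + d^\+ x) <= \int[mu]_x (b x + d^\- x).
  apply: ge0_le_integral => //.
  - by move=> x _; apply: adde_ge0; [exact: pa.1|exact: pp.1].
  - exact: (pos_measD pa pp).2.
  - exact: (pos_measD pb pn).2.
  - by move=> x _; rewrite funeposE funenegE; apply: le_add_posneg; exact: ab.
rewrite (integral_posD pa pp) (integral_posD pb pn) in H.
by move: H; rewrite pnE leeD2rE.
Qed.

Lemma boxV_point (o : V) : boxV o 0 = [set o].
Proof.
apply/seteqP; split => x /=; last by move=> -> i; rewrite subrr normr0.
move=> H; apply/rowP => i; apply/eqP; rewrite -subr_eq0 -normr_le0; exact: H.
Qed.

(** A point is a cube of half-side 0, of volume 0^N = 0. *)
Lemma integral_off_point (o : V) (f g : V -> \bar R) : (0 < N)%N -> pos_meas f -> pos_meas g ->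
  (forall x, x != o -> f x = g x) -> \int[mu]_x f x = \int[mu]_x g x.
Proof.
move=> N0 pf pg fg.
apply: ge0_ae_eq_integral => //; [exact: pf.2|exact: pg.2| | |].
- by move=> x _; exact: pf.1.
- by move=> x _; exact: pg.1.
exists [set o]; split.
- by rewrite -boxV_point; exact: measurable_boxV.
- by rewrite -boxV_point [LHS](muV_box o (lexx 0%R)) mul0rn expr0n gtn_eqF.
- move=> x /= H; apply/eqP; apply: contrapT => /negP xo; apply: H => _; exact: fg.
Qed.

Lemma integral_box_cst (c : V) (k r : R) : (0 <= k)%R -> (0 <= r)%R ->
  pos_meas (fun x => (k * \1_(boxV c r) x)%:E) /\
  \int[mu]_x (k * \1_(boxV c r) x)%:E = (k * (r *+ 2) ^+ N)%:E.
Proof.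
move=> k0 r0; have mb := measurable_boxV c r.
have pi := pos_meas_indic mb.
under eq_fun do rewrite EFinM.
split; first exact: pos_measZ.
rewrite ge0_integralZl ?lee_fin//; last exact: pi.2.
by rewrite integral_indic// setIT [X in _ * X](muV_box c r0) EFinM.
Qed.

End IntegrationTools.

(** * Compactly supported functions *)

Section Support.
Variables (R : realType) (N : nat) (u : 'rV[R]_N -> R).
Hypothesis uc : Cc_inf_H u.
Local Notation V := 'rV[R]_N.
Local Notation K := (closure [set x | u x != 0]).

Lemma Cc_Cn n (D : set V) : Cn n D u.
Proof. by apply: (@Cn_sub _ _ _ setT) => //; move: n; apply/smoothP; case: uc. Qed.

Lemma open_suppC : open (~` K).
Proof. by rewrite openC; exact: closed_closure. Qed.

Lemma suppC0 x : (~` K) x -> u x = 0.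
Proof.
move=> xK; apply/eqP; apply: contrapT => /negP ux; apply: xK.
exact: subset_closure.
Qed.

Lemma supp_Hball : K `<=` @Hball R N. Proof. by case: uc => _ []. Qed.

Lemma compact_supp : compact K. Proof. by case: uc => _ []. Qed.

Lemma suppC_dpart i x : (~` K) x -> dpart i u x = 0.
Proof.
move=> xK; rewrite (dpart_open (g := fun=> 0) i open_suppC xK suppC0).
exact: derive_cst.
Qed.

Lemma Hball_box x : inH x -> boxV (0 : V) 1 x.
Proof.
move=> xH i; rewrite mxE subr0 -(@ler_pXn2r _ 2)// ?nnegrE// expr1n real_normK ?num_real//.
apply: le_trans (ltW xH); rewrite /eucl2 (bigD1 i)//= lerDl.
by apply: sumr_ge0 => j _; exact: sqr_ge0.
Qed.

Lemma supp_bounded (f : V -> R) : (forall x, K x -> {for x, continuous f}) ->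
  exists2 C, 0 <= C & forall x, K x -> `|f x| <= C.
Proof.
move=> cf.
have : compact (f @` K).
  apply: continuous_compact compact_supp.
  by apply: continuous_in_subspaceT => x /set_mem; exact: cf.
move=> /compact_bounded[C [_ HC]].
exists (`|C| + 1) => [|x Kx]; first by rewrite addr_ge0.
by apply: (HC (`|C| + 1)); [rewrite ltr_pwDr// ler_norm|exists x].
Qed.

End Support.

Section CoefficientBounds.
Variables (R : realType) (N : nat).
Hypothesis N5 : (5 <= N)%N.
Local Notation hm := (hm R N).
Local Notation hb := (hb R N).

Lemma hm_ge2 : 2 <= hm.
Proof.
by rewrite -[hm]/((N%:R - 1) / 2) ler_pdivlMr// lerBrDr -natrM -[1]/(1%:R) -natrD ler_nat.
Qed.

Lemma hb_ge2 : 2 <= hb.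
Proof. by have := hm_ge2; rewrite -[hb]/(hm * (hm - 1)) => h; nra. Qed.

(** Near the pole c and t are of the same order, and every monomial of the coefficients has degree
    at most three, so the field is O(r^(-3)) there. *)
Lemma coef_bounds : exists2 H : R, 0 <= H & forall t c : R,
  1 <= t -> 0 <= c <= 2 * t -> 0 <= c ^+ 2 - 1 <= t ^+ 2 ->
  [/\ `|hcoef N t c| <= H * t ^+ 3, `|qcoef N t c| <= H * t ^+ 3 & `|pcoef t| <= H * t ^+ 3].
Proof.
have m2 := hm_ge2; have b2 := hb_ge2.
pose A1 := 2 * hb * hm; pose A2 := (hm + 3 * hb) / 2; pose A3 := 3 / 2 * hm ^+ 2.
pose A4 := 2 * hm ^+ 3; pose A5 := 2 * hm ^+ 2; pose A6 := 2 * hb.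
have hm0 : 0 <= hm by lra.
have hb0 : 0 <= hb by lra.
have a1 : 0 <= A1 := mulr_ge0 (mulr_ge0 (ler0n R 2) hb0) hm0.
have a2 : 0 <= A2 by rewrite /A2; lra.
have a3 : 0 <= A3 by rewrite /A3; have := sqr_ge0 hm; lra.
have a4 : 0 <= A4 by rewrite /A4; have := exprn_ge0 3 hm0; lra.
have a5 : 0 <= A5 by rewrite /A5; have := sqr_ge0 hm; lra.
have a6 : 0 <= A6 by rewrite /A6; lra.
exists (2 * A1 + A2 + A3 + 1 + 2 * A4 + A5 + A6 + 2 * hm); first by lra.
move=> t c t1 /andP[c0 c2t] /andP[y0 yt].
set y := c ^+ 2 - 1 in y0 yt *.
have t0 : 0 <= t by lra.
have t2 : t <= t ^+ 2 by rewrite expr2; nra.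
have t23 : t ^+ 2 <= t ^+ 3 by rewrite (exprS t 2); nra.
have cy0 : 0 <= c * y by rewrite mulr_ge0.
have cy : c * y <= 2 * t ^+ 3 by rewrite exprS mulrA ler_pM.
have ty0 : 0 <= t * y by rewrite mulr_ge0.
have ty : t * y <= t ^+ 3 by rewrite exprS ler_wpM2l.
have tc0 : 0 <= t * c by rewrite mulr_ge0.
have tc : t * c <= 2 * t ^+ 2 by rewrite expr2 mulrCA ler_wpM2l.
have t30 : 1 <= t ^+ 3 by lra.
have e1 := mulr_ge0 a1 cy0; have e2 : 0 <= A1 * (2 * t ^+ 3 - c * y) by rewrite mulr_ge0// subr_ge0.
have e3 := mulr_ge0 a2 ty0; have e4 : 0 <= A2 * (t ^+ 3 - t * y) by rewrite mulr_ge0// subr_ge0.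
have e5 := mulr_ge0 a3 t0; have e6 : 0 <= A3 * (t ^+ 3 - t) by rewrite mulr_ge0// subr_ge0; lra.
have e7 := mulr_ge0 a4 c0; have e8 : 0 <= A4 * (2 * t ^+ 3 - c) by rewrite mulr_ge0// subr_ge0; lra.
have e9 : 0 <= A5 * (t ^+ 3 - 1) by rewrite mulr_ge0// subr_ge0.
have e10 := mulr_ge0 a6 y0; have e11 : 0 <= A6 * (t ^+ 3 - y) by rewrite mulr_ge0// subr_ge0; lra.
have e12 := mulr_ge0 hm0 tc0; have e13 : 0 <= hm * (2 * t ^+ 3 - t * c) by rewrite mulr_ge0// subr_ge0; lra.
have t3 : 0 <= t ^+ 3 by lra.
have f1 := mulr_ge0 a1 t3; have f2 := mulr_ge0 a2 t3; have f3 := mulr_ge0 a3 t3.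
have f4 := mulr_ge0 a4 t3; have f5 := mulr_ge0 a5 t3; have f6 := mulr_ge0 a6 t3.
have f7 := mulr_ge0 hm0 t3.
have hE : hcoef N t c = - (A1 * (c * y)) + A2 * (t * y) + A3 * t + 3 / 8 * t ^+ 3 - A4 * c.
  by rewrite /hcoef /A1 /A2 /A3 /A4 /y; field.
have qE : qcoef N t c = A5 + A6 * y - hm * (t * c) by rewrite /qcoef /A5 /A6 /y; field.
split.
- by rewrite hE ler_norml; apply/andP; split; lra.
- by rewrite qE ler_norml; apply/andP; split; lra.
- by rewrite /pcoef ler_norml; apply/andP; split; lra.
Qed.

End CoefficientBounds.

(** * The inequality with a cutoff at the pole *)

Section PoincareRellich.
Variables (R : realType) (N : nat) (o : 'rV[R]_N) (u : 'rV[R]_N -> R).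
Hypotheses (oH : inH o) (N5 : (5 <= N)%N) (uc : Cc_inf_H u).
Local Notation V := 'rV[R]_N.
Local Notation BV := (borelV R N).
Local Notation mu := (@muV R N).
Local Notation gam := (@gam R N).
Local Notation Hpunct := (Hpunct o).
Local Notation r := (rdist o).
Local Notation K := (closure [set x | u x != 0]).
Local Notation Hball := (@Hball R N).
Implicit Types x : V.

Let N2 : (2 <= N)%N. Proof. exact: leq_trans N5. Qed.
Let oP : open Hpunct := @open_Hpunct R N o.
Let PH : Hpunct `<=` Hball := @HpunctH R N o.
Let uC n D : Cn n D u := Cc_Cn uc n D.

(** Places small hyperbolic balls in Euclidean cubes, whose volume is explicit: 2 |x - o|^2 <= cosh
    r - 1 <= sinh^2 r, and sinh r <= r cosh 1. *)
Lemma rdist_coord_le x i : Hpunct x -> r x <= 1 -> `|x ord0 i - o ord0 i| <= cosh 1 * r x.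
Proof.
move=> xP r1; have r0 := rdist_gt0 oH xP.
have c1 := cosh_ge1 (r x); have c11 := cosh_ge1 (1 : R).
have R0 : 0 <= cosh 1 * r x := mulr_ge0 (le_trans ler01 c11) (ltW r0).
rewrite -(@ler_pXn2r _ 2)// ?nnegrE//.
rewrite real_normK ?num_real//.
have le1 : (x ord0 i - o ord0 i) ^+ 2 <= eucl2 (x - o).
  rewrite /eucl2 (bigD1 i)//= !mxE lerDl.
  by apply: sumr_ge0 => j _; exact: sqr_ge0.
have le2 := chd_ge oH (PH xP); rewrite -(cosh_rdist oH xP) in le2.
have s0 := sinh_gt0 r0; have s1 := sinh_le r0.
have cc : cosh (r x) <= cosh 1 by rewrite le_cosh// ltW.
have le3 : cosh (r x) <= 1 + sinh (r x) ^+ 2 by rewrite -sqr_cosh expr2 ler_peMr// (le_trans ler01).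
have le4 : sinh (r x) <= cosh 1 * r x.
  by rewrite (le_trans s1)// mulrC ler_wpM2r// ltW.
have le5 : sinh (r x) ^+ 2 <= (cosh 1 * r x) ^+ 2.
  by rewrite ler_pXn2r ?nnegrE// ltW.
by have := eucl2_ge0 (x - o); lra.
Qed.

Section Cutoff.
Variable eps : R.
Hypothesis eps0 : 0 < eps.

Definition cutX (t : R) := step (t / eps).
Definition cutX' (t : R) := step' (t / eps) / eps.

Lemma is_derive_cutX t : is_derive t (1 : R) cutX (cutX' t).
Proof.
have d : is_derive t (1 : R) (fun t => t / eps) eps^-1 by der_eq; ring.
exact: (@is_derive_comp R R (@step R) (fun t => t / eps) t 1 _ _ (is_derive_step _) d).
Qed.

Lemma Cn_cutX : Cn 1 Hpunct (fun x => cutX (r x)).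
Proof.
have rC n : Cn n Hpunct r by exact: Cn_rdist.
have c' : continuous cutX'.
  move=> t; have c1 : {for t, continuous (fun t : R => t / eps)}.
    suff [d] : exists d, is_derive t (1 : R) (fun t => t / eps) d by exact: is_derive_continuous.
    by eexists; der.
  have c2 : {for t, continuous (fun t : R => step' (t / eps))}.
    by apply: continuous_comp => //; exact: continuous_step'.
  by apply: (@continuousM R R (fun t : R => step' (t / eps)) (fun=> eps^-1)) => //; exact: cst_continuous.
apply: (@Cn_intro _ _ _ _ _ (fun i y => cutX' (r y) * dpart i r y) oP) => [x xP|i x xP|i].
- apply: continuous_comp; first exact: (CnE (rC 0%N)).
  exact: is_derive_continuous (is_derive_cutX _).
- exact: is_derive_comp (is_derive_cutX _) (Cn_is_derive i (rC 1%N) xP).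
- apply: (Cn_mul oP); last exact: Cn_dpart (rC 1%N).
  split=> // x xP; apply: continuous_comp; first exact: (CnE (rC 0%N)).
  exact: c'.
Qed.

Lemma cutX_near t : t <= eps -> cutX t = 0.
Proof. by move=> te; rewrite /cutX step0// ler_pdivrMr// mul1r. Qed.

Lemma cutX_far t : 2 * eps <= t -> cutX t = 1.
Proof. by move=> te; rewrite /cutX step1// ler_pdivlMr. Qed.

Let E := rellich_field o u cutX.

Let near_o : set V := Hball `&` [set x | chd o x < cosh eps].

Let open_near_o : open near_o := @open_chd_lt R N o oH (cosh eps).
Let near_oo : near_o o := near_center oH eps0.
Let near_o0 x : near_o x -> r x <= eps.
Proof.
move=> [xH xc]; have [->|xo] := eqVneq x o; first by rewrite rdisto ltW.
by apply: (rdist_le_chd oH eps0 _ xc); split => //; exact/eqP.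
Qed.

Let E_near_o i x : near_o x -> E i x = 0.
Proof.
move=> /near_o0/cutX_near X0.
by rewrite /E /rellich_field X0 !mul0r !mulr0 subrr.
Qed.

Let gam_out a x : (~` K) x -> gam u a x = 0.
Proof.
move=> xK; rewrite /gam big1 ?mulr0// => i _.
by rewrite (suppC_dpart i xK) mul0r.
Qed.

Let E_out i x : (~` K) x -> E i x = 0.
Proof.
move=> xK.
rewrite /E /rellich_field !(gam_out _ xK) (suppC0 xK) (suppC_dpart i xK).
by rewrite expr0n /= !mulr0 addr0 !mulr0 mul0r !mulr0 subrr.
Qed.

(** The whole space is covered by three open sets: off the support and near the pole the field is
    zero, and on the punctured ball its formula is regular. *)
Let E1 i : Cn 1 setT (E i).
Proof.
have z n (D : set V) : open D -> (forall x, D x -> E i x = 0) -> Cn n D (E i).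
  by move=> oD z0; apply: (Cn_ext oD (f := fun=> 0)) => [y /z0 ->//|]; exact: Cn_cst.
apply: Cn_local => x _.
have [xK|xK] := pselect (K x); last first.
  by exists (~` K); split => //; apply: z; [exact: open_suppC|exact: E_out].
have xH : inH x by exact: supp_Hball xK.
have [->|xo] := eqVneq x o; first by exists near_o; split => //; apply: z => // y; exact: E_near_o.
exists Hpunct; split; first by split => //; exact/eqP.
exact: (Cn_rellich_field oH (fun n => uC n _) Cn_cutX).
Qed.

Let E0 i x : ~ boxV (0 : V) 1 x -> E i x = 0.
Proof.
by move=> xB; apply: E_out => xK; apply: xB; apply: Hball_box; exact: supp_Hball xK.
Qed.

Let dE0 x : ~ Hpunct x -> \sum_(i < N) dpart i (E i) x = 0.
Proof.
move=> xP; apply: big1 => i _.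
have [xK|xK] := pselect (K x); last first.
  by rewrite (dpart_open (g := fun=> 0) i (@open_suppC R N u) xK (E_out i)); exact: derive_cst.
have -> : x = o by apply: contrapT => xo; apply: xP; split => //; exact: supp_Hball xK.
by rewrite (dpart_open (g := fun=> 0) i open_near_o near_oo (E_near_o i)); exact: derive_cst.
Qed.

Definition wdens x : R := weight N (r x)^-1 (coth (r x)) * u x ^+ 2 * conf x ^+ N.
Definition ldens x : R := LB u x ^+ 2 * conf x ^+ N.

Lemma weight_ge0 x : Hpunct x -> 0 <= weight N (r x)^-1 (coth (r x)).
Proof.
move=> xP; have r0 := rdist_gt0 oH xP.
have m2 := @hm_ge2 R N N5; have b2 := @hb_ge2 R N N5.
have c1 : 0 <= coth (r x) ^+ 2 - 1.
  by rewrite sqr_coth// addrAC subrr add0r invr_ge0 sqr_ge0.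
have hm0 : 0 <= hm R N by lra.
have hb0 : 0 <= hb R N by lra.
have mm0 : 0 <= 2 * hm R N ^+ 2 - 2.
  by have : 0 <= (hm R N - 1) * (hm R N + 1); [apply: mulr_ge0; lra|nra].
have t0 : 0 <= (r x)^-1 by rewrite invr_ge0 ltW.
have p1 := exprn_ge0 4 hm0.
have p2 := mulr_ge0 (sqr_ge0 (hm R N)) (sqr_ge0 (r x)^-1).
have p3 := exprn_ge0 4 t0.
have p4 := mulr_ge0 (mulr_ge0 hb0 mm0) c1.
have b32 : 0 <= hb R N - 3 / 2 by lra.
have p5 := mulr_ge0 (mulr_ge0 hb0 b32) (sqr_ge0 (coth (r x) ^+ 2 - 1)).
rewrite /weight; lra.
Qed.

Lemma ldens_ge0 x : inH x -> 0 <= ldens x.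
Proof. by move=> /conf_gt0 k0; rewrite mulr_ge0 ?sqr_ge0// exprn_ge0// ltW. Qed.

Lemma wdens_ge0 x : Hpunct x -> 0 <= wdens x.
Proof.
move=> xP; have k0 := conf_gt0 (PH xP).
by rewrite mulr_ge0 ?exprn_ge0 ?(ltW k0)// mulr_ge0 ?sqr_ge0// weight_ge0.
Qed.

Lemma cutX_ge0 t : 0 <= cutX t. Proof. exact: step_ge0. Qed.
Lemma cutX_le1 t : cutX t <= 1. Proof. exact: step_le1. Qed.

Let ti_C n : Cn n Hpunct (fun y => (r y)^-1).
Proof. by apply: (Cn_inv oP _ (Cn_rdist oH n)) => x /(rdist_gt0 oH) h; rewrite gt_eqF. Qed.

Lemma Cn_wdens n : Cn n Hpunct wdens.
Proof.
have oP' := oP.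
have ti_Cn := ti_C n; have co_Cn := Cn_coth_rdist oH n; have u_Cn := uC n Hpunct.
have c_Cn c : Cn n Hpunct (fun=> c : R) := Cn_cst n c oP.
have y_Cn : Cn n Hpunct (fun y => coth (r y) ^+ 2 - 1).
  exact: (Cn_add oP (Cn_exp 2 oP co_Cn) (c_Cn _)).
have w1 := Cn_add oP (c_Cn (hm R N ^+ 4)) (Cn_mul oP (c_Cn (hm R N ^+ 2 / 2)) (Cn_exp 2 oP ti_Cn)).
have w2 := Cn_add oP w1 (Cn_mul oP (c_Cn (9 / 16)) (Cn_exp 4 oP ti_Cn)).
have w3 := Cn_add oP w2 (Cn_mul oP (c_Cn (hb R N * (2 * hm R N ^+ 2 - 2))) y_Cn).
have w4 := Cn_add oP w3 (Cn_mul oP (c_Cn (hb R N * (hb R N - 3 / 2))) (Cn_exp 2 oP y_Cn)).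
exact: (Cn_mul oP (Cn_mul oP w4 (Cn_exp 2 oP u_Cn)) (Cn_exp N oP (Cn_sub PH (Cn_conf _ _ n)))).
Qed.

Lemma Cn_LB : Cn 0 Hball (LB u).
Proof.
have oB := @open_Hball R N.
have kC n : Cn n Hball (@conf R N) := Cn_conf R N n.
have kV : Cn 0 Hball (fun y => (conf y ^+ N)^-1).
  apply: (Cn_inv oB _ (Cn_exp N oB (kC 0%N))) => x xH.
  by rewrite expf_neq0// conf_neq0.
apply: (Cn_mul oB kV); apply: (Cn_bigsum _ oB) => i; apply: Cn_dpart.
by apply: (Cn_mul oB (Cn_exp _ oB (kC 1%N))); apply: Cn_dpart; exact: uC.
Qed.

Lemma Cn_ldens : Cn 0 Hball ldens.
Proof.
have oB := @open_Hball R N.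
exact: (Cn_mul oB (Cn_exp 2 oB Cn_LB) (Cn_exp N oB (Cn_conf R N 0))).
Qed.

Variable B : R.
Hypotheses (eps2 : 2 * eps <= 1).

Hypothesis err_le : forall x, Hpunct x -> eps < r x < 2 * eps -> K x ->
  `|cutX' (r x) * errterm o u x * conf x ^+ N| <= B.
Hypothesis B0 : 0 <= B.

Local Open Scope ereal_scope.

Definition aeps x : \bar R := if `[< Hpunct x >] then (cutX (r x) * wdens x)%:E else 0.
Definition lint x : \bar R := if `[< Hball x >] then (ldens x)%:E else 0.

Lemma pos_meas_aeps : pos_meas aeps.
Proof.
apply: (@pos_meas_patch _ _ _ (fun x => cutX (r x) * wdens x)%R) => [|x xP|x xP].
- exact: oP.
- exact: (CnE (Cn_mul oP (Cn_le (leq0n 1) Cn_cutX) (Cn_wdens 0)) xP).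
- by rewrite mulr_ge0 ?cutX_ge0// wdens_ge0.
Qed.

Lemma pos_meas_lint : pos_meas lint.
Proof.
apply: (@pos_meas_patch _ _ _ ldens) => [|x xP|x xP].
- exact: open_Hball.
- exact: (CnE Cn_ldens xP).
- exact: ldens_ge0.
Qed.

Lemma errterm_out x : (~` K) x -> errterm o u x = 0%R.
Proof.
move=> xK; rewrite /errterm !(gam_out _ xK) (suppC0 xK).
by rewrite !expr0n /= !mulr0 !subr0 addr0.
Qed.

(** [certificate] integrated. The derivative of the cutoff lives on the shell eps < r < 2 eps, which
    lies in a cube of half-side 2 eps cosh 1, so the error is at most [B] times the volume of that
    cube. *)
Lemma integral_cut_le : \int[mu]_x aeps x <=
  \int[mu]_x lint x + (B * (cosh 1 * (2 * eps) *+ 2) ^+ N)%:E.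
Proof.
have rho0 : (0 <= cosh 1 * (2 * eps))%R.
  by rewrite mulr_ge0 ?(le_trans ler01 (cosh_ge1 _))// mulr_ge0// ltW.
have [pb <-] := @integral_box_cst R N o B (cosh 1 * (2 * eps))%R B0 rho0.
have pl := pos_meas_lint.
rewrite -ge0_integralD//; [|by move=> x _; exact: pl.1|exact: pl.2|by move=> x _; exact: pb.1|exact: pb.2].
apply: (le_integral_divergence ltr01 E1 E0 pos_meas_aeps (pos_measD pl pb)) => x.
rewrite /aeps; case: asboolP => xP; last first.
  by rewrite dE0// adde0 adde_ge0//; [exact: pl.1|exact: pb.1].
have xH := PH xP; rewrite /lint asboolT//.
rewrite -!EFinD lee_fin.
have k0 : (0 < conf x ^+ N)%R by rewrite exprn_gt0// conf_gt0.
have cert := certificate oH N5 (fun n => uC n _) (fun t _ => is_derive_cutX t) Cn_cutX xP (cutX_ge0 _).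
have err : (cutX' (r x) * errterm o u x * conf x ^+ N <= B * \1_(boxV o (cosh 1 * (2 * eps))) x)%R.
  have b0 : (0 <= B * \1_(boxV o (cosh 1 * (2 * eps))) x)%R by rewrite mulr_ge0.
  have [xK|xK] := pselect (K x); last by rewrite errterm_out// mulr0 mul0r.
  have [/andP[r1 r2]|rr] := boolP (eps < r x < 2 * eps)%R; last first.
    rewrite /cutX' step'_out ?mul0r ?mul0r//.
    by rewrite ltr_pdivlMr// mul1r ltr_pdivrMr//; exact/negP.
  apply: le_trans (ler_norm _) _; apply: le_trans (err_le xP _ xK) _; first by rewrite r1.
  rewrite indicE mem_set ?mulr1// => i.
  apply: (le_trans (rdist_coord_le i xP (le_trans (ltW r2) eps2))).
  by rewrite ler_wpM2l ?(le_trans ler01 (cosh_ge1 _))// ltW.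
apply: le_trans (lerD (lexx _) err).
have := ler_wpM2r (ltW k0) cert.
set S := (\sum_(i < N) _)%R.
have -> : ((cutX (r x) * (weight N (r x)^-1 (coth (r x)) * u x ^+ 2) + (conf x ^+ N)^-1 * S)
    * conf x ^+ N = cutX (r x) * wdens x + S)%R.
  by rewrite /wdens; field; rewrite gt_eqF.
move=> /le_trans; apply; rewrite [X in (X <= _)%R]mulrDl.
rewrite lerD2r /ldens ler_wpM2r ?(ltW k0)//.
by rewrite ler_piMl ?sqr_ge0// cutX_le1.
Qed.

End Cutoff.
End PoincareRellich.

Lemma limn_einf_le (R : realType) (a : (\bar R)^nat) (L : \bar R) (e : R^nat) :
  (forall n, (a n <= L + (e n)%:E)%E) -> e @ \oo --> (0 : R) -> (limn_einf a <= L)%E.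
Proof.
move=> aL e0; rewrite limn_einf_lim; apply: lime_le; first exact: is_cvg_einfs.
near=> n.
apply/lee_addgt0Pr => d d0.
have /cvgrPdist_lt /(_ _ d0) [m _ em] := e0.
apply: (@le_trans _ _ (a (maxn n m))).
  by apply: ereal_inf_lbound; exists (maxn n m) => //=; exact: leq_maxl.
apply: (le_trans (aL _)); apply: leeD2l; rewrite lee_fin.
have := em (maxn n m) (leq_maxr _ _); rewrite sub0r normrN => /ltW.
exact: le_trans (ler_norm _).
Unshelve. all: by end_near.
Qed.

(** * Removal of the cutoff *)

Section Conclusion.
Variables (R : realType) (N : nat) (o : 'rV[R]_N) (u : 'rV[R]_N -> R).
Hypotheses (oH : inH o) (N5 : (5 <= N)%N) (uc : Cc_inf_H u).
Local Notation V := 'rV[R]_N.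
Local Notation BV := (borelV R N).
Local Notation mu := (@muV R N).
Local Notation gam := (@gam R N).
Local Notation Hpunct := (Hpunct o).
Local Notation r := (rdist o).
Local Notation K := (closure [set x | u x != 0]).
Local Notation Hball := (@Hball R N).
Implicit Types x : V.
Let uC n D : Cn n D u := Cc_Cn uc n D.
Let PH : Hpunct `<=` Hball := @HpunctH R N o.

(** One power of 1 / eps comes from the derivative of the cutoff and three from [coef_bounds]; [u],
    its gradient and [conf] are bounded on the compact support. *)
Lemma cut_error : exists2 M : R, 0 <= M & forall eps, 0 < eps -> 2 * eps <= 1 ->
  forall x, Hpunct x -> eps < r x < 2 * eps -> K x ->
  `|cutX' eps (r x) * errterm o u x * conf x ^+ N| <= M / eps ^+ 4.
Proof.
have [H H0 HC] := @coef_bounds R N N5.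
have [S S0 HS] := @step'_bounded R.
have oB := @open_Hball R N.
have [k k0 Hk] : exists2 k : R, 0 <= k & forall x, K x -> `|conf x ^+ N| <= k.
  apply: (supp_bounded uc) => x xK; apply: (CnE (Cn_exp N oB (Cn_conf R N 0))).
  exact: supp_Hball xK.
have [b1 b10 Hb1] : exists2 b : R, 0 <= b & forall x, K x -> `|u x ^+ 2| <= b.
  by apply: (supp_bounded uc) => x xK; exact: (CnE (Cn_exp 2 openT (uC 0 setT))).
have [b2 b20 Hb2] : exists2 b : R, 0 <= b & forall x, K x -> `|gam u u x| <= b.
  apply: (supp_bounded uc) => x xK.
  apply: (CnE (Cn_gam oB (fun y h => h) (uC 1 _) (uC 1 _))).
  exact: supp_Hball xK.
exists (S * (H * (2 * b1 + 4 * b2)) * k).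
  by rewrite !mulr_ge0// addr_ge0// mulr_ge0.
move=> eps e0 e1 x xP /andP[er r2] xK.
have r0 : 0 < r x := lt_trans e0 er.
have s0 := sinh_gt0 r0; have n0 : r x != 0 by rewrite gt_eqF.
set t := (r x)^-1.
have t1 : 1 <= t by rewrite invf_ge1// (le_trans (ltW r2)).
have te : t <= eps^-1 by rewrite lef_pV2 ?posrE// ltW.
have y0 : 0 <= coth (r x) ^+ 2 - 1.
  by rewrite sqr_coth// addrAC subrr add0r invr_ge0 sqr_ge0.
have yt : coth (r x) ^+ 2 - 1 <= t ^+ 2.
  by rewrite sqr_coth// addrAC subrr add0r ltW// invr_sqr_sinh_lt.
have c0 := coth_gt0 r0.
have c2 : coth (r x) <= 2 * t.
  rewrite -(@ler_pXn2r _ 2)// ?nnegrE ?(ltW c0)//; last by rewrite mulr_ge0// (le_trans ler01).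
  have tt : 1 <= t ^+ 2 by rewrite expr_ge1// (le_trans ler01).
  have -> : (2 * t) ^+ 2 = 4 * t ^+ 2 by ring.
  lra.
have [h1 h2 h3] : [/\ `|hcoef N t (coth (r x))| <= H * t ^+ 3,
    `|qcoef N t (coth (r x))| <= H * t ^+ 3 & `|pcoef t| <= H * t ^+ 3].
  by apply: HC => //; [rewrite (ltW c0)|rewrite y0].
have T0 : 0 <= H * t ^+ 3 by rewrite mulr_ge0// exprn_ge0// (le_trans ler01).
have cs := gam_Cauchy_Schwarz oH u xP.
have B1 := le_trans (ler_norm _) (Hb1 x xK); have B2 := le_trans (ler_norm _) (Hb2 x xK).
have err : `|errterm o u x| <= H * t ^+ 3 * (2 * b1 + 4 * b2).
  rewrite /errterm -/t.
  set hh := hcoef _ _ _ in h1 *; set qq := qcoef _ _ _ in h2 *; set pp := pcoef _ in h3 *.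
  set w := gam u r x in cs *; set g := gam u u x in cs B2 *.
  have w2 : 0 <= w ^+ 2 by exact: sqr_ge0.
  have u2 : 0 <= u x ^+ 2 by exact: sqr_ge0.
  have uw : `|u x * w| <= u x ^+ 2 + w ^+ 2.
    have l1 := sqr_ge0 (u x - w); have l2 := sqr_ge0 (u x + w).
    by rewrite ler_norml; apply/andP; split; nra.
  have E1 : `|hh * u x ^+ 2| <= H * t ^+ 3 * b1 by rewrite normrM ler_pM// ger0_norm.
  have E2 : `|qq * u x * w| <= H * t ^+ 3 * (b1 + b2).
    by rewrite -mulrA normrM ler_pM//; lra.
  have E3 : `|pp * w ^+ 2| <= H * t ^+ 3 * b2 by rewrite normrM ler_pM// ger0_norm//; lra.
  have E4 : `|pp * g| <= H * t ^+ 3 * b2 by rewrite normrM ler_pM// ger0_norm//; lra.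
  have -> : hh * u x ^+ 2 - qq * u x * w - 2 * pp * w ^+ 2 + pp * g =
    hh * u x ^+ 2 - qq * u x * w - 2 * (pp * w ^+ 2) + pp * g by ring.
  by move: E1 E2 E3 E4; rewrite !ler_norml => /andP[? ?] /andP[? ?] /andP[? ?] /andP[? ?];
    apply/andP; split; lra.
have ei : 0 <= eps^-1 by rewrite invr_ge0 ltW.
have -> : `|cutX' eps (r x) * errterm o u x * conf x ^+ N| =
  `|step' (r x / eps)| * eps^-1 * `|errterm o u x| * `|conf x ^+ N|.
  by rewrite /cutX' 3!normrM (ger0_norm ei).
have t3 : t ^+ 3 <= eps^-1 ^+ 3.
  by apply: lerXn2r; rewrite ?nnegrE ?invr_ge0 ?(ltW e0) ?(ltW r0).
have bb : 0 <= 2 * b1 + 4 * b2 by rewrite addr_ge0// mulr_ge0.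
have -> : S * (H * (2 * b1 + 4 * b2)) * k / eps ^+ 4 =
  S * eps^-1 * (H * eps^-1 ^+ 3 * (2 * b1 + 4 * b2)) * k.
  by field; rewrite gt_eqF.
have g1 := ler_wpM2r ei (HS (r x / eps)).
have g2 : `|errterm o u x| <= H * eps^-1 ^+ 3 * (2 * b1 + 4 * b2).
  by apply: (le_trans err); rewrite ler_wpM2r// ler_wpM2l.
have Hkx := Hk x xK.
apply: ler_pM => //.
  by rewrite !mulr_ge0.
apply: ler_pM => //.
by rewrite mulr_ge0.
Qed.

Local Open Scope ereal_scope.

Definition winf x : \bar R := if `[< Hpunct x >] then (wdens o u x)%:E else 0.

Lemma integral_weight_le : \int[mu]_x winf x <= \int[mu]_x lint u x.
Proof.
have [M M0 HM] := cut_error.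
(* Starting at 1/2 ensures [2 * eps n <= 1], as required by [cut_error]. *)
pose eps n : R := (n.+2%:R^-1)%R.
have e0 n : (0 < eps n)%R by rewrite invr_gt0.
have e1 n : (2 * eps n <= 1)%R by rewrite ler_pdivrMr// mul1r ler_nat.
pose C : R := (4 * cosh 1)%R.
have cvge : (fun n => M * C ^+ N * eps n)%R @ \oo --> (0%R : R).
  rewrite -[X in _ --> X](mulr0 (M * C ^+ N)%R); apply: cvgMr.
  have := @cvg_harmonic R; rewrite -cvg_shiftS; exact.
have winfE : winf = fun x => limn_einf (fun n => aeps o u (eps n) x).
  apply/funext => x; rewrite /winf /aeps; case: asboolP => xP; last first.
    by rewrite is_cvg_limn_einfE; [rewrite lim_cst|exact: is_cvg_cst].
  have r0 := rdist_gt0 oH xP.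
  have c : (fun n => (cutX (eps n) (r x) * wdens o u x)%:E) @ \oo --> (wdens o u x)%:E.
    apply: cvg_near_cst; near=> n; rewrite cutX_far ?mul1r//.
    have : (eps n <= r x / 2)%R; last by lra.
    apply: ltW; apply: (@lt_trans _ _ (n.+1%:R^-1)%R).
      by rewrite ltf_pV2 ?posrE// ltr_nat.
    by near: n; exact: (near_infty_natSinv_lt (PosNum (divr_gt0 r0 (ltr0n R 2)))).
  by rewrite is_cvg_limn_einfE; [apply/esym/cvg_lim|apply/cvg_ex; eexists; exact: c].
rewrite winfE; apply: (le_trans (fatou mu measurableT _ _)).
- by move=> n; exact: (pos_meas_aeps oH N5 uc (eps n)).2.
- by move=> n x _; exact: (pos_meas_aeps oH N5 uc (eps n)).1.
apply: (limn_einf_le _ cvge) => n.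
have B0 : (0 <= M / eps n ^+ 4)%R by rewrite divr_ge0// exprn_ge0// ltW.
apply: (le_trans (integral_cut_le oH N5 uc (e0 n) (e1 n) (HM _ (e0 n) (e1 n)) B0)).
apply: leeD2l; rewrite lee_fin.
have -> : (cosh 1 * (2 * eps n) *+ 2 = C * eps n)%R by rewrite /C; ring.
(* The volume eps^N beats eps^(-4): as [5 <= N], at least one factor eps survives. *)
have -> : (M / eps n ^+ 4 * (C * eps n) ^+ N = M * C ^+ N * eps n ^+ (N - 4))%R.
  rewrite exprMn -{2}(subnK (ltnW N5)) exprD; move: (eps n ^+ (N - 4))%R (C ^+ N)%R => p q.
  by field; rewrite gt_eqF.
have C0 : (0 <= C)%R by rewrite mulr_ge0 ?(le_trans ler01 (cosh_ge1 _)).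
rewrite ler_wpM2l ?mulr_ge0 ?exprn_ge0//.
rewrite -[X in (_ <= X)%R]expr1; apply: ler_wiXn2l; rewrite ?(ltW (e0 n))//.
  by have := e1 n; have := e0 n; lra.
by rewrite subn_gt0.
Unshelve. all: by end_near.
Qed.

Definition hdens (F : V -> R) x : R := (F x * conf x ^+ N)%R.

Lemma hintE (F : V -> R) : (forall x, Hpunct x -> 0 <= F x)%R -> Cn 0 Hpunct F ->
  F o = 0%R ->
  pos_meas (fun x => if `[< Hpunct x >] then (hdens F x)%:E else 0) /\
  hint F = \int[mu]_x (if `[< Hpunct x >] then (hdens F x)%:E else 0).
Proof.
move=> F0 cF Fo; have oP := @open_Hpunct R N o.
have p : pos_meas (fun x => if `[< Hpunct x >] then (hdens F x)%:E else 0).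
  apply: (@pos_meas_patch _ _ _ (hdens F)) => // [x xP|x xP].
  - exact: (CnE (Cn_mul oP cF (Cn_exp N oP (Cn_sub PH (Cn_conf R N 0)))) xP).
  - by rewrite mulr_ge0 ?F0// exprn_ge0//; exact: ltW (conf_gt0 (PH xP)).
split => //; rewrite integral_muVE// /hint; congr intRN; apply/funext => x.
case: asboolP => xH; case: asboolP => xP //; last by case: (xH (PH xP)).
have -> : x = o by apply: contrapT => xo; apply: xP.
by rewrite Fo mul0r.
Qed.

Lemma hint_ballE (F : V -> R) : (forall x, inH x -> 0 <= F x)%R -> Cn 0 Hball F ->
  pos_meas (fun x => if `[< Hball x >] then (hdens F x)%:E else 0) /\
  hint F = \int[mu]_x (if `[< Hball x >] then (hdens F x)%:E else 0).
Proof.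
move=> F0 cF; have oB := @open_Hball R N.
have p : pos_meas (fun x => if `[< Hball x >] then (hdens F x)%:E else 0).
  apply: (@pos_meas_patch _ _ _ (hdens F)) => // [x xP|x xP].
  - exact: (CnE (Cn_mul oB cF (Cn_exp N oB (Cn_conf R N 0))) xP).
  - by rewrite mulr_ge0 ?F0// exprn_ge0//; exact: ltW (conf_gt0 xP).
by split => //; rewrite integral_muVE.
Qed.

(** For integrands continuous at the pole, where they need not vanish; here the pole is dropped as a
    null set. *)
Lemma hint_punctE (F : V -> R) : (forall x, inH x -> 0 <= F x)%R -> Cn 0 Hball F ->
  pos_meas (fun x => if `[< Hpunct x >] then (hdens F x)%:E else 0) /\
  hint F = \int[mu]_x (if `[< Hpunct x >] then (hdens F x)%:E else 0).
Proof.
move=> F0 cF; have [p ->] := hint_ballE F0 cF; have oP := @open_Hpunct R N o.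
have p' : pos_meas (fun x => if `[< Hpunct x >] then (hdens F x)%:E else 0).
  apply: (@pos_meas_patch _ _ _ (hdens F)) => // [x xP|x xP].
  - exact: (CnE (Cn_mul oP (Cn_sub PH cF) (Cn_exp N oP (Cn_sub PH (Cn_conf R N 0)))) xP).
  - by rewrite mulr_ge0 ?(F0 _ (PH xP))// exprn_ge0//; exact: ltW (conf_gt0 (PH xP)).
split=> //; apply: (@integral_off_point R N o) => // [|x xo]; first exact: leq_trans N5.
case: asboolP => xH; case: asboolP => xP //; last by case: (xH (PH xP)).
by exfalso; apply: xP; split => //; exact/eqP.
Qed.

Lemma LB_int : hint (fun x => LB u x ^+ 2)%R = \int[mu]_x lint u x.
Proof.
have [] := @hint_ballE (fun x => LB u x ^+ 2)%R => [x _||_ ->//]; first exact: sqr_ge0.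
exact: (Cn_exp 2 (@open_Hball R N) (Cn_LB uc)).
Qed.

Lemma rellich_inequality (Nr : R) : Nr = (N%:R)%R ->
  ((Nr - 1) ^+ 4 / 16)%:E * hint (fun x => (u x ^+ 2)%R)
      + ((Nr - 1) ^+ 2 / 8)%:E * hint (fun x => (u x ^+ 2 / r x ^+ 2)%R)
      + (9 / 16)%:E * hint (fun x => (u x ^+ 2 / r x ^+ 4)%R)
      + ((Nr ^+ 2 - 1) * (Nr - 3) ^+ 2 / 8)%:E
          * hint (fun x => (u x ^+ 2 / sinh (r x) ^+ 2)%R)
      + ((Nr - 1) * (Nr - 3) * (Nr ^+ 2 - 4 * Nr - 3) / 16)%:E
          * hint (fun x => (u x ^+ 2 / sinh (r x) ^+ 4)%R)
  <= hint (fun x => LB u x ^+ 2)%R.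
Proof.
move=> NrE; have oP := @open_Hpunct R N o.
have u2 : Cn 0 Hpunct (fun x => u x ^+ 2)%R := Cn_exp 2 oP (uC 0 _).
have rC := Cn_rdist oH 0.
have sC := Cn_sinh_rdist oH 0.
have div_C (g : V -> R) k : Cn 0 Hpunct g -> (forall x, Hpunct x -> 0 < g x)%R -> g o = 0%R ->
  let F := (fun x => u x ^+ 2 / g x ^+ k.+1)%R in
  pos_meas (fun x => if `[< Hpunct x >] then (hdens F x)%:E else 0) /\
  hint F = \int[mu]_x (if `[< Hpunct x >] then (hdens F x)%:E else 0).
  move=> gC g0 go F; apply: hintE.
  - by move=> x xP; rewrite mulr_ge0 ?sqr_ge0// invr_ge0 exprn_ge0// ltW// g0.
  - apply: (Cn_mul oP u2); apply: (Cn_inv oP _ (Cn_exp _ oP gC)) => x xP.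
    by rewrite expf_neq0// gt_eqF// g0.
  - by rewrite /F go expr0n/= invr0 mulr0.
have [p1 E1] := div_C r 1%N rC (@rdist_gt0 R N o oH) (rdisto o).
have [p2 E2] := div_C r 3%N rC (@rdist_gt0 R N o oH) (rdisto o).
have so : sinh (r o) = 0%R by rewrite rdisto sinh0.
have [p3 E3] := div_C (fun x => sinh (r x)) 1%N sC (@sinh_rdist_gt0 R N o oH) so.
have [p4 E4] := div_C (fun x => sinh (r x)) 3%N sC (@sinh_rdist_gt0 R N o oH) so.
have [p0 E0] := @hint_punctE (fun x => u x ^+ 2)%R (fun x _ => sqr_ge0 _) (Cn_exp 2 (@open_Hball R N) (uC 0 _)).
rewrite LB_int E0 E1 E2 E3 E4; apply: le_trans integral_weight_le.
have m2 := @hm_ge2 R N N5; have b2 := @hb_ge2 R N N5.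
have NE : (Nr = 2 * hm R N + 1)%R by rewrite /hm NrE; field.
(* Nonnegative coefficients allow the five integrals, not yet known to be finite, to be merged into
   one. *)
have k0 : (0 <= (Nr - 1) ^+ 4 / 16)%R by rewrite divr_ge0// exprn_ge0//; lra.
have k1 : (0 <= (Nr - 1) ^+ 2 / 8)%R by rewrite divr_ge0// sqr_ge0.
have k2 : (0 <= 9 / 16 :> R)%R by rewrite divr_ge0.
have k3 : (0 <= (Nr ^+ 2 - 1) * (Nr - 3) ^+ 2 / 8)%R.
  by rewrite divr_ge0// mulr_ge0 ?sqr_ge0//; nra.
have k4 : (0 <= (Nr - 1) * (Nr - 3) * (Nr ^+ 2 - 4 * Nr - 3) / 16)%R.
  have -> : ((Nr - 1) * (Nr - 3) * (Nr ^+ 2 - 4 * Nr - 3) / 16 = hb R N * (hb R N - 3 / 2))%R.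
    by rewrite NE /hb; field.
  by rewrite mulr_ge0//; lra.
have q0 := pos_measZ k0 p0; have q1 := pos_measZ k1 p1; have q2 := pos_measZ k2 p2.
have q3 := pos_measZ k3 p3; have q4 := pos_measZ k4 p4.
have s1 := pos_measD q0 q1; have s2 := pos_measD s1 q2; have s3 := pos_measD s2 q3.
rewrite -!integral_posZ// -(integral_posD q0 q1) -(integral_posD s1 q2) -(integral_posD s2 q3) -(integral_posD s3 q4).
apply: ge0_le_integral => //.
- by move=> x _; exact: (pos_measD s3 q4).1.
- exact: (pos_measD s3 q4).2.
- apply: (@pos_meas_patch _ _ _ (wdens o u) _ _ _).2 => [|x xP|x xP].
  + exact: oP.
  + exact: (CnE (Cn_wdens oH uc 0) xP).
  + exact: wdens_ge0.
- move=> x _; rewrite /winf; case: asboolP => xP; last by rewrite !mule0 !adde0.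
  have r0 := rdist_gt0 oH xP; have s0 := sinh_gt0 r0.
  rewrite -!EFinM -!EFinD lee_fin /hdens /wdens /weight sqr_coth//.
  rewrite le_eqVlt; apply/orP; left; apply/eqP; rewrite NE /hb.
  by field; rewrite !gt_eqF.
Qed.

End Conclusion.

(** * Almost optimal radial functions *)

Section TestFunction.
Variables (R : realType) (m L T : R).
Hypothesis (L1 : 1 <= L).
Implicit Types t : R.
Local Notation sinh := (@sinh R).

Definition tau t : R := (ln t - T) / L.
Definition bumpw t : R := tau t * (1 - tau t).
(** By [is_derive_flat], [flat poly2] and [flat poly6] are the derivatives of [flat 'X^2] and
    [flat 'X^6]. Thus [eta], [eta1], [eta2] are B, B', B'' at [tau] for B(x) = exp(- 1 / (x (1 -
    x))), and [gcomp1] is the derivative of [gcomp] in [tau]. *)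
Definition poly2 : {poly R} := ('X^2 - ('X^2)^`()) * 'X^2.
Definition poly6 : {poly R} := ('X^6 - ('X^6)^`()) * 'X^2.
Definition eta t : R := flat 1 (bumpw t).
Definition eta1 t : R := (1 - 2 * tau t) * flat 'X^2 (bumpw t).
Definition eta2 t : R := - 2 * flat 'X^2 (bumpw t) + (1 - 2 * tau t) ^+ 2 * flat poly2 (bumpw t).
(* With [z = 1 / (x (1 - x))] and [B = exp (- z)] one has [B'' = B (z^4 - 6 z^3 + 6 z^2)],
   so that [B''^2 / B^2] is unbounded; adding the derivative of
   [(1 - 2 x) z^6 B^2] makes it comparable with [B^2]. *)
Definition gcomp t : R := (1 - 2 * tau t) * eta t * flat 'X^6 (bumpw t).
Definition gcomp1 t : R := - 2 * eta t * flat 'X^6 (bumpw t)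
  + (1 - 2 * tau t) ^+ 2 * (flat 'X^2 (bumpw t) * flat 'X^6 (bumpw t) + eta t * flat poly6 (bumpw t)).
(** sinh(t)^(-m) and, next, t^(1/2), as exponentials because the exponents are not integers in
    general. *)
Definition sfac t : R := expR (- m * ln (sinh t)).
Definition qfac t : R := expR (ln t / 2).
Definition phi t : R := sfac t * qfac t * eta t.
Definition phi1 t : R := sfac t * qfac t *
  (t^-1 * (eta t / 2 + eta1 t / L) - m * coth t * eta t).
Definition phi2 t : R := sfac t * qfac t *
  (t^-1 ^+ 2 * (eta2 t / L ^+ 2 - eta t / 4)
   - 2 * m * coth t * t^-1 * (eta t / 2 + eta1 t / L)
   + (m ^+ 2 * coth t ^+ 2 - m * (1 - coth t ^+ 2)) * eta t).
(* Radial flux whose divergence [hflux1 + 2 m coth hflux] is [sfac^2 gcomp1 / t]. *)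
Definition hflux t : R := L * gcomp t * sfac t ^+ 2.
Definition hflux1 t : R := (gcomp1 t / t - 2 * m * coth t * L * gcomp t) * sfac t ^+ 2.

Let L0 : 0 < L. Proof. by apply: lt_le_trans L1. Qed.
Let Ln0 : L != 0. Proof. by rewrite gt_eqF. Qed.

Section Derivatives.
Variable t : R.
Hypothesis t0 : 0 < t.
Let tn0 : t != 0. Proof. by rewrite gt_eqF. Qed.
Let dln := is_derive1_ln t0.

Let dtau : is_derive t (1 : R) tau (t^-1 / L).
Proof. by rewrite /tau; der_eq; field; rewrite Ln0 tn0. Qed.

Let dflat p : is_derive t (1 : R) (fun t => flat p (bumpw t))
  ((1 - 2 * tau t) * (t^-1 / L) * flat ((p - p^`()) * 'X^2) (bumpw t)).
Proof.
have dw : is_derive t (1 : R) bumpw ((1 - 2 * tau t) * (t^-1 / L)).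
  by rewrite /bumpw; der_eq; ring.
have := @is_derive_comp R R (flat p) bumpw t 1 _ _ (is_derive_flat p (bumpw t)) dw.
by rewrite mulrC.
Qed.

Let deta : is_derive t (1 : R) eta (eta1 t * (t^-1 / L)).
Proof.
apply: (is_derive_eq (dflat 1)); rewrite /eta1.
by rewrite derivC subr0 mul1r; ring.
Qed.

Let deta1 : is_derive t (1 : R) eta1 (eta2 t * (t^-1 / L)).
Proof.
have d := dflat 'X^2; rewrite /eta1; der_eq; rewrite /eta2 -/poly2; ring.
Qed.

Let dgcomp : is_derive t (1 : R) gcomp (gcomp1 t * (t^-1 / L)).
Proof.
have d := dflat 'X^6; rewrite /gcomp; der_eq; rewrite /gcomp1 /eta1 -/poly6; ring.
Qed.

Let ds : is_derive t (1 : R) sfac (- m * coth t * sfac t).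
Proof.
have s0 := sinh_gt0 t0.
have d1 := @is_derive_comp R R (@ln R) sinh t 1 _ _ (is_derive1_ln s0) (is_derive_sinh t).
have d2 : is_derive t (1 : R) (fun t => - m * ln (sinh t)) (- m * ((sinh t)^-1 * cosh t)).
  by der_eq; ring.
apply: (is_derive_eq (@is_derive_comp R R expR (fun t => - m * ln (sinh t)) t 1 _ _ (is_derive_expR _) d2)).
by rewrite /sfac /coth; ring.
Qed.

Let dq : is_derive t (1 : R) qfac (t^-1 / 2 * qfac t).
Proof.
have d2 : is_derive t (1 : R) (fun t => ln t / 2) (t^-1 / 2) by der_eq; ring.
apply: (is_derive_eq (@is_derive_comp R R expR (fun t => ln t / 2) t 1 _ _ (is_derive_expR _) d2)).
by rewrite /qfac; ring.
Qed.

Lemma is_derive_phi : is_derive t (1 : R) phi (phi1 t).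
Proof.
have d1 := ds; have d2 := dq; have d3 := deta.
by rewrite /phi; der_eq; rewrite /phi1; field; rewrite Ln0 tn0.
Qed.

Lemma is_derive_phi1 : is_derive t (1 : R) phi1 (phi2 t).
Proof.
have d1 := ds; have d2 := dq; have d3 := deta; have d4 := deta1.
have d5 : is_derive t (1 : R) (@coth R) (1 - coth t ^+ 2).
  by apply: is_derive_coth; rewrite gt_eqF// sinh_gt0.
rewrite /phi1; der_eq => //; rewrite /phi2; field.
by rewrite Ln0 tn0.
Qed.

Lemma is_derive_hflux : is_derive t (1 : R) hflux (hflux1 t).
Proof.
have d1 := ds; have d2 := dgcomp.
by rewrite /hflux; der_eq; rewrite /hflux1 /=; field; rewrite Ln0 tn0.
Qed.

(** All first-order terms drop out: [sfac] removes the drift coth t, and for t^(1/2) times a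
    function of ln t the terms in [eta1] cancel. *)
Lemma radial_laplacian : phi2 t + 2 * m * coth t * phi1 t = sfac t * qfac t *
  (t^-1 ^+ 2 * (eta2 t / L ^+ 2 - eta t / 4)
   - (m ^+ 2 + m * (m - 1) * (coth t ^+ 2 - 1)) * eta t).
Proof. by rewrite /phi1 /phi2; field; rewrite Ln0 tn0. Qed.

Lemma sqr_qfac : qfac t ^+ 2 = t.
Proof. by rewrite /qfac -expRM_natl mulrC divfK ?pnatr_eq0// lnK// posrE. Qed.

End Derivatives.

Lemma eta_out t : ~ (0 < tau t < 1) ->
  [/\ eta t = 0, eta1 t = 0, eta2 t = 0, gcomp t = 0 & gcomp1 t = 0].
Proof.
move=> H; have w0 : bumpw t <= 0.
  by rewrite leNgt; apply/negP; rewrite /bumpw => w0; apply: H; apply/andP; split; nra.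
by rewrite /eta1 /eta2 /gcomp /gcomp1 /eta !(flat_le0 _ w0); split; ring.
Qed.

Lemma eta_bounds t : - (eta t * eta2 t) <= 32 * eta t ^+ 2 /\
  eta2 t ^+ 2 <= 10000 * eta t ^+ 2 + gcomp1 t.
Proof.
have [H|H] := pselect (0 < tau t < 1); last first.
  by have [-> _ -> _ ->] := eta_out H; split; lra.
have /andP[t0 t1] := H.
have w0 : 0 < bumpw t by rewrite mulr_gt0// subr_gt0.
(* As x (1 - x) <= 1/4, [y] ranges over the nonnegative reals, and (1 - 2 x)^2 is rational in [y].
   After division by B^2 both claims are polynomial inequalities in [y]. *)
pose B := expR (- (bumpw t)^-1); pose y := (bumpw t)^-1 - 4.
have wn0 : bumpw t != 0 by rewrite gt_eqF.
have y0 : 0 <= y.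
  rewrite subr_ge0 -[4]invrK lef_pV2 ?posrE ?invr_gt0//.
  by rewrite /bumpw; have := sqr_ge0 (tau t - 1 / 2); nra.
have zE : (bumpw t)^-1 = y + 4 by rewrite /y subrK.
have z0 : y + 4 != 0 by rewrite gt_eqF//; lra.
have tw : (1 - 2 * tau t) ^+ 2 = 1 - 4 / (y + 4).
  by rewrite -zE invrK /bumpw; ring.
have fE p : flat p (bumpw t) = p.[y + 4] * B by rewrite flat_gt0// /B zE.
have p2E : poly2.[y + 4] = ((y + 4) ^+ 2 - 2 * (y + 4)) * (y + 4) ^+ 2.
  by rewrite /poly2 derivXn hornerM hornerD hornerN hornerMn !hornerXn /=; ring.
have p6E : poly6.[y + 4] = ((y + 4) ^+ 6 - 6 * (y + 4) ^+ 5) * (y + 4) ^+ 2.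
  by rewrite /poly6 derivXn hornerM hornerD hornerN hornerMn !hornerXn /=; ring.
have e0 : eta t = B by rewrite /eta fE hornerC mul1r.
have e2 : eta2 t = B * ((y + 4) ^+ 4 - 6 * (y + 4) ^+ 3 + 6 * (y + 4) ^+ 2).
  by rewrite /eta2 !fE tw p2E hornerXn; field.
have eg : gcomp1 t = B ^+ 2 * (2 * (y + 4) ^+ 8 - 14 * (y + 4) ^+ 7 + 22 * (y + 4) ^+ 6).
  by rewrite /gcomp1 e0 !fE tw p6E !hornerXn; field.
have B2 : 0 <= B ^+ 2 by exact: sqr_ge0.
have yk k : 0 <= y ^+ k by exact: exprn_ge0.
rewrite e0 e2 eg; split; rewrite -subr_ge0.
  (* The constant 32 is exact: the bracket vanishes at [y = 0], the middle of the bump. *)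
  rewrite (_ : _ - _ = B ^+ 2 * (32 + ((y + 4) ^+ 4 - 6 * (y + 4) ^+ 3 + 6 * (y + 4) ^+ 2))); last by ring.
  rewrite mulr_ge0//.
  have := yk 1%N; have := yk 2%N; have := yk 3%N; have := yk 4%N; rewrite expr1.
  by move=> *; nra.
rewrite (_ : _ - _ = B ^+ 2 * (10000 + (2 * (y + 4) ^+ 8 - 14 * (y + 4) ^+ 7 + 22 * (y + 4) ^+ 6)
  - ((y + 4) ^+ 4 - 6 * (y + 4) ^+ 3 + 6 * (y + 4) ^+ 2) ^+ 2)); last by ring.
apply: mulr_ge0; first exact: B2.
have y3 := yk 3%N; have y4 := yk 4%N; have y5 := yk 5%N; have y6 := yk 6%N; have y7 := yk 7%N; have y8 := yk 8%N.
(* Expanded in powers of [y], the polynomial has a single negative coefficient, the linear one; a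
   multiple of this square absorbs it. *)
have y1 := sqr_ge0 (y - 1 / 9).
clear -y0 y3 y4 y5 y6 y7 y8 y1.
lra.
Qed.

End TestFunction.

Ltac lr := clear; intros; lra.

(** * The one-dimensional energy inequality *)

Section Energy.
Variable R : realType.
Local Notation sinh := (@sinh R).

(** t^3 <= 27 exp t, and exp t <= 4 sinh t once exp(- t) <= exp(t) / 2. *)
Lemma cube_le_sinh (t : R) : 1 <= t -> t ^+ 3 <= 108 * sinh t.
Proof.
move=> t1; have t0 : 0 <= t by lra.
have h := exprn_le_expR 2 t0.
have e2 : 2 <= expR t by apply: le_trans (expR_ge1Dx t); lra.
have en : expR (- t) <= expR t / 2.
  rewrite expRN; apply: (@le_trans _ _ 1); last lra.
  by rewrite invf_le1 ?expR_gt0//; lra.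
apply: (le_trans h); rewrite /Defs.sinh; lra.
Qed.

(** The polynomial decay that replaces the exponential smallness of 1 / sinh^2; 11664 is 108^2. *)
Lemma sqr_coth_decay (t t0 : R) : 1 <= t0 -> t0 <= t ->
  (coth t ^+ 2 - 1) * t ^+ 2 <= 11664 / t0 ^+ 2.
Proof.
move=> t01 tt; have t1 : 1 <= t by lra.
have tp : 0 < t by lra.
have s0 := sinh_gt0 tp.
rewrite sqr_coth// addrAC subrr add0r mulrC ler_pdivrMr ?exprn_gt0//.
have c3 := cube_le_sinh t1.
have c6 : (t ^+ 3) ^+ 2 <= (108 * sinh t) ^+ 2.
  have s108 : 0 <= 108 * sinh t by lra.
  have t3 : 0 <= t ^+ 3 by rewrite exprn_ge0// ltW.
  by rewrite ler_pXn2r ?nnegrE.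
rewrite mulrAC ler_pdivlMr ?exprn_gt0//; last lra.
apply: (@le_trans _ _ (t ^+ 2 * t ^+ 4)).
  rewrite ler_wpM2l ?sqr_ge0//; apply: (@le_trans _ _ (t ^+ 2)).
    by rewrite ler_pXn2r ?nnegrE//; lra.
  by rewrite ler_weXn2l.
have -> : t ^+ 2 * t ^+ 4 = (t ^+ 3) ^+ 2 by ring.
by apply: (le_trans c6); rewrite exprMn; lra.
Qed.

Lemma large_square (A d B : R) : 0 <= A -> 0 < d -> 1 <= B ->
  exists2 x, B <= x & A / x ^+ 2 <= d.
Proof.
move=> A0 d0 B1; have q : 0 <= A / d by rewrite divr_ge0// ltW.
exists (B + A / d); first by rewrite lerDl.
have x1 : 1 <= B + A / d by apply: (le_trans B1); rewrite lerDl.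
have x0 : 0 < B + A / d by apply: lt_le_trans x1.
rewrite ler_pdivrMr ?exprn_gt0// -ler_pdivrMl// mulrC.
apply: (@le_trans _ _ (B + A / d)); first by rewrite lerDr (le_trans ler01).
by rewrite expr2 ler_peMr// ltW.
Qed.

(** Here a = m^2, b = m (m - 1), s = 1 / sinh^2, e = [eta], f = [eta2], g = [gcomp1]. The left side
    is the square of the conjugated operator minus a^2 t^2 e^2, up to a common factor. The main term
    a / 2 is 2 a / 4 from the [- e / 4]; a large [L] controls e f and a small [K] everything else,
    each within d / 4. *)
Lemma energy_key (a b d L s K e f g t : R) : 0 <= a -> 0 <= b -> 0 <= d -> 1 <= L ->
  0 <= s -> s <= 1 -> s <= s * t ^+ 2 -> s * t ^+ 2 <= 5832 * K -> 0 <= K ->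
  - (e * f) <= 32 * e ^+ 2 -> f ^+ 2 <= 10000 * e ^+ 2 + g -> 64 * a / L ^+ 2 <= d / 4 ->
  t^-1 ^+ 2 <= K / 2 ->
  (10001 + (65 * b + 2 * a * b + b ^+ 2) * 5832) * K <= d / 4 ->
  t^-1 ^+ 2 * (f / L ^+ 2 - e / 4) ^+ 2 - 2 * (a + b * s) * (f / L ^+ 2 - e / 4) * e
   + (2 * a * b * s + b ^+ 2 * s ^+ 2) * t ^+ 2 * e ^+ 2
  <= (a / 2 + d / 2) * e ^+ 2 + K * g.
Proof.
move=> a0 b0 d0 L1 s0 s1 st sK K0 ef ff aL tK bK.
have i0 : 0 <= L^-1 ^+ 2 by exact: sqr_ge0.
have i1 : L^-1 ^+ 2 <= 1.
  by rewrite exprVn invf_le1 ?exprn_gt0 ?(lt_le_trans ltr01)// expr_ge1// (le_trans ler01).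
have e2 := sqr_ge0 e.
rewrite -!exprVn in aL *; move: (L^-1 ^+ 2) i0 i1 aL => l l0 l1 aL.
have X2 : (f * l - e / 4) ^+ 2 <= 2 * f ^+ 2 + e ^+ 2 / 8.
  have h := sqr_ge0 (f * l + e / 4).
  have h2 : (f * l) ^+ 2 <= f ^+ 2 by rewrite exprMn ler_piMr ?sqr_ge0// expr_le1.
  have -> : (f * l - e / 4) ^+ 2 = 2 * (f * l) ^+ 2 + e ^+ 2 / 8 - (f * l + e / 4) ^+ 2 by field.
  by move: h h2; lr.
have T1 : t^-1 ^+ 2 * (f * l - e / 4) ^+ 2 <= K * (10001 * e ^+ 2 + g).
  apply: (@le_trans _ _ (K / 2 * (2 * f ^+ 2 + e ^+ 2 / 8))).
    by apply: ler_pM => //; exact: sqr_ge0.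
  have -> : K / 2 * (2 * f ^+ 2 + e ^+ 2 / 8) = K * (f ^+ 2 + e ^+ 2 / 16) by field.
  by apply: ler_wpM2l; [exact: K0|move: ff e2; lr].
have A0 : 0 <= a + b * s by rewrite addr_ge0// mulr_ge0.
have T2 : - (2 * (a + b * s) * (f * l - e / 4) * e) <= 2 * (a + b * s) * ((32 * l + 1 / 4) * e ^+ 2).
  have -> : - (2 * (a + b * s) * (f * l - e / 4) * e) = 2 * (a + b * s) * (- (e * f) * l + e ^+ 2 / 4) by field.
  apply: ler_wpM2l; first by rewrite mulr_ge0.
  by move: (ler_wpM2r l0 ef); lr.
have ab0 := mulr_ge0 a0 b0; have bb0 := sqr_ge0 b.
have s2 : s ^+ 2 * t ^+ 2 <= 5832 * K.
  apply: (le_trans _ sK); rewrite expr2 -mulrA ler_piMl//.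
  by apply: le_trans st.
have U1 : (2 * a * b * s + b ^+ 2 * s ^+ 2) * t ^+ 2 <= (2 * a * b + b ^+ 2) * (5832 * K).
  have -> : (2 * a * b * s + b ^+ 2 * s ^+ 2) * t ^+ 2 = 2 * (a * b) * (s * t ^+ 2) + b ^+ 2 * (s ^+ 2 * t ^+ 2) by ring.
  have -> : (2 * a * b + b ^+ 2) * (5832 * K) = 2 * (a * b) * (5832 * K) + b ^+ 2 * (5832 * K) by ring.
  by apply: lerD; apply: ler_wpM2l => //; rewrite mulr_ge0.
have U2 : 2 * (a + b * s) * (32 * l + 1 / 4) <= 64 * a * l + a / 2 + 65 * b * (5832 * K).
  have bs : b * s <= b * (5832 * K) by apply: ler_wpM2l => //; exact: le_trans sK.
  have bsl : b * s * l <= b * s by rewrite ler_piMr// mulr_ge0.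
  have bk0 : 0 <= b * s by rewrite mulr_ge0.
  have -> : 2 * (a + b * s) * (32 * l + 1 / 4) = 64 * a * l + a / 2 + 64 * (b * s * l) + b * s / 2 by field.
  by move: bs bsl bk0; lr.
have V : 10001 * K + 2 * (a + b * s) * (32 * l + 1 / 4) + (2 * a * b * s + b ^+ 2 * s ^+ 2) * t ^+ 2 <= a / 2 + d / 2.
  by move: U1 U2 bK aL; lr.
have W := ler_wpM2r e2 V.
have fin (x1 y q r z E rhs : R) : x1 <= K * (10001 * E + g) -> - y <= q * (r * E) ->
    (10001 * K + q * r + z) * E <= rhs * E -> x1 - y + z * E <= rhs * E + K * g.
  clear; intros; lra.
exact: fin T1 T2 W.
Qed.

(** The surplus d / 2 on the left later gives strictness, and the term with [th] is a divergence
    that integrates to zero. *)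
Lemma energy_estimate (m d R0 : R) : 1 <= m -> 0 < d -> 0 <= R0 ->
  exists L T th : R, [/\ 1 <= L, R0 <= expR T & forall t, 0 < t ->
    (eta L T t != 0 -> expR T <= t) /\
    (phi2 m L T t + 2 * m * coth t * phi1 m L T t) ^+ 2 + d / 2 * (phi m L T t ^+ 2 / t ^+ 2)
    <= m ^+ 4 * phi m L T t ^+ 2 + (m ^+ 2 / 2 + d) * (phi m L T t ^+ 2 / t ^+ 2)
       + th * (hflux1 m L T t + 2 * m * coth t * hflux m L T t) ].
Proof.
move=> m1 d0 R00.
have [a aE] : exists a, a = m ^+ 2 by eexists.
have [b bE] : exists b, b = m * (m - 1) by eexists.
have a0 : 0 <= a by rewrite aE sqr_ge0.
have b0 : 0 <= b by rewrite bE; apply: mulr_ge0; rewrite ?subr_ge0// (le_trans ler01).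
(* Twice the bracket required by [energy_key], since [K] will be 2 / t0^2. *)
have M10 : 0 <= 20002 + (65 * b + 2 * a * b + b ^+ 2) * 11664.
  by move: (mulr_ge0 a0 b0) (sqr_ge0 b) (b0); lr.
have a64 : 0 <= 64 * a by rewrite mulr_ge0.
have d4 : 0 < d / 4 by rewrite divr_gt0.
have [L L1 LL] := large_square a64 d4 (lexx 1).
have R01 : 1 <= 1 + R0 by rewrite lerDl.
have [t0 t0R TT] := large_square M10 d4 R01.
have t01 : 1 <= t0 by apply: le_trans t0R.
have t0p : 0 < t0 by apply: lt_le_trans t01.
have Lp : 0 < L by apply: lt_le_trans L1.
exists L, (ln t0), (2 / t0 ^+ 2); rewrite lnK ?posrE//; split => //.
  by apply: le_trans t0R; rewrite lerDr.
move=> t tp; have tn0 : t != 0 by rewrite gt_eqF.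
have far : 0 < tau L (ln t0) t -> t0 <= t.
  rewrite /tau => h; have : 0 < ln t - ln t0 by move: h; rewrite pmulr_lgt0// invr_gt0.
  by rewrite subr_gt0 ltr_ln ?posrE// => /ltW.
split.
  move=> e0; apply: far; apply: contraNT e0; rewrite -leNgt => tau0.
  rewrite (let: And5 e _ _ _ _ := @eta_out _ L (ln t0) t _ in e)//.
  by move=> /andP[]; rewrite ltNge tau0.
rewrite (radial_laplacian m (ln t0) L1 tp).
have [H|H] := pselect (0 < tau L (ln t0) t < 1); last first.
  have [e0 _ e2 e3 e4] := @eta_out _ L (ln t0) t H.
  rewrite /phi /hflux /hflux1 e0 e2 e3 e4.
  by rewrite !(mul0r, mulr0, subrr, addr0, expr0n)/= ?(mul0r, mulr0, addr0, subrr).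
have tt0 : t0 <= t by case/andP: H => /far.
have t1 : 1 <= t by exact: le_trans tt0.
have tt1 : 1 <= t ^+ 2 by rewrite expr_ge1// ltW.
have [b1 b2] := @eta_bounds _ L (ln t0) t.
have sg := sqr_coth_decay t01 tt0.
have c1 : 0 <= coth t ^+ 2 - 1 by rewrite sqr_coth// addrAC subrr add0r invr_ge0 sqr_ge0.
have q := sqr_qfac tp; set Q := qfac t in q *.
rewrite /phi -/Q; set S := sfac m t; rewrite /hflux1 /hflux -/S.
set e := eta _ _ _ in b1 b2 *; set f := eta2 _ _ _ in b1 b2 *.
set g := gcomp1 _ _ _ in b2 *; set g0 := gcomp _ _ _.
set s := coth t ^+ 2 - 1 in sg c1 *.
have [K KE] : exists K, K = 2 / t0 ^+ 2 by eexists.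
rewrite -KE; have K0 : 0 < K by rewrite KE divr_gt0// exprn_gt0.
have s1 : s <= s * t ^+ 2 by rewrite ler_peMr.
have s2 : s * t ^+ 2 <= 5832 * K by rewrite KE; move: sg; lr.
have s3 : s <= 1.
  apply: (@le_trans _ _ (t^-1 ^+ 2)); last by rewrite exprVn invf_le1 ?exprn_gt0.
  by rewrite /s sqr_coth// addrAC subrr add0r ltW// invr_sqr_sinh_lt.
pose X := f / L ^+ 2 - e / 4.
have key : t^-1 ^+ 2 * X ^+ 2 - 2 * (a + b * s) * X * e + (2 * a * b * s + b ^+ 2 * s ^+ 2) * t ^+ 2 * e ^+ 2
    <= (a / 2 + d / 2) * e ^+ 2 + K * g.
  apply: (energy_key a0 b0 (ltW d0) L1 c1 s3 s1 s2 _ b1 b2 LL) => //.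
  - exact: ltW.
  - by rewrite exprVn KE mulrC mulKf ?pnatr_eq0// lef_pV2 ?posrE ?exprn_gt0// ler_pXn2r ?nnegrE ?(ltW t0p) ?(ltW tp).
  - by rewrite KE; move: TT; lr.
rewrite -subr_ge0.
rewrite (_ : _ - _ = S ^+ 2 / t * ((a / 2 + d / 2) * e ^+ 2 + K * g -
  (t^-1 ^+ 2 * X ^+ 2 - 2 * (a + b * s) * X * e + (2 * a * b * s + b ^+ 2 * s ^+ 2) * t ^+ 2 * e ^+ 2))).
  by rewrite mulr_ge0 ?subr_ge0// divr_ge0 ?sqr_ge0// ltW.
have -> : (S * Q * (t^-1 ^+ 2 * (f / L ^+ 2 - e / 4) - (m ^+ 2 + m * (m - 1) * s) * e)) ^+ 2 =
  S ^+ 2 * t * (t^-1 ^+ 2 * (f / L ^+ 2 - e / 4) - (m ^+ 2 + m * (m - 1) * s) * e) ^+ 2.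
  by rewrite -[X in S ^+ 2 * X * _]q; ring.
have -> : (S * Q * e) ^+ 2 = S ^+ 2 * t * e ^+ 2 by rewrite -[X in S ^+ 2 * X * _]q; ring.
by rewrite /X aE bE; field; rewrite (gt_eqF Lp) tn0.
Qed.

End Energy.

(** * Optimality of the constants *)

Section Annulus.
Variables (R : realType) (N : nat) (o : 'rV[R]_N).
Hypotheses (oH : inH o) (N5 : (5 <= N)%N).
Local Notation V := 'rV[R]_N.
Local Notation gam := (@gam R N).
Local Notation Hball := (@Hball R N).
Local Notation Hpunct := (Hpunct o).
Local Notation r := (rdist o).
Implicit Types x : V.

Let N2 : (2 <= N)%N. Proof. exact: leq_trans N5. Qed.
Let oP : open Hpunct := @open_Hpunct R N o.
Let PH : Hpunct `<=` Hball := @HpunctH R N o.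

(* The closed ball [{r <= b}], written without division so that closedness in
   the ambient space is visible. *)
Definition closed_hball (b : R) : set V :=
  [set x | 2 * eucl2 (x - o) <= (cosh b - 1) * (1 - eucl2 x) * (1 - eucl2 o)]
  `&` [set x | eucl2 x <= 1].

Lemma Cn_eucl2_sub (c : V) n : Cn n setT (fun x => eucl2 (x - c)).
Proof.
have oT : open [set: V] := openT.
apply: Cn_bigsum => // i.
have := Cn_exp 2 oT (Cn_add oT (Cn_coord n i oT) (Cn_cst n (- c ord0 i) oT)).
by apply: Cn_ext => // y _; rewrite !mxE.
Qed.

Lemma closed_closed_hball b : closed (closed_hball b).
Proof.
have oT : open [set: V] := openT; have e0 : Cn 0 setT (@eucl2 R N) := Cn_eucl2 0 oT.
apply: closedI.
  pose F x : R := 2 * eucl2 (x - o) + - ((cosh b - 1) * (1 + - eucl2 x) * (1 - eucl2 o)).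
  rewrite (_ : [set x | _] = F @^-1` [set t | t <= 0]); last first.
    by apply/seteqP; split => x /=; rewrite /F subr_le0.
  have FC : Cn 0 setT F.
    have c (k : R) : Cn 0 setT (fun _ : V => k) := Cn_cst 0 k oT.
    have F1 := Cn_mul oT (c 2) (Cn_eucl2_sub o 0).
    have F2 := Cn_mul oT (c (cosh b - 1)) (Cn_add oT (c 1) (Cn_opp oT e0)).
    exact: (Cn_add oT F1 (Cn_opp oT (Cn_mul oT F2 (c (1 - eucl2 o))))).
  by apply: preimage_closed => [x _|]; [exact: (CnE FC)|exact: closed_le].
rewrite (_ : [set x | _] = @eucl2 R N @^-1` [set t | t <= 1])//.
by apply: preimage_closed => [x _|]; [exact: (CnE e0)|exact: closed_le].
Qed.

(** On the unit sphere the right side of the first condition is zero, which forces [x = o], a point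
    of the open ball. *)
Lemma closed_hballH b : closed_hball b `<=` Hball.
Proof.
move=> x [/= H1 H2]; rewrite /Hball/= /inH lt_neqAle H2 andbT; apply/eqP => E.
move: H1; rewrite E subrr mulr0 mul0r => H1.
have e0 : eucl2 (x - o) = 0 by have := eucl2_ge0 (x - o); lra.
have xo : x - o = 0 by apply: contrapT => /eqP/eucl2_gt0; rewrite e0 ltxx.
by move: oH; rewrite /inH -(subr0_eq xo) E ltxx.
Qed.

Lemma rdist_closed_hball b x : Hpunct x -> 0 < b -> ~ closed_hball b x -> b <= r x.
Proof.
move=> xP b0 H; rewrite leNgt; apply/negP => rb; apply: H.
have xH := PH xP; split; last exact: ltW.
have c : chd o x <= cosh b by rewrite -(cosh_rdist oH xP) le_cosh ?ltW// rdist_gt0.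
have w : 0 < (1 - eucl2 x) * (1 - eucl2 o) by rewrite mulr_gt0// subr_gt0.
by move: c; rewrite /chd addrC -lerBrDr ler_pdivrMr//= mulrA.
Qed.

Lemma compact_closed_hball b : compact (closed_hball b).
Proof.
apply: (subclosed_compact _ (@compact_boxV R N 0 1)); first exact: closed_closed_hball.
by move=> x /closed_hballH; exact: Hball_box.
Qed.

Section Patch.
Variables (a b : R) (G : V -> R).
Hypotheses (a0 : 0 < a) (b0 : 0 < b).
Hypothesis G0 : forall x, Hpunct x -> ~ (a < r x < b) -> G x = 0.
Local Notation u := (zpatch Hpunct G).

Lemma zpatch_out x : (~` closed_hball b) x -> u x = 0.
Proof.
move=> xK; rewrite /zpatch; case: asboolP => // xP; apply: G0 => //.
by apply/negP; rewrite negb_and -!leNgt (rdist_closed_hball xP b0 xK) orbT.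
Qed.

Lemma zpatch_near x : (Hball `&` [set x | chd o x < cosh a]) x -> u x = 0.
Proof.
move=> [xH xc]; rewrite /zpatch; case: asboolP => // xP; apply: G0 => //.
by apply/negP; rewrite negb_and -!leNgt (rdist_le_chd oH a0 xP xc).
Qed.

Lemma Cn_zpatch n : Cn n Hpunct G -> Cn n setT u.
Proof.
move=> GC.
have z (D : set V) : open D -> (forall x, D x -> u x = 0) -> Cn n D u.
  by move=> oD z0; apply: (Cn_ext oD (f := fun=> 0)) => [y /z0 ->//|]; exact: Cn_cst.
apply: Cn_local => x _.
have [xK|xK] := pselect (closed_hball b x); last first.
  exists (~` closed_hball b); split => //; apply: z; last exact: zpatch_out.
  by rewrite openC; exact: closed_closed_hball.
have xH := closed_hballH xK.
have [->|xo] := eqVneq x o.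
  exists (Hball `&` [set x | chd o x < cosh a]); split; first exact: near_center.
  by apply: z; [exact: (open_chd_lt oH)|exact: zpatch_near].
exists Hpunct; split; first by split => //; exact/eqP.
by apply: Cn_ext GC => // y yP; rewrite /zpatch asboolT.
Qed.

Lemma zpatch_Cc : (forall n, Cn n Hpunct G) -> Cc_inf_H u.
Proof.
move=> GC.
have KK : closure [set x | u x != 0] `<=` closed_hball b.
  have cl := (closure_id _).1 (@closed_closed_hball b); rewrite [X in _ `<=` X]cl.
  apply: closureS => x /= ux; apply: contrapT => /zpatch_out u0.
  by rewrite u0 eqxx in ux.
split; first by apply/smoothP => n; exact: Cn_zpatch.
split; last by move=> x /KK; exact: closed_hballH.
by apply: subclosed_compact KK; [exact: closed_closure|exact: compact_closed_hball].
Qed.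

Lemma zpatch_box x : ~ boxV (0 : V) 1 x -> u x = 0.
Proof. by move=> xB; apply: zpatch_out => xK; apply: xB; apply: Hball_box; exact: closed_hballH xK. Qed.

Lemma dpart_zpatch_off i x : ~ Hpunct x -> dpart i u x = 0.
Proof.
move=> xP; have [xK|xK] := pselect (closed_hball b x); last first.
  have oK : open (~` closed_hball b) by rewrite openC; exact: closed_closed_hball.
  by rewrite (dpart_open (g := fun=> 0) i oK xK zpatch_out); exact: derive_cst.
have -> : x = o by apply: contrapT => xo; apply: xP; split => //; exact: closed_hballH xK.
by rewrite (dpart_open (g := fun=> 0) i (open_chd_lt oH (y := cosh a)) (near_center oH a0) zpatch_near); exact: derive_cst.
Qed.

End Patch.

Lemma div_radial (h h1 : R -> R) x : Hpunct x -> Cn 1 Hpunct (fun y => h (r y)) ->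
  (forall t : R, 0 < t -> is_derive t (1 : R) h (h1 t)) ->
  \sum_(i < N) dpart i (fun y => conf y ^+ (N - 2) * (h (r y) * dpart i r y)) x =
  conf x ^+ N * (h1 (r x) + (N%:R - 1) * coth (r x) * h (r x)).
Proof.
move=> xP hC hd; rewrite (div_grad oP PH N2 xP hC (Cn_rdist oH 2)).
rewrite (LB_rdist oH N2 xP) (gam_comp r xP (Cn_rdist oH 1) (hd _ (rdist_gt0 oH xP))).
by rewrite (gam_rdist oH xP); congr (_ * _); ring.
Qed.

Lemma dpart_radial (h h1 : R -> R) i x : Hpunct x ->
  (forall t : R, 0 < t -> is_derive t (1 : R) h (h1 t)) ->
  dpart i (fun y => h (r y)) x = h1 (r x) * dpart i r x.
Proof.
move=> xP hd; apply: dpart_is_derive.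
exact: is_derive_comp (hd _ (rdist_gt0 oH xP)) (Cn_is_derive i (Cn_rdist oH 1) xP).
Qed.

Lemma LB_radial (h h1 h2 : R -> R) x : Hpunct x -> Cn 2 Hpunct (fun y => h (r y)) ->
  (forall t : R, 0 < t -> is_derive t (1 : R) h (h1 t)) ->
  (forall t : R, 0 < t -> is_derive t (1 : R) h1 (h2 t)) ->
  LB (zpatch Hpunct (fun y => h (r y))) x = h2 (r x) + (N%:R - 1) * coth (r x) * h1 (r x).
Proof.
move=> xP hC hd h1d.
(* [h1] of r is the bracket of [h] of r with r, so its regularity is inherited from [h]. *)
have h1C : Cn 1 Hpunct (fun y => h1 (r y)).
  apply: Cn_ext (Cn_gam oP PH hC (Cn_rdist oH 2)) => // y yP.
  rewrite (gam_comp r yP (Cn_rdist oH 1) (hd _ (rdist_gt0 oH yP))).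
  by rewrite (gam_rdist oH yP) mulr1.
rewrite /LB (_ : \sum_(i < N) _ = conf x ^+ N * (h2 (r x) + (N%:R - 1) * coth (r x) * h1 (r x))).
  by rewrite mulKf// expf_neq0// conf_neq0//; exact: PH.
rewrite -(div_radial xP h1C h1d); apply: eq_bigr => i _.
apply: (dpart_open _ oP xP) => y yP; congr (_ * _).
rewrite -(dpart_radial i yP hd); apply: (dpart_open _ oP yP) => z zP.
by rewrite /zpatch asboolT.
Qed.

Lemma exists_rdist (rho : R) : 0 < rho -> exists2 x, Hpunct x & r x = rho.
Proof.
move=> rho0; have Y1 := cosh_gt1 rho0; set Y := cosh rho in Y1.
have N0 : (0 < N)%N by exact: leq_trans N2.
pose i0 := Ordinal N0; pose a := o ord0 i0; pose w := 1 - eucl2 o.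
have w0 : 0 < w by rewrite subr_gt0.
pose p (t : R) := o + t *: ebase R i0.
have pE t : eucl2 (p t) = eucl2 o + 2 * t * a + t ^+ 2.
  rewrite /eucl2 (bigD1 i0)//= [in RHS](bigD1 i0)//= !mxE !eqxx mulr1.
  rewrite (eq_bigr (fun i => o ord0 i ^+ 2)) => [|i ii0]; last first.
    by rewrite !mxE (negbTE ii0) andbF mulr0 addr0.
  by rewrite -/a; ring.
have poE t : eucl2 (p t - o) = t ^+ 2.
  rewrite /p addrAC subrr add0r /eucl2 (bigD1 i0)//= !mxE !eqxx mulr1 big1 ?addr0// => i ii0.
  by rewrite !mxE (negbTE ii0) andbF mulr0 expr0n.
(* The equation cosh r = Y on the ray o + t e, cleared of denominators so as to be continuous past
   the boundary. At t = 0 it is negative; at t = 2 the ray has left the ball and it is positive. A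
   zero is automatically inside the ball. *)
pose g t := 2 * t ^+ 2 - (Y - 1) * (1 - (eucl2 o + 2 * t * a + t ^+ 2)) * w.
have cg : {within `[(0 : R), 2], continuous g}.
  apply: continuous_subspaceT => t.
  suff [d] : exists d, is_derive t (1 : R) g d by exact: is_derive_continuous.
  by eexists; rewrite /g; der.
have a1 : a ^+ 2 <= eucl2 o.
  by rewrite /eucl2 (bigD1 i0)//= lerDl; apply: sumr_ge0 => i _; exact: sqr_ge0.
have g0 : g 0 < 0.
  rewrite /g expr0n /= !mulr0 mul0r !addr0 sub0r oppr_lt0 mulr_gt0// mulr_gt0//.
  by rewrite subr_gt0.
have g2 : 0 < g 2.
  rewrite /g; have : 1 <= eucl2 o + 2 * 2 * a + 2 ^+ 2.
    have : -1 < a; last by nra.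
    by have := oH; rewrite /inH; nra.
  set q := eucl2 o + _ + _ => q1.
  have : 0 <= (Y - 1) * (q - 1) * w by rewrite !mulr_ge0 ?subr_ge0// ltW.
  have -> : (Y - 1) * (1 - q) * w = - ((Y - 1) * (q - 1) * w) by ring.
  by move: ((Y - 1) * (q - 1) * w) => z z0; lra.
have /(IVT (ler0n R 2) cg) [t tI gt] : Num.min (g 0) (g 2) <= 0 <= Num.max (g 0) (g 2).
  by rewrite ge_min (ltW g0) le_max (ltW g2) orbT.
have t0 : t != 0 by apply/eqP => t0; move: g0; rewrite -{1}t0 gt ltxx.
have t2 : 0 < t ^+ 2 by rewrite exprn_even_gt0.
have Yw : 0 < (Y - 1) * w by rewrite mulr_gt0// subr_gt0.
have E : 2 * t ^+ 2 = (Y - 1) * (1 - eucl2 (p t)) * w.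
  by rewrite pE; apply/eqP; rewrite -subr_eq0; apply/eqP; exact: gt.
have pH : inH (p t).
  rewrite /inH -subr_gt0 -(pmulr_rgt0 _ Yw).
  have -> : (Y - 1) * w * (1 - eucl2 (p t)) = 2 * t ^+ 2 by rewrite E; ring.
  by move: t2; move: (t ^+ 2) => s; lra.
have pP : Hpunct (p t).
  by split => //= po; move: (poE t); rewrite po subrr => e; move: t2; rewrite -e /eucl2 big1 ?ltxx// => i _; rewrite mxE expr0n.
have cY : cosh (r (p t)) = Y.
  rewrite (cosh_rdist oH pP) /chd poE E -/w.
  have n1 : 1 - eucl2 (p t) != 0 by rewrite subr_eq0 gt_eqF.
  by field; rewrite n1 gt_eqF.
by exists (p t) => //; rewrite /rdist; have := acosh_cosh rho0; rewrite -/Y -cY (cosh_rdist oH pP).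
Qed.

End Annulus.

(** * Finiteness and positivity of integrals *)

Section HyperbolicIntegrals.
Variables (R : realType) (N : nat) (o : 'rV[R]_N) (u : 'rV[R]_N -> R).
Hypotheses (oH : inH o) (N5 : (5 <= N)%N) (uc : Cc_inf_H u).
Local Notation V := 'rV[R]_N.
Local Notation BV := (borelV R N).
Local Notation mu := (@muV R N).
Local Notation Hball := (@Hball R N).
Local Notation Hpunct := (Hpunct o).
Local Notation r := (rdist o).
Local Notation K := (closure [set x | u x != 0]).
Local Open Scope ereal_scope.
Implicit Types x : V.
Let oP : open Hpunct := @open_Hpunct R N o.
Let PH : Hpunct `<=` Hball := @HpunctH R N o.
Let uC n D : Cn n D u := Cc_Cn uc n D.

Lemma hint_quotientE :
  pos_meas (fun x => if `[< Hpunct x >] then (hdens (fun x => u x ^+ 2 / r x ^+ 2)%R x)%:E else 0) /\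
  hint (fun x => u x ^+ 2 / r x ^+ 2)%R =
  \int[mu]_x (if `[< Hpunct x >] then (hdens (fun x => u x ^+ 2 / r x ^+ 2)%R x)%:E else 0).
Proof.
have rC := Cn_rdist oH 0.
apply: hintE.
- by move=> x xP; rewrite mulr_ge0 ?sqr_ge0// invr_ge0 sqr_ge0.
- apply: (Cn_mul oP (Cn_exp 2 oP (uC 0 _))); apply: (Cn_inv oP _ (Cn_exp _ oP rC)) => x xP.
  by rewrite expf_neq0// gt_eqF// (rdist_gt0 oH).
- by rewrite rdisto expr0n/= invr0 mulr0.
Qed.

Lemma LB_suppC x : (~` K) x -> LB u x = 0%R.
Proof.
move=> xK; rewrite /LB big1 ?mulr0// => i _.
rewrite (dpart_open (g := fun=> 0%R) i (@open_suppC R N u) xK); first exact: derive_cst.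
by move=> y yK; rewrite (suppC_dpart i yK) mulr0.
Qed.

(** Finiteness is what makes adding a positive quantity a strict increase in the extended reals. *)
Lemma hint_LB_fin_num : hint (fun x => LB u x ^+ 2)%R \is a fin_num.
Proof.
rewrite (LB_int uc); have pl := pos_meas_lint uc.
have [k k0 Hk] : exists2 k : R, (0 <= k)%R & forall x, K x -> (`|ldens u x| <= k)%R.
  apply: (supp_bounded uc) => x xK; apply: (CnE (Cn_ldens uc)).
  exact: supp_Hball xK.
have [pb Eb] := @integral_box_cst R N 0%R k 1%R k0 ler01.
rewrite ge0_fin_numE; last by apply: integral_ge0 => x _; exact: pl.1.
apply: (@le_lt_trans _ _ (\int[mu]_x (k * \1_(boxV (0%R : V) 1) x)%:E)); last by rewrite Eb ltry.
apply: ge0_le_integral => //.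
- by move=> x _; exact: pl.1.
- exact: pl.2.
- exact: pb.2.
- move=> x _; rewrite /lint; case: asboolP => xH; last exact: pb.1.
  rewrite lee_fin indicE mem_set ?mulr1; last exact: Hball_box.
  have [xK|xK] := pselect (K x); first by apply: le_trans (Hk x xK); exact: ler_norm.
  by rewrite /ldens (LB_suppC xK) expr0n mul0r.
Qed.

Lemma integral_patch_gt0 (D : set V) (f : V -> R) x1 : open D ->
  (forall x, D x -> {for x, continuous f}) -> (forall x, D x -> (0 <= f x)%R) -> D x1 ->
  (0 < f x1)%R -> 0 < \int[mu]_x (if `[< D x >] then (f x)%:E else 0).
Proof.
move=> oD cf f0 Dx1 f1.
have pf := pos_meas_patch oD cf f0.
have oB : nbhs x1 (D `&` [set x | (f x1 / 2 < f x)%R]).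
  apply: filterI; first exact: open_nbhs_nbhs.
  apply: (cf x1 Dx1 [set t : R | (f x1 / 2 < t)%R]); apply: open_nbhs_nbhs; split; first exact: open_gt.
  by rewrite /= ltr_pdivrMr// mulr_natr mulr2n ltrDl.
have /nbhs_ballP[e /= e0 He] := oB.
have e20 : (0 <= e / 2)%R by rewrite divr_ge0// ltW.
have k0 : (0 <= f x1 / 2)%R by rewrite divr_ge0// ltW.
have [pb Eb] := @integral_box_cst R N x1 (f x1 / 2)%R (e / 2)%R k0 e20.
apply: (@lt_le_trans _ _ (\int[mu]_x (f x1 / 2 * \1_(boxV x1 (e / 2)) x)%:E)).
  by rewrite Eb lte_fin mulr_gt0 ?divr_gt0// exprn_gt0// pmulrn_lgt0// divr_gt0.
apply: ge0_le_integral => //.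
- by move=> x _; exact: pb.1.
- exact: pb.2.
- exact: pf.2.
- move=> x _; have [xb|xb] := pselect (boxV x1 (e / 2) x); last first.
    by rewrite indicE memNset// mulr0; exact: pf.1.
  have [Dx fx] : (D `&` [set x | (f x1 / 2 < f x)%R]) x.
    apply: He; split=> [|i j]; first exact: e0.
    rewrite (ord1 i) /ball/= distrC; apply: le_lt_trans (xb j) _.
    by rewrite ltr_pdivrMr// mulr_natr mulr2n ltrDl.
  rewrite asboolT// lee_fin indicE mem_set// mulr1; exact: ltW.
Qed.

End HyperbolicIntegrals.

(** * The test functions on hyperbolic space *)

Section Sharpness.
Variables (R : realType) (N : nat) (o : 'rV[R]_N).
Hypotheses (oH : inH o) (N5 : (5 <= N)%N).
Local Notation V := 'rV[R]_N.
Local Notation BV := (borelV R N).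
Local Notation mu := (@muV R N).
Local Notation Hball := (@Hball R N).
Local Notation Hpunct := (Hpunct o).
Local Notation r := (rdist o).
Local Notation m := (hm R N).
Implicit Types x : V.
Let oP : open Hpunct := @open_Hpunct R N o.
Let PH : Hpunct `<=` Hball := @HpunctH R N o.

Lemma Cn_ln_rdist n : Cn n Hpunct (fun x => ln (r x)).
Proof. by apply: (Cn_ln oP _ (Cn_rdist oH n)) => x; exact: rdist_gt0. Qed.

Lemma Cn_sfac n : Cn n Hpunct (fun x => sfac m (r x)).
Proof.
apply: (Cn_expR oP); apply: (Cn_mul oP (Cn_cst n _ oP)).
by apply: (Cn_ln oP _ (Cn_sinh_rdist oH n)) => x; exact: sinh_rdist_gt0.
Qed.

Variables L T : R.
Hypothesis L1 : 1 <= L.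

Lemma Cn_tau n : Cn n Hpunct (fun x => tau L T (r x)).
Proof.
exact: (Cn_mul oP (Cn_add oP (Cn_ln_rdist n) (Cn_cst n _ oP)) (Cn_cst n _ oP)).
Qed.

Lemma Cn_bumpw n : Cn n Hpunct (fun x => bumpw L T (r x)).
Proof.
have t := Cn_tau n.
exact: (Cn_mul oP t (Cn_add oP (Cn_cst n 1 oP) (Cn_opp oP t))).
Qed.

Lemma Cn_phi n : Cn n Hpunct (fun x => phi m L T (r x)).
Proof.
apply: (Cn_mul oP); last exact: (Cn_flat 1 oP (Cn_bumpw n)).
apply: (Cn_mul oP (Cn_sfac n)).
exact: (Cn_expR oP (Cn_mul oP (Cn_ln_rdist n) (Cn_cst n _ oP))).
Qed.

Lemma Cn_hflux n : Cn n Hpunct (fun x => hflux m L T (r x)).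
Proof.
apply: (Cn_mul oP); last exact: (Cn_exp 2 oP (Cn_sfac n)).
apply: (Cn_mul oP (Cn_cst n _ oP)).
apply: (Cn_mul oP); last exact: (Cn_flat _ oP (Cn_bumpw n)).
apply: (Cn_mul oP); last exact: (Cn_flat 1 oP (Cn_bumpw n)).
have t2 := Cn_mul oP (Cn_cst n 2 oP) (Cn_tau n).
exact: (Cn_add oP (Cn_cst n 1 oP) (Cn_opp oP t2)).
Qed.

Lemma tau_annulus x : Hpunct x -> ~ (expR T < r x < expR (T + L)) -> ~ (0 < tau L T (r x) < 1).
Proof.
move=> xP H /andP[t0 t1]; apply: H; have r0 := rdist_gt0 oH xP.
have L0 : 0 < L by apply: lt_le_trans L1.
move: t0 t1; rewrite /tau pmulr_lgt0 ?invr_gt0// subr_gt0 ltr_pdivrMr// mul1r ltrBlDr addrC => t0 t1.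
by rewrite -[r x]lnK ?posrE// !ltr_expR t0.
Qed.

Definition test_fun : V -> R := zpatch Hpunct (fun x => phi m L T (r x)).

Lemma test_funE x : Hpunct x -> test_fun x = phi m L T (r x).
Proof. by move=> xP; rewrite /test_fun /zpatch asboolT. Qed.

Let phi_out x : Hpunct x -> ~ (expR T < r x < expR (T + L)) -> phi m L T (r x) = 0.
Proof. by move=> xP /(tau_annulus xP)/eta_out[e _ _ _ _]; rewrite /phi e mulr0. Qed.

Lemma test_fun_Cc : Cc_inf_H test_fun.
Proof.
exact: (zpatch_Cc oH (expR_gt0 T) (expR_gt0 (T + L)) phi_out Cn_phi).
Qed.

Lemma test_fun_neq0 : exists2 x, Hpunct x & test_fun x != 0.
Proof.
have L0 : 0 < L by apply: lt_le_trans L1.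
have [x xP rx] := exists_rdist oH N5 (expR_gt0 (T + L / 2)).
exists x => //; rewrite test_funE// rx /phi !mulf_neq0 ?gt_eqF ?expR_gt0//.
apply: flat1_gt0; rewrite /bumpw /tau expRK.
have -> : (T + L / 2 - T) / L = 1 / 2 by field; rewrite gt_eqF.
lra.
Qed.

Lemma LB_test_fun x : Hpunct x ->
  LB test_fun x = phi2 m L T (r x) + 2 * m * coth (r x) * phi1 m L T (r x).
Proof.
move=> xP.
have := LB_radial oH N5 xP (Cn_phi 2) (fun t t0 => is_derive_phi m T L1 t0)
  (fun t t0 => is_derive_phi1 m T L1 t0).
by move=> H; rewrite /test_fun H /hm; congr (_ + _); field.
Qed.

Local Open Scope ereal_scope.

(** The flux terms form the Riemannian divergence of a radial field supported in the annulus, so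
    they disappear on integration; strictness comes from d / 2 times the positive integral of u^2 /
    r^2. *)
Lemma test_fun_energy (d th : R) : (0 < d)%R ->
  (forall t : R, (0 < t)%R ->
    ((phi2 m L T t + 2 * m * coth t * phi1 m L T t) ^+ 2 + d / 2 * (phi m L T t ^+ 2 / t ^+ 2)
    <= m ^+ 4 * phi m L T t ^+ 2 + (m ^+ 2 / 2 + d) * (phi m L T t ^+ 2 / t ^+ 2)
       + th * (hflux1 m L T t + 2 * m * coth t * hflux m L T t))%R) ->
  hint (fun x => LB test_fun x ^+ 2)%R < (m ^+ 4)%:E * hint (fun x => test_fun x ^+ 2)%R
    + (m ^+ 2 / 2 + d)%:E * hint (fun x => test_fun x ^+ 2 / r x ^+ 2)%R.
Proof.
move=> d0 en; have uc := test_fun_Cc; set u := test_fun in uc *.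
have uC n D : Cn n D u := Cc_Cn uc n D.
have [pI EI] := hint_quotientE oH uc.
pose Idens x := if `[< Hpunct x >] then (hdens (fun x => u x ^+ 2 / r x ^+ 2)%R x)%:E else 0.
have rC := Cn_rdist oH.
have rV : Cn 0 Hpunct (fun x => (r x ^+ 2)^-1)%R.
  apply: (Cn_inv oP _ (Cn_exp 2 oP (rC 0%N))) => x xP.
  by rewrite expf_neq0// gt_eqF// (rdist_gt0 oH).
have kC n : Cn n Hpunct (@conf R N) := Cn_sub PH (Cn_conf R N n).
have I0 : 0 < \int[mu]_x Idens x.
  have [x1 x1P ux1] := test_fun_neq0.
  apply: (@integral_patch_gt0 R N Hpunct (hdens (fun x => u x ^+ 2 / r x ^+ 2)%R) x1) => //.
  - move=> x xP.
    exact: (CnE (Cn_mul oP (Cn_mul oP (Cn_exp 2 oP (uC 0%N _)) rV) (Cn_exp N oP (kC 0%N))) xP).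
  - move=> x xP; rewrite mulr_ge0 ?exprn_ge0 ?(ltW (conf_gt0 (PH xP)))//.
    by rewrite mulr_ge0 ?sqr_ge0// invr_ge0 sqr_ge0.
  - apply: mulr_gt0; last by rewrite exprn_gt0// (conf_gt0 (PH x1P)).
    apply: divr_gt0; first by rewrite exprn_even_gt0.
    by rewrite exprn_gt0// (rdist_gt0 oH).
have Lfin := hint_LB_fin_num uc.
apply: (@lt_le_trans _ _ (hint (fun x => LB u x ^+ 2)%R + (d / 2)%:E * \int[mu]_x Idens x)).
  by rewrite lteDl// mule_gt0// lte_fin divr_gt0.
have [pL EL] := @hint_punctE R N o N5 (fun x => LB u x ^+ 2)%R (fun x _ => sqr_ge0 _)
  (Cn_exp 2 (@open_Hball R N) (Cn_LB uc)).
have [pU EU] := @hint_punctE R N o N5 (fun x => u x ^+ 2)%R (fun x _ => sqr_ge0 _)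
  (Cn_exp 2 (@open_Hball R N) (uC 0%N _)).
have m2 := hm_ge2 R N5.
have k0 : (0 <= m ^+ 4)%R by rewrite exprn_ge0//; lra.
have k1 : (0 <= m ^+ 2 / 2 + d)%R by rewrite addr_ge0 ?(ltW d0)// divr_ge0// sqr_ge0.
have k2 : (0 <= d / 2)%R by rewrite divr_ge0// ltW.
have q0 := pos_measZ k0 pU; have q1 := pos_measZ k1 pI; have q2 := pos_measZ k2 pI.
rewrite EL EU EI /Idens -!integral_posZ// -(integral_posD pL q2) -(integral_posD q0 q1).
pose G i y := (conf y ^+ (N - 2) * (- th * hflux m L T (r y) * dpart i r y))%R.
have G0 i x : Hpunct x -> ~ (expR T < r x < expR (T + L))%R -> G i x = 0%R.
  by move=> xP /(tau_annulus xP)/eta_out[_ _ _ e _]; rewrite /G /hflux e mulr0 !mul0r mulr0 mul0r mulr0.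
have hC n : Cn n Hpunct (fun y => - th * hflux m L T (r y))%R.
  exact: (Cn_mul oP (Cn_cst n _ oP) (Cn_hflux n)).
have GC i : Cn 1 Hpunct (G i).
  apply: (Cn_mul oP (Cn_exp _ oP (kC 1%N))); apply: (Cn_mul oP (hC 1%N)).
  exact: Cn_dpart (rC 2%N).
have eT := expR_gt0 T; have eTL := expR_gt0 (T + L).
have E1 i := Cn_zpatch oH eT eTL (G0 i) (GC i).
have E0 i x := @zpatch_box R N o oH _ _ _ eTL (G0 i) x.
apply: (le_integral_divergence ltr01 E1 E0 (pos_measD pL q2) (pos_measD q0 q1)) => x.
case: asboolP => xP; last first.
  rewrite !mule0 !adde0 big1 ?adde0// => i _.
  exact: (dpart_zpatch_off oH eT eTL (G0 i)).
have k3 : (0 < conf x ^+ N)%R by rewrite exprn_gt0// (conf_gt0 (PH xP)).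
have r0 := rdist_gt0 oH xP.
have -> : (\sum_(i < N) dpart i (zpatch Hpunct (G i)) x = conf x ^+ N *
    (- th * hflux1 m L T (r x) + (N%:R - 1) * coth (r x) * (- th * hflux m L T (r x))))%R.
  have hd (t : R) : (0 < t)%R -> is_derive t (1 : R)%R (fun t => - th * hflux m L T t)%R (- th * hflux1 m L T t)%R.
    by move=> t0; have dh := is_derive_hflux m T L1 t0; der_eq; ring.
  rewrite -(div_radial oH N5 xP (hC 1%N) hd).
  apply: eq_bigr => i _; apply: (dpart_open _ oP xP) => y yP.
  by rewrite /zpatch asboolT.
rewrite -!EFinM -!EFinD lee_fin /hdens LB_test_fun// [u x]test_funE//.
have := ler_wpM2r (ltW k3) (en _ r0).
have -> : (N%:R - 1 = 2 * m)%R by rewrite /hm; field.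
move: (phi _ _ _ _) (phi1 _ _ _ _) (phi2 _ _ _ _) (hflux _ _ _ _) (hflux1 _ _ _ _) => p p1 p2 h h1.
move: (coth _) (conf x ^+ N)%R (p ^+ 2 / r x ^+ 2)%R => co K q; clear; lra.
Qed.

End Sharpness.

(** * Failure of the inequalities with larger constants *)

Section Optimality.
Variables (R : realType) (N : nat) (o : 'rV[R]_N).
Hypotheses (oH : inH o) (N5 : (5 <= N)%N).
Local Notation V := 'rV[R]_N.
Local Notation mu := (@muV R N).
Local Notation Hball := (@Hball R N).
Local Notation Hpunct := (Hpunct o).
Local Notation r := (rdist o).
Local Notation m := (hm R N).

Lemma almost_optimizer (d R0 : R) : 0 < d -> 0 <= R0 -> exists u : V -> R,
  [/\ Cc_inf_H u, forall x, Hpunct x -> u x != 0 -> R0 <= r x &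
   (hint (fun x => LB u x ^+ 2)%R < (m ^+ 4)%:E * hint (fun x => u x ^+ 2)%R
    + (m ^+ 2 / 2 + d)%:E * hint (fun x => u x ^+ 2 / r x ^+ 2)%R)%E].
Proof.
move=> d0 R00; have m2 := hm_ge2 R N5.
have m1 : 1 <= m by lra.
have [L [T [th [L1 RT en]]]] := energy_estimate m1 d0 R00.
exists (test_fun o L T); split; first exact: test_fun_Cc.
  move=> x xP; rewrite (test_funE _ _ xP) => p0.
  have [+ _] := en (r x) (rdist_gt0 oH xP) => h.
  apply: (le_trans RT); apply: h; apply: contraNneq p0 => e0.
  by rewrite /phi e0 mulr0.
apply: (test_fun_energy oH N5 L1 (th := th) d0) => t t0; exact: (en t t0).2.
Qed.

Lemma hint_quotient_le (u : V -> R) (R0 : R) : Cc_inf_H u -> 0 < R0 ->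
  (forall x, Hpunct x -> u x != 0 -> R0 <= r x) ->
  (hint (fun x => u x ^+ 2 / r x ^+ 2)%R <= (R0 ^+ 2)^-1%:E * hint (fun x => u x ^+ 2)%R)%E.
Proof.
move=> uc R00 uR; have [pI ->] := hint_quotientE oH uc.
have [pU ->] := @hint_punctE R N o N5 (fun x => u x ^+ 2)%R (fun x _ => sqr_ge0 _)
  (Cn_exp 2 (@open_Hball R N) (Cc_Cn uc 0 _)).
have k0 : 0 <= (R0 ^+ 2)^-1 by rewrite invr_ge0 sqr_ge0.
have pk := pos_measZ k0 pU.
rewrite -integral_posZ//.
apply: ge0_le_integral => //.
- by move=> x _; exact: pI.1.
- exact: pI.2.
- exact: pk.2.
- move=> x _; case: asboolP => xP; last by rewrite mule0.
  have k3 := exprn_ge0 N (ltW (conf_gt0 (HpunctH xP))).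
  rewrite -EFinM lee_fin /hdens mulrA ler_wpM2r// mulrC.
  have [->|u0] := eqVneq (u x) 0; first by rewrite expr0n/= !mulr0.
  rewrite ler_wpM2r ?sqr_ge0// lef_pV2 ?posrE ?exprn_gt0 ?(rdist_gt0 oH)//.
  by rewrite ler_pXn2r ?nnegrE ?(ltW R00) ?(ltW (rdist_gt0 oH xP))// uR.
Qed.

Lemma spectral_constant_optimal (C : R) : m ^+ 4 < C -> exists u : V -> R, Cc_inf_H u /\
  (hint (fun x => LB u x ^+ 2)%R < C%:E * hint (fun x => u x ^+ 2)%R)%E.
Proof.
move=> mC; have m2 := hm_ge2 R N5.
have A0 : 0 <= m ^+ 2 / 2 + 1 by rewrite addr_ge0// divr_ge0// sqr_ge0.
(* The excess [d] is fixed at 1; a support beyond [R0] makes the whole u^2 / r^2 term fit into the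
   gap [C - m ^+ 4]. *)
have [R0 R1 HR] : exists2 R0, 1 <= R0 & (m ^+ 2 / 2 + 1) / R0 ^+ 2 <= C - m ^+ 4.
  by apply: large_square => //; rewrite subr_gt0.
have R00 : 0 < R0 by apply: lt_le_trans R1.
have [u [uc uR uE]] := almost_optimizer ltr01 (ltW R00).
exists u; split => //; apply: (lt_le_trans uE).
have U0 : (0 <= hint (fun x => u x ^+ 2)%R)%E.
  have [pU ->] := @hint_punctE R N o N5 (fun x => u x ^+ 2)%R (fun x _ => sqr_ge0 _)
    (Cn_exp 2 (@open_Hball R N) (Cc_Cn uc 0 _)).
  by apply: integral_ge0 => x _; exact: pU.1.
have := hint_quotient_le uc R00 uR.
move: U0; set U := hint (fun x => u x ^+ 2)%R; set I := hint _ => U0 IU.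
apply: (@le_trans _ _ ((m ^+ 4)%:E * U + ((m ^+ 2 / 2 + 1) / R0 ^+ 2)%:E * U)%E).
  by rewrite leeD2l// EFinM -muleA lee_wpmul2l.
have m40 : 0 <= m ^+ 4 by rewrite exprn_ge0//; lra.
have q0 : 0 <= (m ^+ 2 / 2 + 1) / R0 ^+ 2 by rewrite divr_ge0// sqr_ge0.
rewrite -ge0_muleDl ?lee_fin// lee_wpmul2r// -EFinD lee_fin; lra.
Qed.

Lemma potential_constant_optimal (c : R) : m ^+ 2 / 2 < c -> exists u : V -> R, Cc_inf_H u /\
  (hint (fun x => LB u x ^+ 2)%R < (m ^+ 4)%:E * hint (fun x => u x ^+ 2)%R
    + c%:E * hint (fun x => u x ^+ 2 / r x ^+ 2)%R)%E.
Proof.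
(* The excess [d] is the whole gap here, and the support may start anywhere, so [R0] is 0. *)
move=> mc; have d0 : 0 < c - m ^+ 2 / 2 by rewrite subr_gt0.
have [u [uc _ uE]] := almost_optimizer d0 (lexx 0).
by exists u; split => //; rewrite (addrC (m ^+ 2 / 2)) subrK in uE.
Qed.

End Optimality.

Theorem theorem3p1 (R : realType) (N : nat) (o : 'rV[R]_N) :
  (5 <= N)%N -> inH o ->
  let r := fun x : 'rV[R]_N => hdist x o in
  let Nr : R := N%:R in
  (forall u : 'rV[R]_N -> R, Cc_inf_H u ->
     (hint (fun x => (LB u x ^+ 2)%R) >=
        ((Nr - 1) ^+ 4 / 16)%:E * hint (fun x => (u x ^+ 2)%R)
      + ((Nr - 1) ^+ 2 / 8)%:E * hint (fun x => (u x ^+ 2 / r x ^+ 2)%R)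
      + (9 / 16)%:E * hint (fun x => (u x ^+ 2 / r x ^+ 4)%R)
      + ((Nr ^+ 2 - 1) * (Nr - 3) ^+ 2 / 8)%:E
          * hint (fun x => (u x ^+ 2 / sinh (r x) ^+ 2)%R)
      + ((Nr - 1) * (Nr - 3) * (Nr ^+ 2 - 4 * Nr - 3) / 16)%:E
          * hint (fun x => (u x ^+ 2 / sinh (r x) ^+ 4)%R))%E)
  /\
  (forall C : R, (Nr - 1) ^+ 4 / 16 < C ->
     exists u : 'rV[R]_N -> R, Cc_inf_H u /\
       (hint (fun x => (LB u x ^+ 2)%R) < C%:E * hint (fun x => (u x ^+ 2)%R))%E)
  /\
  (forall c : R, (Nr - 1) ^+ 2 / 8 < c ->
     exists u : 'rV[R]_N -> R, Cc_inf_H u /\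
       (hint (fun x => (LB u x ^+ 2)%R) <
          ((Nr - 1) ^+ 4 / 16)%:E * hint (fun x => (u x ^+ 2)%R)
        + c%:E * hint (fun x => (u x ^+ 2 / r x ^+ 2)%R))%E).
Proof.
move=> N5 oH r Nr.
have m4 : (Nr - 1) ^+ 4 / 16 = hm R N ^+ 4 by rewrite /hm /Nr; field.
have m2 : (Nr - 1) ^+ 2 / 8 = hm R N ^+ 2 / 2 by rewrite /hm /Nr; field.
split; first by move=> u uc; exact: rellich_inequality.
rewrite m4 m2; split.
- by move=> C mC; exact: (spectral_constant_optimal oH N5 mC).
- by move=> c; exact: potential_constant_optimal.
Qed.
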